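(* Let $X$ be a reduced equidimensional germ of analytic subspace of codimension $k\ge 1$ in $S=(\mathbb{C}^m,0)$, contained in a reduced complete intersection $C$ of codimension $k$. Then $\mathrm{Hom}_{\mathcal{O}_C}(\mathcal{J}_{X/C},\mathcal{O}_C)\simeq\mathcal{R}_X$. In particular, if $C$ is a reduced complete intersection, then $\mathrm{Hom}_{\mathcal{O}_C}(\mathcal{J}_C,\mathcal{O}_C)=\mathcal{R}_C$ (where $\mathrm{Hom}_{\mathcal{O}_C}(\mathcal{J}_C,\mathcal{O}_C)$ is identified with $\{\rho\in\mathcal{M}_C:\rho\,\mathcal{J}_C\subseteq\mathcal{O}_C\}$).
   Context: $\mathcal{O}_S=\mathbb{C}\{x_1,\ldots,x_m\}$; $\Omega^q$ is the module of germs of holomorphic $q$-forms; $\mathcal{I}_X$ is the radical ideal of $X$; the radical ideal $\mathcal{I}_C\subseteq\mathcal{I}_X$ of $C$ is generated by a regular sequence $(f_1,\ldots,f_k)$; $f=f_1\cdots f_k$; $\mathcal{O}_X=\mathcal{O}_S/\mathcal{I}_X$, $\mathcal{O}_C=\mathcal{O}_S/\mathcal{I}_C$, with total rings of fractions $\mathcal{M}_X,\mathcal{M}_C$. $$\Omega^q(\log X/C)=\Big\{\omega\in\tfrac{1}{f}\Omega^q\ :\ \mathcal{I}_X\,\omega\subseteq\tfrac1f\mathcal{I}_C\Omega^q\ \text{ and }\ dh\wedge\omega\in\tfrac1f\mathcal{I}_C\Omega^{q+1}\text{ for all }h\in\mathcal{I}_X\Big\}.$$ Residues: for every $\omega\in\Omega^k(\log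 X/C)$ there exist $g\in\mathcal{O}_S$ inducing a non zero divisor in $\mathcal{O}_C$, $\xi\in\mathcal{O}_S$ and $\eta\in\frac1f\mathcal{I}_C\Omega^k$ with $g\omega=\frac{df_1\wedge\cdots\wedge df_k}{f}\,\xi+\eta$; put $\mathrm{res}_{X/C}(\omega)=\frac{\xi}{g}\big|_X\in\mathcal{M}_X$ (well defined). $\mathcal{R}_X=\mathrm{res}_{X/C}(\Omega^k(\log X/C))\subseteq\mathcal{M}_X$; for $X=C$ this is $\mathcal{R}_C\subseteq\mathcal{M}_C$. $\mathcal{J}_C\subseteq\mathcal{O}_C$ is the ideal generated by the $k\times k$ minors of the Jacobian matrix of $(f_1,\ldots,f_k)$, and $\mathcal{J}_{X/C}\subseteq\mathcal{O}_X$ is the image of $\mathcal{J}_C$ in $\mathcal{O}_X$, considered as an $\mathcal{O}_C$-module. *)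

(* Defs.v *)
From HB Require Import structures.
From mathcomp Require Import all_boot all_order all_algebra.
From mathcomp Require Import complex boolp classical_sets functions reals.
From mathcomp Require Import mpoly ring.

Set Implicit Arguments.
Unset Strict Implicit.
Unset Printing Implicit Defensive.

Import Order.TTheory GRing.Theory Num.Theory.
Local Open Scope ring_scope.

Section ClassicalUnits.
Variable A : comNzRingType.

Definition cunit : {pred A} := fun x => `[< exists y, y * x = 1 >].

Definition cinv (x : A) : A :=
  if pselect (exists y, y * x = 1) is left xP then sval (cid xP) else x.

Lemma cmulVx : {in cunit, left_inverse 1 cinv *%R}.
Proof.
move=> x /asboolP xP; rewrite /cinv; case: pselect => // xP'.
by case: cid.
Qed.

Lemma cunitPl (x y : A) : y * x = 1 -> cunit x.
Proof. by move=> yx; apply/asboolP; exists y. Qed.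

Lemma cinv_out : {in [predC cunit], cinv =1 id}.
Proof.
move=> x /= /negP xP; rewrite /cinv; case: pselect => // xP'.
by case: xP; apply/asboolP.
Qed.

End ClassicalUnits.

Section PowerSeries.
Variables (K : numFieldType) (m : nat).
Implicit Types (a b c : 'X_{1..m} -> K) (al be : 'X_{1..m}).

(* Absolute convergence on some polydisc. For K = R[i], [0 < r] says that r is
   real and positive. *)
Definition convergent a : Prop :=
  exists r M : K, 0 < r /\
    forall n, \sum_(al : 'X_{1..m < n}) `|a al| * r ^+ mdeg al <= M.

Record cps := CPS { coef :> 'X_{1..m} -> K; coefP : convergent coef }.

HB.instance Definition _ := gen_eqMixin cps.
HB.instance Definition _ := gen_choiceMixin cps.

Lemma cpsP (x y : cps) : coef x =1 coef y -> x = y.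
Proof.
case: x y => [a aP] [b bP] /= /funext ab; case: _ / ab bP => bP.
by congr CPS; exact: Prop_irrelevance.
Qed.

Definition ps0 : 'X_{1..m} -> K := fun=> 0.
Definition psopp a : 'X_{1..m} -> K := fun al => - a al.
Definition psadd a b : 'X_{1..m} -> K := fun al => a al + b al.
Definition ps1 : 'X_{1..m} -> K := fun al => (al == 0%MM)%:R.
Definition psmul a b : 'X_{1..m} -> K := fun al =>
  \sum_(be : 'X_{1..m < (mdeg al).+1} | (be <= al)%MM) a be * b (al - be)%MM.
Definition psderiv (i : 'I_m) a : 'X_{1..m} -> K := fun al =>
  (al i).+1%:R * a (al + U_(i))%MM.

Definition trunc n a : {mpoly K[m]} := \sum_(al : 'X_{1..m < n}) a al *: 'X_[al].

Lemma trunc_coef n a al : (mdeg al < n)%N -> (trunc n a)@_al = a al.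
Proof. exact: mcoeff_mpoly. Qed.

Lemma psmul_trunc n a b al : (mdeg al < n)%N ->
  psmul a b al = (trunc n a * trunc n b)@_al.
Proof.
move=> ltn; rewrite (mcoeff_poly_mul_lin _ _ (ltnSn (mdeg al))).
apply: eq_bigr => be le; rewrite !trunc_coef //.
  exact: leq_ltn_trans (mdegB _ _) ltn.
exact: leq_trans (bmdeg be) ltn.
Qed.

Lemma psmulE n a b al : (mdeg al < n)%N ->
  psmul a b al =
  \sum_(k : 'X_{1..m < n, n} | al == (k.1 + k.2)%MM) a k.1 * b k.2.
Proof.
move=> ltn; rewrite (psmul_trunc _ _ ltn) (mcoeff_poly_mul _ _ (k := n)) //.
by apply: eq_bigr => k _; rewrite !trunc_coef ?bmdeg.
Qed.

Lemma mcoeffM_eq n (p p' q : {mpoly K[m]}) al : (mdeg al < n)%N ->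
  (forall be, (mdeg be < n)%N -> p@_be = p'@_be) -> (p * q)@_al = (p' * q)@_al.
Proof.
move=> ltn pp'; rewrite !(mcoeff_poly_mul _ _ (k := n)) //.
by apply: eq_bigr => k _; rewrite pp' ?bmdeg.
Qed.

Lemma psmulC a b : psmul a b =1 psmul b a.
Proof. by move=> al; rewrite !(psmul_trunc _ _ (ltnSn _)) mulrC. Qed.

Lemma psmulA a b c : psmul a (psmul b c) =1 psmul (psmul a b) c.
Proof.
move=> al; rewrite !(psmul_trunc _ _ (ltnSn _)) [trunc _ a * _]mulrC.
set n := (mdeg al).+1.
have E x y z : (trunc n (psmul x y) * trunc n z)@_al
             = (trunc n x * trunc n y * trunc n z)@_al.
  apply: (@mcoeffM_eq n) => // be ltn.
  by rewrite trunc_coef // (psmul_trunc _ _ ltn).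
by rewrite !E [_ * trunc n a]mulrC mulrA.
Qed.

Lemma psmul1 a : psmul ps1 a =1 a.
Proof.
move=> al; rewrite (psmulE _ _ (ltnSn _)).
rewrite (bigD1 (bm0, BMultinom (ltnSn (mdeg al)))) /=; last by rewrite add0m.
rewrite /ps1 eqxx mul1r big1 ?addr0 // => -[k1 k2] /= /andP[/eqP alE].
rewrite xpair_eqE negb_and => ne; case: eqP => [k10|]; last by rewrite mul0r.
case/orP: ne => /negP[]; rewrite -val_eqE /=; apply/eqP => //.
by rewrite [RHS]alE k10 add0m.
Qed.

Lemma psmulDl a b c : psmul (psadd a b) c =1 psadd (psmul a c) (psmul b c).
Proof.
move=> al; rewrite /psadd /psmul -big_split /=.
by apply: eq_bigr => be _; rewrite mulrDl.
Qed.

Definition bounded_by (r M : K) a :=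
  forall n, \sum_(al : 'X_{1..m < n}) `|a al| * r ^+ mdeg al <= M.

Lemma bounded_by_le r r' M a : 0 < r' -> r' <= r ->
  bounded_by r M a -> bounded_by r' M a.
Proof.
move=> r'0 r'r aM n; apply: le_trans (aM n); apply: ler_sum => al _.
by rewrite ler_wpM2l // lerXn2r // nnegrE ltW // (lt_le_trans r'0).
Qed.

Lemma common_radius a b : convergent a -> convergent b ->
  exists r M N, [/\ 0 < r, bounded_by r M a & bounded_by r N b].
Proof.
move=> [r [M [r0 aM]]] [s [N [s0 bN]]].
have rs0 : 0 < r + s by rewrite addr_gt0.
have t0 : 0 < r * s / (r + s) by rewrite divr_gt0 ?mulr_gt0.
exists (r * s / (r + s)), M, N; split=> //.
- apply: bounded_by_le aM => //; rewrite ler_pdivrMr // ler_pM2l //.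
  by rewrite lerDr ltW.
- apply: bounded_by_le bN => //; rewrite ler_pdivrMr // mulrC ler_pM2l //.
  by rewrite lerDl ltW.
Qed.

Lemma bounded_ge0 r M a : bounded_by r M a -> 0 <= M.
Proof.
move=> /(_ 0%N); rewrite big1 // => al _.
by have := bmdeg al; rewrite ltn0.
Qed.

Lemma convergent0 : convergent ps0.
Proof.
exists 1, 0; split=> // n; rewrite big1 // => al _.
by rewrite /ps0 normr0 mul0r.
Qed.

Lemma convergent1 : convergent ps1.
Proof.
exists 1, 1; split=> // n.
have [al0|ne0] := pickP (fun al : 'X_{1..m < n} => (al : 'X_{1..m}) == 0%MM).
  move=> al0E; rewrite (bigD1 al0) //= big1 => [|be ne].
    by rewrite /ps1 al0E normr1 expr1n mulr1 addr0.
  rewrite /ps1; case: eqP => [be0|_]; last by rewrite normr0 mul0r.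
  by case/negP: ne; rewrite -val_eqE /= be0 eq_sym.
by rewrite big1 // => al _; rewrite /ps1 ne0 normr0 mul0r.
Qed.

Lemma convergentN a : convergent a -> convergent (psopp a).
Proof.
move=> [r [M [r0 aM]]]; exists r, M; split=> // n.
by rewrite /psopp; under eq_bigr do rewrite normrN; exact: aM.
Qed.

Lemma convergentD a b : convergent a -> convergent b -> convergent (psadd a b).
Proof.
move=> ca cb; have [r [M [N [r0 aM bN]]]] := common_radius ca cb.
exists r, (M + N); split=> // n; apply: le_trans (lerD (aM n) (bN n)).
rewrite -big_split /=; apply: ler_sum => al _.
by rewrite -mulrDl ler_wpM2r ?ler_normD // exprn_ge0 // ltW.
Qed.

Lemma convergentM a b : convergent a -> convergent b -> convergent (psmul a b).
Proof.
move=> ca cb; have [r [M [N [r0 aM bN]]]] := common_radius ca cb.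
have rX k : 0 <= r ^+ k by rewrite exprn_ge0 // ltW.
exists r, (M * N); split=> // n.
pose F (k : 'X_{1..m < n, n}) :=
  (`|a k.1| * r ^+ mdeg k.1) * (`|b k.2| * r ^+ mdeg k.2).
have F0 k : 0 <= F k by rewrite !mulr_ge0.
apply: (@le_trans _ _ (\sum_(k : 'X_{1..m < n, n}) F k)); last first.
  rewrite -(pair_bigA _ (fun x y : 'X_{1..m < n} =>
    (`|a x| * r ^+ mdeg x) * (`|b y| * r ^+ mdeg y))) /=.
  under eq_bigr do rewrite -mulr_sumr.
  rewrite -mulr_suml.
  by apply: ler_pM (aM n) (bN n); apply: sumr_ge0 => al _; exact: mulr_ge0.
apply: (@le_trans _ _ (\sum_(al : 'X_{1..m < n})
   \sum_(k : 'X_{1..m < n, n} | (al : 'X_{1..m}) == (k.1 + k.2)%MM) F k)).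
  apply: ler_sum => al _; rewrite (psmulE _ _ (bmdeg al)).
  apply: (le_trans (ler_wpM2r (rX _) (ler_norm_sum _ _ _))).
  rewrite mulr_suml; apply: ler_sum => k /eqP ->.
  by rewrite mdegD exprD normrM /F mulrACA.
rewrite (exchange_big_dep xpredT) //=; apply: ler_sum => k _.
have [lt|ge] := ltnP (mdeg (k.1 + k.2)%MM) n.
  by rewrite (big_pred1 (BMultinom lt)).
rewrite big_pred0 // => al; apply/negP => /eqP alE.
by have := bmdeg al; rewrite alE ltnNge ge.
Qed.

Lemma convergent_deriv i a : convergent a -> convergent (psderiv i a).
Proof.
move=> [r [M [r0 aM]]]; have r20 : 0 < r / 2 by rewrite divr_gt0.
exists (r / 2), (M / r * 2); split=> // n.
have rX k : 0 <= r ^+ k by rewrite exprn_ge0 // ltW.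
pose G (al : 'X_{1..m}) := `|a al| * r ^+ mdeg al.
have G0 al : 0 <= G al by rewrite mulr_ge0.
have up_proof (al : 'X_{1..m < n}) : (mdeg (al + U_(i))%MM < n.+1)%N.
  by rewrite mdegD mdeg1 addn1 ltnS bmdeg.
pose up (al : 'X_{1..m < n}) : 'X_{1..m < n.+1} := BMultinom (up_proof al).
apply: (@le_trans _ _ (\sum_(al : 'X_{1..m < n}) G (up al) / r * 2)); last first.
  rewrite -!mulr_suml ler_pM2r // ler_pM2r ?invr_gt0 //.
  apply: le_trans (aM n.+1).
  have up_inj : injective up.
    by move=> al be /(congr1 val) /= /addIm /val_inj.
  rewrite (eq_bigl (fun al : 'X_{1..m < n} => al \in [set: 'X_{1..m < n}]%SET)); last first.
    by move=> al; rewrite finset.in_setT.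
  rewrite -(big_imset (fun al : 'X_{1..m < n.+1} => G al) (in2W up_inj)) /=.
  rewrite big_mkcond /=; apply: ler_sum => al _.
  by case: ifP => // _; exact: G0.
apply: ler_sum => al _; rewrite /psderiv /G normrM normr_nat mdegD mdeg1.
rewrite addn1 exprSr mulrA mulfK ?gt_eqF //.
rewrite [_%:R * _]mulrC -!mulrA ler_wpM2l //.
rewrite expr_div_n mulrCA ler_wpM2l //.
rewrite ler_pdivrMr ?exprn_gt0 // -exprS -natrX ler_nat.
have le : (al i <= mdeg al)%N by rewrite mdegE (bigD1 i) //= leq_addr.
exact: leq_ltn_trans le (ltn_trans (ltnSn _) (ltn_expl _ (ltnSn 1))).
Qed.

Definition cps0 := CPS convergent0.
Definition cps1 := CPS convergent1.
Definition cpsopp (x : cps) := CPS (convergentN (coefP x)).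
Definition cpsadd (x y : cps) := CPS (convergentD (coefP x) (coefP y)).
Definition cpsmul (x y : cps) := CPS (convergentM (coefP x) (coefP y)).
Definition deriv_cps i (x : cps) := CPS (convergent_deriv i (coefP x)).

Lemma cpsaddA : associative cpsadd.
Proof. by move=> x y z; apply: cpsP => al; rewrite /= /psadd addrA. Qed.
Lemma cpsaddC : commutative cpsadd.
Proof. by move=> x y; apply: cpsP => al; rewrite /= /psadd addrC. Qed.
Lemma cpsadd0 : left_id cps0 cpsadd.
Proof. by move=> x; apply: cpsP => al; rewrite /= /psadd add0r. Qed.
Lemma cpsaddN : left_inverse cps0 cpsopp cpsadd.
Proof. by move=> x; apply: cpsP => al; rewrite /= /psadd addNr. Qed.

HB.instance Definition _ :=
  GRing.isZmodule.Build cps cpsaddA cpsaddC cpsadd0 cpsaddN.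

Lemma cpsmulA : associative cpsmul.
Proof. by move=> x y z; apply: cpsP => al; rewrite /= psmulA. Qed.
Lemma cpsmulC : commutative cpsmul.
Proof. by move=> x y; apply: cpsP => al; rewrite /= psmulC. Qed.
Lemma cpsmul1 : left_id cps1 cpsmul.
Proof. by move=> x; apply: cpsP => al; rewrite /= psmul1. Qed.
Lemma cpsmulDl : left_distributive cpsmul cpsadd.
Proof. by move=> x y z; apply: cpsP => al; rewrite /= psmulDl. Qed.
Lemma cps1_neq0 : cps1 != cps0.
Proof.
apply/eqP => /(congr1 (fun x : cps => x 0%MM)) /= /eqP.
by rewrite /ps1 /ps0 eqxx oner_eq0.
Qed.

HB.instance Definition _ := GRing.Zmodule_isComNzRing.Build cps
  cpsmulA cpsmulC cpsmul1 cpsmulDl cps1_neq0.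
HB.instance Definition _ := GRing.ComNzRing_hasMulInverse.Build cps
  (@cmulVx cps) (@cunitPl cps) (@cinv_out cps).

Lemma min_coef (x : cps) : x != 0 ->
  exists2 al, x al != 0 & forall be, (be < al)%O -> x be = 0.
Proof.
move=> x0; apply: contrapT => nmin; case/negP: x0; apply/eqP/cpsP.
apply: (@ltmwf m (fun al => x al = 0)) => al IH; apply: contrapT => /eqP xal.
by apply: nmin; exists al.
Qed.

Lemma cps_integral : GRing.integral_domain_axiom cps.
Proof.
move=> x y xy; apply/norP => -[/min_coef[al xal ltal] /min_coef[be ybe ltbe]].
have /eqP := congr1 (fun z : cps => z (al + be)%MM) xy; apply/negP.
rewrite /= (psmulE _ _ (ltnSn _)).
have lal : (mdeg al < (mdeg (al + be)%MM).+1)%N by rewrite ltnS mdegD leq_addr.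
have lbe : (mdeg be < (mdeg (al + be)%MM).+1)%N by rewrite ltnS mdegD leq_addl.
rewrite (bigD1 (BMultinom lal, BMultinom lbe)) //= big1 ?addr0 ?mulf_neq0 //.
move=> [k1 k2] /= /andP[/eqP kE]; rewrite xpair_eqE -!val_eqE /= => ne.
case: (ltgtP (k1 : 'X_{1..m}) al) => [lt|gt|k1E].
- by rewrite ltal ?mul0r.
- rewrite [y _]ltbe ?mulr0 // ltNge; apply/negP => le.
  by have := ltmc_le_add gt le; rewrite [X in (X < _)%O]kE ltxx.
- by move: kE ne; rewrite k1E => /addmI beE; rewrite eqxx -beE eqxx.
Qed.

HB.instance Definition _ := GRing.ComUnitRing_isIntegral.Build cps cps_integral.

End PowerSeries.

Section TotalFractions.
Variable A : comNzRingType.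

Definition nzd : pred A := fun s => `[< GRing.lreg s >].

Lemma nzdP s : reflect (GRing.lreg s) (nzd s).
Proof. exact: asboolP. Qed.

Lemma nzd1 : nzd 1. Proof. by apply/nzdP; exact: lreg1. Qed.

Lemma nzdM s t : nzd s -> nzd t -> nzd (s * t).
Proof. by move=> /nzdP sP /nzdP tP; apply/nzdP; exact: lregM. Qed.

Record tratio := TRatio { tratio_val :> A * A; _ : nzd tratio_val.2 }.

HB.instance Definition _ := [isSub for tratio_val].
HB.instance Definition _ := [Choice of tratio by <:].

Lemma tratioP (x : tratio) : nzd x.2. Proof. by case: x. Qed.

Definition equivt (x y : tratio) := x.1 * y.2 == y.1 * x.2.

Lemma equivt_refl : reflexive equivt. Proof. by move=> x; exact: eqxx. Qed.

Lemma equivt_sym : ssrbool.symmetric equivt.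
Proof. by move=> x y; rewrite /equivt eq_sym. Qed.

Lemma equivt_trans : transitive equivt.
Proof.
move=> y x z /eqP xy /eqP yz; apply/eqP; apply: (nzdP _ (tratioP y)).
by rewrite mulrCA [y.2 * _]mulrC mulrA xy mulrAC yz mulrC [z.1 * _]mulrC !mulrA.
Qed.

Canonical equivt_equiv := EquivRel equivt equivt_refl equivt_sym equivt_trans.

Definition totfrac := {eq_quot equivt}%qT.

HB.instance Definition _ : EqQuotient _ equivt totfrac := EqQuotient.on totfrac.
HB.instance Definition _ := Choice.on totfrac.

Definition addt (x y : tratio) : tratio :=
  @TRatio (x.1 * y.2 + y.1 * x.2, x.2 * y.2) (nzdM (tratioP x) (tratioP y)).
Definition oppt (x : tratio) : tratio := @TRatio (- x.1, x.2) (tratioP x).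
Definition mult (x y : tratio) : tratio :=
  @TRatio (x.1 * y.1, x.2 * y.2) (nzdM (tratioP x) (tratioP y)).
Definition embt (a : A) : tratio := @TRatio (a, 1) nzd1.

Definition tfq (x : tratio) : totfrac := \pi_totfrac%qT x.

Lemma tfqP x y : tfq x = tfq y <-> x.1 * y.2 = y.1 * x.2.
Proof.
split=> [/eqmodP /= /eqP //|xy]; apply/eqmodP/eqP; exact: xy.
Qed.

Lemma tfqK (q : totfrac) : tfq (repr q) = q.
Proof. exact: reprK. Qed.

Lemma tfqW (P : totfrac -> Prop) : (forall x, P (tfq x)) -> forall q, P q.
Proof. by move=> H q; rewrite -[q]tfqK. Qed.

Definition tfadd (p q : totfrac) := tfq (addt (repr p) (repr q)).
Definition tfopp (p : totfrac) := tfq (oppt (repr p)).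
Definition tfmul (p q : totfrac) := tfq (mult (repr p) (repr q)).
Definition tfemb (a : A) : totfrac := tfq (embt a).

Lemma tfaddE x y : tfadd (tfq x) (tfq y) = tfq (addt x y).
Proof.
have /tfqP Ex := tfqK (tfq x); have /tfqP Ey := tfqK (tfq y).
apply/tfqP; move: Ex Ey => /=; set x' := repr _; set y' := repr _ => Ex Ey.
have -> : (x'.1 * y'.2 + y'.1 * x'.2) * (x.2 * y.2) =
  (x'.1 * x.2) * (y'.2 * y.2) + (y'.1 * y.2) * (x'.2 * x.2) by ring.
by rewrite Ex Ey; ring.
Qed.

Lemma tfoppE x : tfopp (tfq x) = tfq (oppt x).
Proof.
have /tfqP Ex := tfqK (tfq x).
by apply/tfqP; move: Ex => /= Ex; rewrite !mulNr Ex.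
Qed.

Lemma tfmulE x y : tfmul (tfq x) (tfq y) = tfq (mult x y).
Proof.
have /tfqP Ex := tfqK (tfq x); have /tfqP Ey := tfqK (tfq y).
by apply/tfqP; move: Ex Ey => /= Ex Ey; rewrite mulrACA Ex Ey mulrACA.
Qed.

Lemma tfaddA : associative tfadd.
Proof.
elim/tfqW => x; elim/tfqW => y; elim/tfqW => z; rewrite !tfaddE.
by apply/tfqP => /=; ring.
Qed.

Lemma tfaddC : commutative tfadd.
Proof.
elim/tfqW => x; elim/tfqW => y; rewrite !tfaddE; apply/tfqP => /=.
by rewrite addrC [y.2 * _]mulrC.
Qed.

Lemma tfadd0 : left_id (tfemb 0) tfadd.
Proof.
by elim/tfqW => x; rewrite tfaddE; apply/tfqP; rewrite /= mul0r add0r mulr1 mul1r.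
Qed.

Lemma tfaddN : left_inverse (tfemb 0) tfopp tfadd.
Proof.
elim/tfqW => x; rewrite tfoppE tfaddE; apply/tfqP => /=.
by rewrite mulNr addNr !mul0r.
Qed.

HB.instance Definition _ :=
  GRing.isZmodule.Build totfrac tfaddA tfaddC tfadd0 tfaddN.

Lemma tfmulA : associative tfmul.
Proof.
elim/tfqW => x; elim/tfqW => y; elim/tfqW => z; rewrite !tfmulE.
by apply/tfqP; rewrite /= !mulrA.
Qed.

Lemma tfmulC : commutative tfmul.
Proof.
elim/tfqW => x; elim/tfqW => y; rewrite !tfmulE; apply/tfqP => /=.
by rewrite [x.1 * _]mulrC [x.2 * _]mulrC.
Qed.

Lemma tfmul1 : left_id (tfemb 1) tfmul.
Proof.
by elim/tfqW => x; rewrite tfmulE; apply/tfqP; rewrite /= !mul1r.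
Qed.

Lemma tfmulDl : left_distributive tfmul tfadd.
Proof.
elim/tfqW => x; elim/tfqW => y; elim/tfqW => z; rewrite !(tfmulE, tfaddE).
by apply/tfqP => /=; ring.
Qed.

Lemma tf1_neq0 : tfemb 1 != tfemb 0.
Proof. by apply/eqP => /tfqP /= /eqP; rewrite !mulr1 oner_eq0. Qed.

HB.instance Definition _ := GRing.Zmodule_isComNzRing.Build totfrac
  tfmulA tfmulC tfmul1 tfmulDl tf1_neq0.
HB.instance Definition _ := GRing.ComNzRing_hasMulInverse.Build totfrac
  (@cmulVx totfrac) (@cunitPl totfrac) (@cinv_out totfrac).

Lemma tfemb_zmod_morphism : zmod_morphism tfemb.
Proof.
move=> a b; rewrite -[RHS]/(tfadd _ (tfopp _)) tfoppE tfaddE.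
by apply/tfqP; rewrite /= !mulr1.
Qed.

Lemma tfemb_monoid_morphism : monoid_morphism tfemb.
Proof.
split=> // a b; rewrite -[RHS]/(tfmul _ _) tfmulE.
by apply/tfqP; rewrite /= !mulr1.
Qed.

HB.instance Definition _ :=
  GRing.isZmodMorphism.Build A totfrac tfemb tfemb_zmod_morphism.
HB.instance Definition _ :=
  GRing.isMonoidMorphism.Build A totfrac tfemb tfemb_monoid_morphism.

Lemma tfemb_inj : injective tfemb.
Proof. by move=> a b /tfqP /=; rewrite !mulr1. Qed.

Lemma tfemb_unit s : GRing.lreg s -> tfemb s \is a GRing.unit.
Proof.
move=> /nzdP sP; apply/asboolP; exists (tfq (@TRatio (1, s) sP)).
by rewrite -[LHS]/(tfmul _ _) tfmulE; apply/tfqP; rewrite /= !mulr1 !mul1r.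
Qed.

Lemma totfrac_div (q : totfrac) :
  exists a s, GRing.lreg s /\ q = tfemb a / tfemb s.
Proof.
elim/tfqW: q => x; have /nzdP xP := tratioP x.
exists x.1, x.2; split=> //; apply: (mulIr (tfemb_unit xP)).
rewrite mulrVK ?tfemb_unit // -[LHS]/(tfmul _ _) tfmulE.
by apply/tfqP; rewrite /= !mulr1.
Qed.

End TotalFractions.

Section Colon.
Variable A : comNzRingType.
Local Open Scope classical_set_scope.

Definition colon (J : set A) : set (totfrac A) := [set rho |
  forall y, J y -> exists b, rho * tfemb y = tfemb b].

End Colon.

Section CommutativeAlgebra.
Variable A : comNzRingType.
Local Open Scope classical_set_scope.

Definition ideal_span (S : set A) : set A := [set a |
  exists n (c g : 'I_n -> A), (forall i, S (g i)) /\ a = \sum_i c i * g i].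

Definition radical_ideal (I : {pred A}) : Prop :=
  forall a n, a ^+ n \in I -> a \in I.

Definition regular_sequence k (f : 'I_k -> A) : Prop :=
  (forall (i : 'I_k) a,
     let I := ideal_span [set f j | j in [set j : 'I_k | (j < i)%N]] in
     I (f i * a) -> I a) /\
  ~ ideal_span (range f) 1.

Definition prime_chain n (P : nat -> prime_idealr A) : Prop :=
  forall i, (i < n)%N ->
    {subset P i <= P i.+1} /\ ~ {subset P i.+1 <= P i}.

Definition has_height (P : {pred A}) (k : nat) : Prop :=
  (exists2 Q, prime_chain k Q & Q k =i P) /\
  (forall n Q, prime_chain n Q -> Q n =i P -> (n <= k)%N).

Definition minimal_prime (I : {pred A}) (P : prime_idealr A) : Prop :=
  {subset I <= P} /\
  forall Q : prime_idealr A, {subset I <= Q} -> {subset Q <= P} -> {subset P <= Q}.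

(* The irreducible components of V(I) are the V(P), P a minimal prime over I,
   and the codimension of V(P) is the height of P. *)
Definition equidimensional_of_codim (k : nat) (I : {pred A}) : Prop :=
  forall P, minimal_prime I P -> has_height P k.

End CommutativeAlgebra.

Section Modules.
Variables (A B : comNzRingType) (h : A -> B).
Local Open Scope classical_set_scope.

(* Hom_A(J, A) for J a subset of B, on which a : A acts as multiplication by h a. *)
Definition hom_along (J : set B) : set (J -> A) := [set phi |
  forall (a : A) (x y z : J),
    val z = h a * val x + val y -> phi z = a * phi x + phi y].

Definition submodule_along (N : set B) : Prop :=
  N 0 /\ forall a x y, N x -> N y -> N (h a * x + y).

End Modules.

Section Forms.
Variable m : nat.

Section Wedge.
Variable A : comNzRingType.

(* Differential forms of all degrees: [w I] is the coefficient of
   dx_{i_1} /\ ... /\ dx_{i_q} for I = {i_1 < ... < i_q}. *)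
Definition form := {ffun {set 'I_m} -> A^o}.

Definition homogeneous (q : nat) (w : form) : Prop :=
  forall I : {set 'I_m}, #|I| <> q -> w I = 0.

Definition form1 : form := [ffun I : {set 'I_m} => (#|I| == 0%N)%:R].

Definition inversions (I J : {set 'I_m}) : nat :=
  #|[set p : 'I_m * 'I_m | [&& p.1 \in I, p.2 \in J & (p.2 < p.1)%N]]%SET|.

Definition wedge (v w : form) : form := [ffun L : {set 'I_m} =>
  \sum_(I : {set 'I_m} | I \subset L)
    (-1) ^+ inversions I (L :\: I) * (v I * w (L :\: I)%SET)].

End Wedge.

Definition map_form (A B : comNzRingType) (h : A -> B) (w : form A) : form B :=
  [ffun I => h (w I)].

Definition differential (K : numFieldType) (h : cps K m) : form (cps K m) :=
  [ffun I => \sum_(i < m | I == [set i]%SET) deriv_cps i h].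

End Forms.

Section LogarithmicForms.
Variables (R : realType) (m k : nat).
Local Notation O := (cps R[i] m).
Local Notation "x %:F" := (@FracField.tofrac O x) (at level 1, format "x %:F").
Local Open Scope classical_set_scope.

Definition mero_form (w : form m O) : form m {fraction O} :=
  map_form (@FracField.tofrac O) w.

Definition ideal_forms (I : {pred O}) (q : nat) : set (form m O) := [set w |
  exists n (c : 'I_n -> O) (v : 'I_n -> form m O),
    (forall i, c i \in I /\ homogeneous q (v i)) /\ w = \sum_i c i *: v i].

Definition over (f : O) (N : set (form m O)) : set (form m {fraction O}) :=
  [set (f%:F)^-1 *: mero_form w | w in N].

Definition log_forms (IX IC : {pred O}) (f : 'I_k -> O) (q : nat) :
    set (form m {fraction O}) := [set w |
  let F := \prod_i f i in
  [/\ over F [set v | homogeneous q v] w,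
      forall h, h \in IX -> over F (ideal_forms IC q) (h%:F *: w) &
      forall h, h \in IX -> over F (ideal_forms IC q.+1)
                              (wedge (mero_form (differential h)) w)]].

Variables (IX IC : idealr O) (f : 'I_k -> O).
Local Notation OX := {ideal_quot IX}.
Local Notation OC := {ideal_quot IC}.
Local Open Scope quotient_scope.

Definition is_residue (w : form m {fraction O}) (rho : totfrac OX) : Prop :=
  let F := \prod_i f i in
  exists (g xi : O) (eta : form m {fraction O}),
    [/\ GRing.lreg (\pi_OC g),
        over F (ideal_forms IC k) eta,
        g%:F *: w =
          (xi%:F / F%:F) *:
            mero_form (\big[@wedge m O/form1 m O]_(i < k) differential (f i))
          + eta &
        rho = tfemb (\pi_OX xi) / tfemb (\pi_OX g)].

Definition residues : set (totfrac OX) :=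
  [set rho | exists2 w, log_forms IX IC f k w & is_residue w rho].

Definition jacobian_minors : set OC :=
  [set \det (\matrix_(i < k, j < k) \pi_OC (deriv_cps (s j) (f i)))
    | s in [set s : 'I_k -> 'I_m | {homo s : i j / (i < j)%N}]].

Definition jacobian_ideal : set OC := ideal_span jacobian_minors.

(* The projection O_C -> O_X, meaningful only when I_C is contained in I_X:
   see [restriction_pi]. *)
Definition restriction (a : OC) : OX := \pi_OX (repr a).

Lemma restriction_pi (a : O) : {subset IC <= IX} ->
  restriction (\pi_OC a) = \pi_OX a.
Proof.
move=> sub; apply/eqP; rewrite -Quotient.idealrBE sub //.
by rewrite Quotient.idealrBE reprK.
Qed.

Definition restr_scalar (a : OC) : totfrac OX := tfemb (restriction a).

Definition jacobian_ideal_restr : set OX := restriction @` jacobian_ideal.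

End LogarithmicForms.

Arguments residues {R m k} IX IC f.
Arguments jacobian_ideal {R m k} IC f.
Arguments jacobian_ideal_restr {R m k} IX IC f.
Arguments restriction {R m} IX IC a.
Arguments restr_scalar {R m} IX IC a.
Arguments hom_along {A B} h J phi.

(* Main.v *)
From HB Require Import structures.
From Pilot Require Import Defs.
From mathcomp Require Import all_boot all_order all_algebra.
From mathcomp Require Import complex boolp classical_sets functions reals.
From mathcomp Require Import mpoly ring zify.
(* Again, because mathcomp's own [form] would otherwise shadow the one of [Defs]. *)
Import Pilot.Defs.

(* Let [g] and [xi] be such that [w = (xi / g) df_1 /\ ... /\ df_k / f] modulo
   [(1 / f) IC], so that [res w = xi / g]. Then multiplication by [xi / g] sends
   the minor [D_L] of the Jacobian matrix to the coefficient of [w] at [dx_L], and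
   this is the homomorphism attached to the residue. It determines [xi / g]
   because some combination [g0] of the minors is a nonzerodivisor modulo [IC];
   conversely [phi] is attached to [phi (g0) / g0], whose form is logarithmic
   because the maximal minors of [(h, f_1, ..., f_k)] vanish on [X] for [h] in [IX].
   Both facts are checked at the minimal primes [P] of [IX], which by
   equidimensionality are minimal over [IC]; there [P] is locally generated by the
   [f_i], which gives the vanishing. For [g0], a prime chain of length [k] ending
   at [P] is turned, by Weierstrass division and a linear change of coordinates at
   each step, into a bound [d <= m - k] for the dimension of the space of tangent
   vectors to [P], so that the Jacobian matrix of [f] has rank [k] at [P]; prime
   avoidance over the finitely many minimal primes of [IC] concludes. *)

Set Implicit Arguments.
Unset Strict Implicit.
Unset Printing Implicit Defensive.

Import Order.TTheory GRing.Theory Num.Theory.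
Local Open Scope ring_scope.

(** * Ideals and prime chains *)

Local Open Scope classical_set_scope.

(** Residues and homomorphisms are compared without forms, through pairs (g, xi) with three
    properties: g is a nonzerodivisor modulo IC, xi IX lies in IC, and xi J lies in g O + IC for the
    ideal J of minors. The third property supplies the coefficients of a form. The second makes the
    value on a class of J in O_X independent of its lift, and it turns equality in M_X into
    congruence modulo IC, since a difference lying in IX then has its square in IC. The condition on
    dh /\ w leaves no trace in the pair: the minors of (h, f_1, ..., f_k) lie in IX, hence xi sends
    them into IC.

    Regularity of the sequence gives a lower bound for heights: every prime containing it ends a
    chain of length k. Against the upper bound in equidimensionality this makes the minimal primes
    of IX minimal over IC, and the same chain feeds the bound d + k <= m. Characteristic zero gives
    the separability of a minimal polynomial, and integers that stay distinct modulo every prime,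
    for prime avoidance. *)

Section Ideals.
Variable A : comNzRingType.
Implicit Types (I J : set A) (P Q : prime_idealr A).

(** Ideals are plain sets here, since Zorn's lemma and spans produce sets and not instances of
    [idealr]. The whole ring is allowed. *)
Definition ideal I := I 0 /\ forall a x y, I x -> I y -> I (a * x + y).

Lemma ideal0 I : ideal I -> I 0. Proof. by case. Qed.

Lemma idealD I x y : ideal I -> I x -> I y -> I (x + y).
Proof. by move=> [_ H] Ix Iy; rewrite -[x]mul1r; exact: H. Qed.

Lemma idealM I a x : ideal I -> I x -> I (a * x).
Proof. by move=> [I0 H] Ix; rewrite -[_ * _]addr0; exact: H. Qed.

Lemma idealN I x : ideal I -> I x -> I (- x).
Proof. by move=> idI Ix; rewrite -mulN1r; exact: idealM. Qed.

Lemma idealB I x y : ideal I -> I x -> I y -> I (x - y).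
Proof. by move=> idI Ix Iy; apply: idealD => //; exact: idealN. Qed.

Lemma ideal_sum I n (c g : 'I_n -> A) : ideal I -> (forall i, I (g i)) ->
  I (\sum_i c i * g i).
Proof.
move=> idI Ig; apply: big_ind => [|x y|i _]; first exact: ideal0.
  exact: idealD.
exact: idealM.
Qed.

Lemma ideal_idealr (I : idealr A) : ideal [set` I].
Proof. by split=> [|a x y Ix Iy] /=; rewrite ?rpred0 ?rpredD ?idealMr. Qed.

Lemma ideal_ideal_span (S : set A) : ideal (ideal_span S).
Proof.
split=> [|a x y [n [c [g [Sg ->]]]] [n' [c' [g' [Sg' ->]]]]].
  by exists 0%N, (fun=> 0), (fun=> 0); split=> [[]//|]; rewrite big_ord0.
exists (n + n')%N, (fun i => match fintype.split i with inl j => a * c j | inr j => c' j end),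
  (fun i => match fintype.split i with inl j => g j | inr j => g' j end).
split=> [i|]; first by case: fintype.splitP.
rewrite big_split_ord /= mulr_sumr; congr (_ + _); apply: eq_bigr => i _.
  by rewrite mulrA; case: (fintype.split _) (fintype.unsplitK (inl i : 'I_n + 'I_n')%type) => j [] // ->.
by case: (fintype.split _) (fintype.unsplitK (inr i : 'I_n + 'I_n')%type) => j [] // ->.
Qed.

Lemma mem_ideal_span (S : set A) x : S x -> ideal_span S x.
Proof.
move=> Sx; exists 1%N, (fun=> 1), (fun=> x); split=> //.
by rewrite big_ord1 mul1r.
Qed.

Lemma ideal_span_sub (S I : set A) : ideal I -> S `<=` I -> ideal_span S `<=` I.
Proof.
by move=> idI SI x [n [c [g [Sg ->]]]]; apply: ideal_sum => // i; exact: SI.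
Qed.

Lemma ideal_span_range n (f : 'I_n -> A) x :
  ideal_span (range f) x -> exists c, x = \sum_i c i * f i.
Proof.
move=> [l [c [g [/= fg ->]]]]; elim: l => [|l IH] in c g fg *.
  exists (fun=> 0); rewrite big_ord0 big1 // => i _; exact: mul0r.
have [d dE] := IH (fun i => c (lift ord0 i)) (fun i => g (lift ord0 i)) (fun i => fg _).
have [j _ gE] := fg ord0.
exists (fun i => (if i == j then c ord0 else 0) + d i).
rewrite big_ord_recl dE -gE; under [RHS]eq_bigr do rewrite mulrDl.
rewrite big_split /=; congr (_ + _); rewrite (bigD1 j) //= eqxx big1 ?addr0 //.
by move=> i /negPf ->; rewrite mul0r.
Qed.

Lemma prime_idealr_of (P : set A) : ideal P -> ~ P 1 ->
  (forall a b, P (a * b) -> P a \/ P b) ->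
  exists Q : prime_idealr A, forall x, x \in Q <-> P x.
Proof.
move=> idP P1 PM; pose S : A -> bool := fun x => `[< P x >].
have S_ideal : idealr_closed S.
  split; first by apply/asboolP; exact: ideal0.
    by apply/asboolP.
  by move=> a x y /asboolP Px /asboolP Py; apply/asboolP; apply: idP.2.
have S_prime : prime_idealr_closed S.
  move=> u v /asboolP /PM uv; apply/orP.
  by case: uv => ?; [left|right]; apply/asboolP.
pose h1 := isIdealr.Build A S S_ideal.
pose h2 := isPrimeIdealrClosed.Build A S S_prime.
pose S' : prime_idealr A := HB.pack S h1 h2.
by exists S' => x; split=> [/asboolP|Px] //; apply/asboolP.
Qed.

(* A maximal element of the ideals containing [I] and missing a multiplicative
   set [T] is prime. *)
Lemma prime_avoiding (I T : set A) : ideal I -> T 1 ->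
  (forall x y, T x -> T y -> T (x * y)) -> (forall x, I x -> ~ T x) ->
  exists Q : prime_idealr A, (forall x, I x -> x \in Q) /\ forall x, x \in Q -> ~ T x.
Proof.
move=> idI T1 TM IT.
pose F (J : set A) := J = set0 \/ [/\ ideal J, I `<=` J & forall x, J x -> ~ T x].
have [|J [FJ Jmax]] := @Zorn_bigcup A F.
  move=> C CF totC; have [[J CJ Jne]|Cempty] := pselect (exists2 J, C J & J <> set0).
    right; have good J' : C J' -> J' <> set0 -> [/\ ideal J', I `<=` J' & forall x, J' x -> ~ T x].
      by move=> /CF[].
    have [idJ IJ JT] := good _ CJ Jne; split=> [||x [J' CJ' J'x]]; last first.
    - have J'ne : J' <> set0 by move=> J'0; rewrite J'0 in J'x.
      by have [_ _] := good _ CJ' J'ne; apply.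
    - by move=> x Ix; exists J => //; exact: IJ.
    split; first by exists J => //; exact: ideal0.
    move=> a x y [J1 CJ1 J1x] [J2 CJ2 J2y].
    have id1 : ideal J1 by have [|] := good _ CJ1; rewrite // => J0; rewrite J0 in J1x.
    have id2 : ideal J2 by have [|] := good _ CJ2; rewrite // => J0; rewrite J0 in J2y.
    have [J12|J21] := totC _ _ CJ1 CJ2.
      by exists J2 => //; apply: id2.2 => //; exact: J12.
    by exists J1 => //; apply: id1.2 => //; exact: J21.
  left; apply/seteqP; split=> // x [J CJ Jx].
  by have /contrapT J0 : ~ (J <> set0) by [move=> ne; apply: Cempty; exists J|];
     rewrite J0 in Jx.
have FI : F I by right; split.
have {FJ}[idJ IJ JT] : [/\ ideal J, I `<=` J & forall x, J x -> ~ T x].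
  case: FJ => // J0; case: (Jmax I) => //; rewrite J0; split=> // /(_ 0 (ideal0 idI)).
  by [].
have step a : ~ J a -> exists t c, [/\ T t & J (t - c * a)].
  move=> Ja; apply: contrapT => nT.
  pose J' := [set x | exists c, J (x - c * a)].
  apply: (Jmax J').
    split=> [x Jx|]; first by exists 0; rewrite mul0r subr0.
    by move=> /(_ a)-/(_ _)/Ja; apply; exists 1; rewrite mul1r subrr; exact: ideal0.
  right; split=> [||x [c Jc] Tx].
  - split; first by exists 0; rewrite mul0r subr0; exact: ideal0.
    move=> b x y [c Jc] [d Jd]; exists (b * c + d).
    have -> : b * x + y - (b * c + d) * a = b * (x - c * a) + (y - d * a) by ring.
    exact: idJ.2.
  - by move=> x /IJ Jx; exists 0; rewrite mul0r subr0.
  - by apply: nT; exists x, c.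
have [||Q QE] := prime_idealr_of idJ.
- by move=> /JT.
- move=> a b Jab; apply: contrapT => /not_orP[/step[t [c [Tt Jt]]] /step[s [d [Ts Js]]]].
  apply: (JT (t * s)) (TM _ _ Tt Ts).
  have -> : t * s = s * (t - c * a) + (c * a * (s - d * b) + c * d * (a * b)) by ring.
  by apply: idJ.2 => //; apply: idJ.2 => //; exact: idealM.
by exists Q; split=> [x /IJ|x] /QE //; exact: JT.
Qed.

(** The localization of A / I at [P] is reduced with a single prime, hence a field, where x
    vanishes. Directly: if no such s existed, the multiplicative set of all s x^n with s outside [P]
    would miss [I], and a prime avoiding it would lie between [I] and [P] without containing x. *)
Lemma minimal_prime_torsion (I : idealr A) P x : radical_ideal I ->
  minimal_prime I P -> x \in P -> exists2 s, s \notin P & s * x \in I.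
Proof.
move=> radI [IP Pmin] Px; apply: contrapT => nos.
pose T := [set y | exists s n, s \notin P /\ y = s * x ^+ n].
have [|||Q [IQ QT]] := @prime_avoiding [set` I] T (ideal_idealr I).
- by exists 1, 0%N; rewrite idealr1 expr0 mul1r.
- move=> _ _ [s [n [sP ->]]] [t [l [tP ->]]]; exists (s * t), (n + l)%N.
  by rewrite prime_idealrM negb_or sP tP exprD; split=> //; ring.
- move=> y /= Iy [s [n [sP yE]]]; apply: nos; exists s => //.
  apply: (radI _ n.+1); have -> : (s * x) ^+ n.+1 = (s ^+ n * x) * (s * x ^+ n).
    by rewrite exprMn !exprS; ring.
  by rewrite idealMr // -yE.
have QP : {subset Q <= P}.
  move=> y Qy; apply/negP => /negP yP; apply: (QT _ Qy).
  by exists y, 0%N; rewrite expr0 mulr1.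
have /(_ x Px) Qx := Pmin Q (fun y => IQ y) QP.
by apply: (QT _ Qx); exists 1, 1%N; rewrite idealr1 mul1r expr1.
Qed.

Lemma prime_chain_cons n (C : nat -> prime_idealr A) P : prime_chain n C ->
  {subset C n <= P} -> ~ {subset P <= C n} ->
  prime_chain n.+1 (fun i => if (i <= n)%N then C i else P).
Proof.
move=> chC CP PC i; rewrite ltnS leq_eqVlt => /orP[/eqP ->|lt_in].
  by rewrite /= eqxx ltnn.
by rewrite /= lt_in orbT; exact: chC.
Qed.

(** The chain is built downwards. If [Q] contains the first n + 1 elements, regularity strips powers
    of the last one, f, so no s f^l with s outside [Q] lies in the ideal of the first n. A prime
    over that ideal avoiding all these products is contained in [Q] and omits f, which makes the
    step strict. *)
Lemma regular_sequence_chain k (f : 'I_k -> A) P : regular_sequence f ->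
  (forall i, f i \in P) -> exists2 C, prime_chain k C & C k =i P.
Proof.
move=> [freg _] fP.
pose I (n : nat) := ideal_span [set f j | j in [set j : 'I_k | (j < n)%N]].
suff H n (Q : prime_idealr A) : (n <= k)%N -> (forall x, I n x -> x \in Q) ->
    exists2 C, prime_chain n C & C n =i Q.
  apply: (H k P) => //; apply: (@ideal_span_sub _ [set` P]).
    exact: ideal_idealr.
  by move=> _ [j _ <-]; exact: fP.
elim: n Q => [|n IH] Q nk IQ.
  by exists (fun=> Q).
pose i := Ordinal nk; pose T := [set y | exists s l, s \notin Q /\ y = s * f i ^+ l].
have idI : ideal (I n) by exact: ideal_ideal_span.
have subI : I n `<=` I n.+1.
  apply: ideal_span_sub; first exact: ideal_ideal_span.
  by move=> _ [j /= jn <-]; apply: mem_ideal_span; exists j => //=; exact: leqW.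
have [|||Q' [IQ' QT]] := @prime_avoiding (I n) T idI.
- by exists 1, 0%N; rewrite idealr1 expr0 mul1r.
- move=> _ _ [s [m [sP ->]]] [t [l [tP ->]]]; exists (s * t), (m + l)%N.
  by rewrite prime_idealrM negb_or sP tP exprD; split=> //; ring.
- move=> y Iy [s [l [sQ yE]]]; rewrite {}yE in Iy; case/negP: sQ.
  apply: IQ; apply: subI; elim: l Iy => [|l IHl]; first by rewrite expr0 mulr1.
  by move=> Iy; apply/IHl/(freg i); move: Iy; rewrite exprS mulrCA.
have [|C chC CQ] := IH Q' (ltnW nk); first exact: IQ'.
have Q'Q : {subset Q' <= Q}.
  move=> y Qy; apply/negP => /negP yP; apply: (QT _ Qy).
  by exists y, 0%N; rewrite expr0 mulr1.
exists (fun i => if (i <= n)%N then C i else Q); last by move=> x; rewrite ltnn.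
apply: prime_chain_cons => // [x|QC]; first by rewrite CQ; exact: Q'Q.
have fiQ : f i \in Q by apply: IQ; apply: mem_ideal_span; exists i => /=.
move: (QC _ fiQ); rewrite CQ => /QT; apply.
by exists 1, 1%N; rewrite idealr1 mul1r expr1.
Qed.

(** A prime over [J] strictly inside [P] ends a chain of length k, which [P] would extend to length
    k + 1, against its height. *)
Lemma equidimensional_minimal k (f : 'I_k -> A) (I J : {pred A}) P :
  regular_sequence f -> [set` J] = ideal_span (range f) -> {subset J <= I} ->
  equidimensional_of_codim k I -> minimal_prime I P -> minimal_prime J P.
Proof.
move=> freg JE JI eqd minP; have [IP _] := minP.
split=> [x /JI/IP //|Q JQ QP]; apply: contrapT => PQ.
have [|C chC CQ] := regular_sequence_chain (P := Q) freg.
  move=> i; apply: JQ; suff : [set` J] (f i) by [].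
  by rewrite JE; apply: mem_ideal_span; exists i.
have [_ height_le] := eqd _ minP; suff : (k < k)%N by rewrite ltnn.
apply: (height_le _ (fun i => if (i <= k)%N then C i else P)).
  apply: prime_chain_cons => // [x|PC]; first by rewrite CQ; exact: QP.
  by apply: PQ => x Px; rewrite -CQ; exact: PC.
by move=> x; rewrite ltnn.
Qed.

End Ideals.

(** * Noetherian rings, minimal primes and prime avoidance *)

Definition finitely_generated (A : comNzRingType) (I : set A) : Prop :=
  exists n (g : 'I_n -> A), (forall i, I (g i)) /\ I `<=` ideal_span (range g).

Definition noetherian (A : comNzRingType) : Prop :=
  forall I : set A, ideal I -> finitely_generated I.

Section Noetherian.
Variable A : comNzRingType.
Hypothesis noethA : noetherian A.

(** [F] is not assumed closed under unions of chains: the union is finitely generated, its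
    generators lie in one member of the chain, and so the union is that member. *)
Lemma noetherian_maximal (F : set (set A)) (I0 : set A) : F I0 ->
  (forall J, F J -> ideal J) ->
  exists2 J, F J & forall J', F J' -> J `<=` J' -> J' `<=` J.
Proof.
move=> FI0 Fid; pose G J := J = set0 \/ F J.
have Fne J : F J -> J <> set0.
  by move=> /Fid /ideal0 J0 JE; rewrite JE in J0.
have [|J [GJ Jmax]] := @Zorn_bigcup A G.
  move=> C CG totC; have [[J CJ Jne]|Cempty] := pselect (exists2 J, C J & J <> set0).
    pose U := \bigcup_(X in C) X; have [| n [g [Ug gU]]] := noethA (I := U).
      split; first by exists J => //; case: (CG _ CJ) => // /Fid /ideal0.
      move=> a x y [J1 CJ1 J1x] [J2 CJ2 J2y].
      have id1 : ideal J1 by case: (CG _ CJ1) => [J0|/Fid //]; rewrite J0 in J1x.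
      have id2 : ideal J2 by case: (CG _ CJ2) => [J0|/Fid //]; rewrite J0 in J2y.
      have [J12|J21] := totC _ _ CJ1 CJ2.
        by exists J2 => //; apply: id2.2 => //; exact: J12.
      by exists J1 => //; apply: id1.2 => //; exact: J21.
    have [X [CX Xne Xg]] : exists X, [/\ C X, X <> set0 & forall i, X (g i)].
      elim: n g Ug {gU} => [|n IH] g Ug; first by exists J; split=> // -[].
      have [X [CX Xne Xg]] := IH (fun i => g (lift ord0 i)) (fun i => Ug _).
      have [Y CY Yg] := Ug ord0; have [XY|YX] := totC _ _ CX CY.
        exists Y; split=> //; first by move=> Y0; rewrite Y0 in Yg.
        by move=> i; case: (unliftP ord0 i) => [j ->|-> //]; apply: XY; exact: Xg.
      exists X; split=> // i; case: (unliftP ord0 i) => [j ->|->]; first exact: Xg.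
      exact: YX.
    have FX : F X by case: (CG _ CX).
    suff -> : \bigcup_(X in C) X = X by right.
    apply/seteqP; split=> [x /gU|x Xx]; last by exists X.
    apply: ideal_span_sub; first exact: Fid.
    by move=> _ [i _ <-].
  left; apply/seteqP; split=> // x [J CJ Jx].
  by have /contrapT J0 : ~ (J <> set0) by [move=> ne; apply: Cempty; exists J|];
     rewrite J0 in Jx.
have FJ : F J.
  case: GJ => // J0; case: (Jmax I0); last by right.
  rewrite J0; split=> // I0E; exact: (I0E 0 (ideal0 (Fid _ FI0))).
exists J => // J' FJ' JJ'; apply: contrapT => nJ'J.
by apply: (Jmax J'); [split|right].
Qed.

(** Noetherian induction: a maximal counterexample [J] is not prime, and for a b in [J] with neither
    factor in [J] it is the intersection of the radicals of J + (a) and J + (b), which are larger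
    and hence decompose. *)
Lemma radical_decomposition (I : set A) : ideal I ->
  (forall a n, I (a ^+ n) -> I a) ->
  exists n (Q : 'I_n -> prime_idealr A), forall x, I x <-> forall i, x \in Q i.
Proof.
move=> idI radI; apply: contrapT => nI.
pose F (J : set A) := [/\ ideal J, forall a n, J (a ^+ n) -> J a &
  ~ exists n (Q : 'I_n -> prime_idealr A), forall x, J x <-> forall i, x \in Q i].
have [||J [idJ radJ nJ] Jmax] := @noetherian_maximal F I; [by []|by move=> J []|].
(* The whole ring is the intersection of the empty family of primes. *)
have J1 : ~ J 1.
  move=> J1; apply: nJ; exists 0%N; have Q0 : 'I_0 -> prime_idealr A by case.
  by exists Q0 => x; split=> [_ []//|_]; rewrite -[x]mulr1; exact: idealM.
have [[a [b [Jab Ja Jb]]]|Jpr] :=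
    pselect (exists a b, [/\ J (a * b), ~ J a & ~ J b]); last first.
  have [a b Jab|Q QE] := prime_idealr_of idJ J1.
    by apply: contrapT => /not_orP[Ja Jb]; apply: Jpr; exists a, b.
  apply: nJ; exists 1%N, (fun=> Q) => x; rewrite -QE.
  by split=> [//|/(_ ord0)].
(* The radical of J + (c). *)
pose E c := [set x | exists n, exists d, J (x ^+ n - d * c)].
have EJ c : ~ J c -> exists n (Q : 'I_n -> prime_idealr A),
    forall x, E c x <-> forall i, x \in Q i.
  move=> Jc; apply: contrapT => nE; apply: (Jc).
  have JE : J `<=` E c by move=> x Jx; exists 1%N, 0; rewrite mul0r subr0.
  have Ec : E c c by exists 1%N, 1; rewrite expr1 mul1r subrr; exact: ideal0.
  apply: (Jmax (E c)) => //; split=> //; last first.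
    by move=> x n [l [d Jx]]; exists (n * l)%N, d; rewrite exprM.
  split; first by apply: JE; exact: ideal0.
  have EM u x : E c x -> E c (u * x).
    move=> [n [d Jx]]; exists n, (u ^+ n * d).
    by rewrite exprMn -mulrA -mulrBr; exact: idealM.
  move=> u x y /(EM u)[n [d Jx]] [l [e Jy]]; exists (n + l)%N.
  set v := u * x in Jx *.
  have mod_pow i k w g : (i <= k)%N -> J (w ^+ i - g * c) -> 
      exists g', J (w ^+ k - g' * c).
    move=> ik Jw; exists (w ^+ (k - i) * g).
    by rewrite -{1}(subnK ik) exprD -mulrA -mulrBr; exact: idealM.
  have modM w z g : J (w - g * c) -> exists g', J (z * w - g' * c).
    by move=> Jw; exists (z * g); rewrite -mulrA -mulrBr; exact: idealM.
  rewrite exprDn; apply: (big_ind (fun w => exists g, J (w - g * c))).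
  - by exists 0; rewrite mul0r subr0; exact: ideal0.
  - move=> w z [g Jw] [h Jz]; exists (g + h).
    have -> : w + z - (g + h) * c = w - g * c + (z - h * c) by ring.
    exact: idealD.
  (* In the term v^(n + l - i) y^i the exponent of v is at least n if i <= l, and that of y exceeds
     l otherwise. *)
  - move=> [i ilt] _ /=; rewrite -mulrnAl -mulr_natl.
    have [il|li] := leqP i l.
      have [|g Jg] := @mod_pow n (n + l - i)%N v d _ Jx; first by lia.
      have [g' Jg'] := modM _ ('C(n + l, i)%:R * y ^+ i) _ Jg.
      by exists g'; rewrite mulrAC.
    have [|g Jg] := @mod_pow l i y e _ Jy; first by lia.
    exact: modM Jg.
have [n [Q QE]] := EJ _ Ja; have [l [Q' QE']] := EJ _ Jb.
apply: nJ; exists (n + l)%N, (fun i => match fintype.split i with inl j => Q j | inr j => Q' j end).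
move=> x; split=> [Jx i|H].
  have JE c : E c x by exists 1%N, 0; rewrite mul0r subr0.
  by case: fintype.splitP => j _; [have /QE := JE a|have /QE' := JE b]; apply.
have /QE [i [d Jd]] : forall i, x \in Q i.
  by move=> i; have := H (unsplit (inl i)); rewrite unsplitK.
have /QE' [j [e Je]] : forall i, x \in Q' i.
  by move=> j; have := H (unsplit (inr j)); rewrite unsplitK.
apply: (radJ _ (i + j)%N); rewrite exprD.
have -> : x ^+ i * x ^+ j =
  x ^+ j * (x ^+ i - d * a) + (d * a * (x ^+ j - e * b) + d * e * (a * b)) by ring.
by apply: idJ.2 => //; apply: idJ.2 => //; exact: idealM.
Qed.

Lemma prime_prod n (x : 'I_n -> A) (P : prime_idealr A) :
  \prod_i x i \in P -> exists i, x i \in P.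
Proof.
move=> Px; apply: contrapT => nP; suff : \prod_i x i \notin P by rewrite Px.
apply: (big_ind (fun y => y \notin P)) => [|y z|i _]; first by rewrite idealr1.
  by rewrite prime_idealrM negb_or => -> ->.
by apply/negP => Pxi; apply: nP; exists i.
Qed.

Lemma minimal_primes (I : idealr A) : radical_ideal I ->
  exists n (Q : 'I_n -> prime_idealr A), (forall i, minimal_prime I (Q i)) /\
    forall x, x \in I <-> forall i, x \in Q i.
Proof.
move=> radI.
pose D n := exists Q : 'I_n -> prime_idealr A, forall x, x \in I <-> forall i, x \in Q i.
have exD : exists n, `[< D n >].
  have [n [Q QE]] := radical_decomposition (ideal_idealr I) radI.
  by exists n; apply/asboolP; exists Q.
case: (ex_minnP exD) => n /asboolP[Q QE] nmin; exists n, Q; split=> // i.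
split=> [x /QE //|Q' IQ' Q'Q].
have [j Qj] : exists j, {subset Q j <= Q'}.
  apply: contrapT => nQ; have /choice[x xP] : forall j, exists x, x \in Q j /\ x \notin Q'.
    move=> j; apply: contrapT => nx; apply: nQ; exists j => x Qx.
    by apply/negP => /negP xQ'; apply: nx; exists x.
  have /IQ'/prime_prod[j] : \prod_j x j \in I.
    apply/QE => j; rewrite (bigD1 j) //= mulrC idealMr //; exact: (xP j).1.
  by apply/negP; exact: (xP j).2.
have [ji|ne] := eqVneq j i; first by move=> x; rewrite -ji => /Qj.
case: n => [|n] in Q QE nmin i j Q'Q Qj ne *; first by case: i Q'Q ne.
have /nmin : `[< D n >]; last by rewrite ltnn.
apply/asboolP; exists (fun l => Q (lift i l)) => x; rewrite QE; split=> // H l.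
have [l' ->//|->] := unliftP i l.
by apply: Q'Q; apply: Qj; have [j' ->//|jE] := unliftP i j; rewrite jE eqxx in ne.
Qed.

End Noetherian.

(** If x + c y and x + d y with c < d both lie in [Q i], then so does y, as d - c is a unit, and
    then x. With x outside the later primes and y outside the first, each prime thus excludes at
    most one c, and a large c works for all of them. *)
Lemma prime_avoidance (A : comNzRingType) (J : set A) n (Q : 'I_n -> prime_idealr A) :
  (forall l, exists y : A, y * l.+1%:R = 1) -> ideal J ->
  (forall i, exists2 x, J x & x \notin Q i) ->
  exists2 x, J x & forall i, x \notin Q i.
Proof.
move=> char0 idJ; elim: n Q => [|n IH] Q JQ.
  by exists 0; [exact: ideal0|case].
have [x Jx xQ] := IH (fun i => Q (lift ord0 i)) (fun i => JQ _).
have [y Jy yQ] := JQ ord0.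
have good i : exists N, forall c, (N <= c)%N -> x + c%:R * y \notin Q i.
  have [[c cQ]|nc] := pselect (exists c, x + c%:R * y \in Q i); last first.
    by exists 0%N => c _; apply/negP => cQ; apply: nc; exists c.
  exists c.+1 => d cd; apply/negP => dQ.
  have yQi : y \in Q i.
    have [z zE] := char0 (d - c.+1)%N.
    have -> : y = z * ((x + d%:R * y) - (x + c%:R * y)).
      have -> : d = (d - c.+1).+1 + c :> nat by lia.
      rewrite natrD; transitivity ((z * (d - c.+1).+1%:R) * y); last by ring.
      by rewrite zE mul1r.
    by apply: idealMr; rewrite rpredB.
  have xQi : x \in Q i.
    by rewrite -[x](addrK (c%:R * y)) rpredB // idealMr.
  have [j iE|iE] := unliftP ord0 i; first by move: (xQ j); rewrite -iE xQi.
  by rewrite -iE yQi in yQ.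
have /choice[N NP] := good; exists (x + (\max_i N i)%:R * y).
  by rewrite addrC; exact: idJ.2.
by move=> i; apply: NP; exact: leq_bigmax.
Qed.

Local Close Scope classical_set_scope.

(** * Division of convergent power series *)

Lemma ler_sum_inj (K : numDomainType) (I J : finType) (Q : pred I) (P : pred J)
    (f : I -> J) (F : J -> K) :
  (forall j, P j -> 0 <= F j) -> {in Q &, injective f} ->
  (forall i, Q i -> P (f i)) -> \sum_(i | Q i) F (f i) <= \sum_(j | P j) F j.
Proof.
move=> F0 finj QP; rewrite -(big_imset _ finj) /= big_mkcond [leRHS]big_mkcond.
apply: ler_sum => j _; case: imsetP => [[i Qi ->]|_]; first by rewrite QP.
by case: ifP => // /F0.
Qed.

Section Weights.
Variables (m : nat) (w : 'I_m -> nat).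
Hypothesis w_gt0 : forall i, (0 < w i)%N.

Definition wdeg (al : 'X_{1..m}) : nat := (\sum_i w i * al i)%N.

Lemma wdegD al be : wdeg (al + be)%MM = (wdeg al + wdeg be)%N.
Proof. by rewrite -big_split; apply: eq_bigr => i _; rewrite mnmDE mulnDr. Qed.

Lemma mdeg_le_wdeg al : (mdeg al <= wdeg al)%N.
Proof. by rewrite mdegE leq_sum // => i _; exact: leq_pmull. Qed.

Lemma wdeg_le_mdeg al : (wdeg al <= (\sum_i w i) * mdeg al)%N.
Proof.
rewrite mdegE big_distrr /= leq_sum // => i _; rewrite leq_mul2r (bigD1 i) //=.
by rewrite leq_addr orbT.
Qed.

End Weights.

Section WeightedDivision.
Variables (K : numFieldType) (m : nat) (w : 'I_m -> nat).
Hypothesis w_gt0 : forall i, (0 < w i)%N.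
Implicit Types (a q u : 'X_{1..m} -> K) (al be : 'X_{1..m}).
Local Notation wd := (wdeg w).

Lemma wdeg_bounded (r M : K) a : 0 < r -> bounded_by r M a -> forall t : K, 0 < t -> t <= 1 ->
  t <= r -> forall n, \sum_(al : 'X_{1..m < n}) `|a al| * t ^+ wd al <= M.
Proof.
move=> r0 aM t t0 t1 tr n; apply: le_trans (aM n); apply: ler_sum => al _.
rewrite ler_wpM2l //; apply: (@le_trans _ _ (t ^+ mdeg al)).
  by apply: ler_wiXn2l => //; [exact: ltW|exact: (mdeg_le_wdeg w_gt0)].
by rewrite lerXn2r // nnegrE ltW.
Qed.

(** The radius t^W works because [wdeg] is at most W times the degree. The sums are cut off by
    weight as well, since the recursion for the quotient is triangular with respect to the
    weight. *)
Lemma wdeg_convergent (t M : K) a : 0 < t -> t <= 1 ->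
  (forall n N, (n <= N)%N ->
     \sum_(al : 'X_{1..m < N} | (wd al < n)%N) `|a al| * t ^+ wd al <= M) ->
  convergent a.
Proof.
move=> t0 t1 aM; pose W := (\sum_i w i)%N.
have t_ge0 n : 0 <= t ^+ n by rewrite exprn_ge0 // ltW.
exists (t ^+ W), M; split=> [|n]; first exact: exprn_gt0.
pose N := (W * n + n)%N.
have widen (al : 'X_{1..m < n}) : (mdeg al < N.+1)%N.
  by have := bmdeg al; rewrite /N; lia.
apply: (le_trans _ (aM N.+1 N.+1 (leqnn _))).
apply: (@le_trans _ _ (\sum_(al : 'X_{1..m < n})
    `|a (BMultinom (widen al))| * t ^+ wd (BMultinom (widen al)))).
  apply: ler_sum => al _ /=; rewrite ler_wpM2l // -exprM.
  by apply: ler_wiXn2l => //; [exact: ltW|exact: wdeg_le_mdeg].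
apply: (ler_sum_inj (F := fun al : 'X_{1..m < N.+1} => `|a al| * t ^+ wd al)).
- by move=> al _; rewrite mulr_ge0.
- by move=> al be _ _ /(congr1 val) /= /val_inj.
- move=> al _ /=; rewrite ltnS; apply: leq_trans (wdeg_le_mdeg _ _) _.
  by rewrite /N (leq_trans _ (leq_addr _ _)) // leq_mul2l (ltnW (bmdeg al)) orbT.
Qed.

Section Division.
Variables (h : 'X_{1..m} -> K) (b0 : 'X_{1..m}).
Hypothesis h_b0 : h b0 = 1.
Hypothesis h_low : forall be, be != b0 -> (wd be <= wd b0)%N -> h be = 0.

(* The quotient [q] of [u] by [h] solves [u (al + b0) = (h * q) (al + b0)], that is
   [q = u (. + b0) + div_step q]. Since [b0] is the only monomial of [h] of weight
   at most [wdeg b0], [div_step] raises the weight, so that iteration converges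
   coefficientwise, and it contracts the norm [sum |q al| t ^ wdeg al] for small [t]. *)
Definition div_step q : 'X_{1..m} -> K := fun al => q al - psmul h q (al + b0)%MM.

Lemma div_stepE N q al : (mdeg (al + b0)%MM < N)%N ->
  div_step q al = - \sum_(k : 'X_{1..m < N, N} |
     ((al + b0)%MM == (k.1 + k.2)%MM) && ((k.1 : 'X_{1..m}) != b0)) h k.1 * q k.2.
Proof.
move=> ltN; rewrite /div_step (psmulE _ _ ltN).
have lt1 : (mdeg b0 < N)%N by move: ltN; rewrite mdegD; lia.
have lt2 : (mdeg al < N)%N by move: ltN; rewrite mdegD; lia.
rewrite (bigD1 (BMultinom lt1, BMultinom lt2)) /=; last by rewrite addmC.
rewrite h_b0 mul1r opprD addNKr; congr (- _); apply: eq_bigl => -[k1 k2] /=.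
case: eqP => //= kE; congr (~~ _); rewrite xpair_eqE !bmeqP /=.
apply/andP/idP => [[]//|k1E]; split=> //; apply/eqP.
by move: kE; rewrite (eqP k1E) addmC => /addmI.
Qed.

Lemma div_step_wdeg n q q' : (forall al, (wd al < n)%N -> q al = q' al) ->
  forall al, (wd al <= n)%N -> div_step q al = div_step q' al.
Proof.
move=> qq' al aln; rewrite !(div_stepE _ (ltnSn _)); congr (- _).
apply: eq_bigr => k /andP[/eqP kE kb0].
have [le|gt] := leqP (wd k.1) (wd b0); first by rewrite h_low ?mul0r.
rewrite qq' //; apply: leq_trans aln; move/(congr1 wd): kE; rewrite !wdegD => E.
by rewrite -(ltn_add2r (wd b0)) E [ltnRHS]addnC ltn_add2l.
Qed.

Fixpoint div_iter u n : 'X_{1..m} -> K :=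
  if n is n'.+1 then fun al => u (al + b0)%MM + div_step (div_iter u n') al
  else fun=> 0.

Lemma div_iter_stable u n l al : (wd al < n)%N ->
  div_iter u (n + l) al = div_iter u n al.
Proof.
elim: n al => // n IH al aln; rewrite addSn /=; congr (_ + _).
by apply: (@div_step_wdeg n) => // be; exact: IH.
Qed.

(** The diagonal of the iteration: by [div_iter_stable] the coefficient at al is constant from this
    index on, so no limit has to be taken. *)
Definition div_quo u : 'X_{1..m} -> K := fun al => div_iter u (wd al).+1 al.

Lemma div_quoE u al : div_quo u al = u (al + b0)%MM + div_step (div_quo u) al.
Proof.
rewrite {1}/div_quo /=; congr (_ + _); apply: (@div_step_wdeg (wd al)) => // be lt.
by rewrite /div_quo -(subnKC lt) div_iter_stable.
Qed.

Lemma div_rem u al : (b0 <= al)%MM -> u al = psmul h (div_quo u) al.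
Proof.
move=> /submK alE; have /eqP := div_quoE u (al - b0)%MM; rewrite /div_step alE.
by rewrite addrCA -subr_eq0 opprD addNKr oppr_eq0 subr_eq0 => /eqP.
Qed.

(** In the norm with parameter t the fixed point equation of [div_quoE] gives S <= Mu / t^(wdeg b0)
    + S / 2 for every partial sum S of the quotient, hence a bound that does not depend on the
    truncation. *)
Lemma div_quo_convergent u : convergent h -> convergent u -> convergent (div_quo u).
Proof.
move=> ch cu; have [r [M [Mu [r0 hM uM]]]] := common_radius ch cu.
have M0 := bounded_ge0 hM; have Mu0 := bounded_ge0 uM.
pose t0 := r / (1 + r); have r1 : 0 < 1 + r by rewrite addr_gt0.
have t0_gt0 : 0 < t0 by rewrite divr_gt0.
have t01 : t0 <= 1 by rewrite ler_pdivrMr // mul1r lerDr.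
have t0r : t0 <= r by rewrite ler_pdivrMr // ler_peMr ?lerDl // ltW.
have hM0 := wdeg_bounded r0 hM t0_gt0 t01 t0r.
(* With be of weight wdeg b0 + e + 1, the choice of t gives t^(e + 1) <= t0^e t = t0^(wdeg be) / d;
   so the terms of [h] other than b0 contribute at most M / d <= 1 / 2. *)
pose d := 2%:R * (M + 1); have d_gt0 : 0 < d by rewrite mulr_gt0 // ltr_wpDl.
have d_ge1 : 1 <= d by rewrite -[leLHS]mulr1 ler_pM // ?ler1n ?lerDr.
pose t := t0 ^+ (wd b0).+1 / d.
have t_gt0 : 0 < t by rewrite divr_gt0 // exprn_gt0.
have tt0 : t <= t0.
  rewrite ler_pdivrMr // exprSr mulrC ler_wpM2l ?(ltW t0_gt0) //.
  by rewrite (le_trans _ d_ge1) // exprn_ile1 // ltW.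
have t1 : t <= 1 by exact: le_trans t01.
have uMt := wdeg_bounded r0 uM t_gt0 t1 (le_trans tt0 t0r).
have tX n : 0 <= t ^+ n by rewrite exprn_ge0 // ltW.
pose H (be : 'X_{1..m}) := `|h be| * t ^+ (wd be - wd b0).
have H0 be : 0 <= H be by rewrite mulr_ge0.
have Hsum N : \sum_(be : 'X_{1..m < N} | (be : 'X_{1..m}) != b0) H be <= 2^-1.
  apply: (@le_trans _ _ (\sum_(be : 'X_{1..m < N}) `|h be| * t0 ^+ wd be * d^-1)).
    rewrite big_mkcond; apply: ler_sum => be _.
    have rhs0 : 0 <= `|h be| * t0 ^+ wd be * d^-1.
      by rewrite !mulr_ge0 ?invr_ge0 ?exprn_ge0 ?(ltW t0_gt0) ?(ltW d_gt0).
    case: ifP => // neb; rewrite /H.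
    have [le|gt] := leqP (wd be) (wd b0); first by apply: le_trans rhs0; rewrite h_low // normr0 mul0r.
    have [e wE] : exists e, wd be = (e.+1 + wd b0)%N by exists (wd be - wd b0).-1; rewrite prednK ?subn_gt0 // subnK // ltnW.
    rewrite -mulrA ler_wpM2l // wE addnK exprSr addSnnS exprD -mulrA.
    by apply: ler_wpM2r; [exact: ltW|rewrite lerXn2r // nnegrE ltW].
  rewrite -mulr_suml ler_pdivrMr // /d mulrA mulVf ?pnatr_eq0 // mul1r.
  by apply: le_trans (hM0 N) _; rewrite lerDl.
apply: (@wdeg_convergent t (2%:R * (Mu / t ^+ wd b0))) => // n N' nN'.
pose N := (N' + mdeg b0)%N.
pose F al := `|div_quo u al| * t ^+ wd al; have F0 al : 0 <= F al by rewrite mulr_ge0.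
pose S := \sum_(al : 'X_{1..m < N} | (wd al < n)%N) F al.
apply: (@le_trans _ _ S).
  have widen (al : 'X_{1..m < N'}) : (mdeg al < N)%N by rewrite ltn_addr // bmdeg.
  apply: (@ler_sum_inj _ _ _ (fun al : 'X_{1..m < N'} => (wd al < n)%N)
    (fun al : 'X_{1..m < N} => (wd al < n)%N)
    (fun al : 'X_{1..m < N'} => BMultinom (widen al))
    (fun al : 'X_{1..m < N} => F al)) => //.
  by move=> al be _ _ /(congr1 val) /= /val_inj.
(* [S] is a finite sum, so half of it can be moved to the left side. *)
suff le_S : S <= Mu / t ^+ wd b0 + 2^-1 * S.
  rewrite -(ler_pM2l (_ : 0 < 2^-1 :> K)) ?invr_gt0 // mulKf ?pnatr_eq0 //.
  have -> : 2^-1 * S = S - 2^-1 * S.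
    by rewrite -{2}[S]mul1r -mulrBl; congr (_ * _); field.
  by rewrite lerBlDr.
have ltN al : (wd al < n)%N -> (mdeg (al + b0)%MM < N)%N.
  move=> aln; rewrite mdegD /N ltn_add2r (leq_ltn_trans (mdeg_le_wdeg w_gt0 al)) //.
  exact: leq_trans nN'.
pose D (al : 'X_{1..m}) := \sum_(k : 'X_{1..m < N, N} |
  ((al + b0)%MM == (k.1 + k.2)%MM) && ((k.1 : 'X_{1..m}) != b0)) `|h k.1| * `|div_quo u k.2|.
apply: (@le_trans _ _ (\sum_(al : 'X_{1..m < N} | (wd al < n)%N)
    (`|u (al + b0)%MM| * t ^+ wd al + D al * t ^+ wd al))).
  apply: ler_sum => al aln; rewrite -mulrDl ler_wpM2r // div_quoE.
  apply: le_trans (ler_normD _ _) _; rewrite lerD2l (div_stepE _ (ltN _ aln)) normrN.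
  apply: le_trans (ler_norm_sum _ _ _) _.
  by apply: ler_sum => k _; rewrite normrM.
rewrite big_split /= lerD //.
  rewrite ler_pdivlMr ?exprn_gt0 // mulr_suml.
  apply: le_trans (uMt (N + mdeg b0)%N).
  have lt' (al : 'X_{1..m < N}) : (mdeg (al + b0)%MM < N + mdeg b0)%N.
    by rewrite mdegD ltn_add2r bmdeg.
  apply: (@le_trans _ _ (\sum_(al : 'X_{1..m < N} | (wd al < n)%N)
      (fun be : 'X_{1..m < N + mdeg b0} => `|u be| * t ^+ wd be) (BMultinom (lt' al)))).
    by apply: ler_sum => al _ /=; rewrite wdegD exprD mulrA.
  apply: ler_sum_inj => [al _|al be _ _ /(congr1 val) /= /addIm /val_inj|//] //.
  by rewrite mulr_ge0.
pose G (k : 'X_{1..m < N, N}) := H k.1 * F k.2.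
have G0 k : 0 <= G k by rewrite mulr_ge0.
apply: (@le_trans _ _ (\sum_(k : 'X_{1..m < N, N} |
    ((k.1 : 'X_{1..m}) != b0) && (wd k.2 < n)%N) G k)); last first.
  rewrite -(pair_big (fun be : 'X_{1..m < N} => (be : 'X_{1..m}) != b0)
    (fun al : 'X_{1..m < N} => (wd al < n)%N) (fun x y : 'X_{1..m < N} => H x * F y)) /=.
  under eq_bigr do rewrite -mulr_sumr.
  by rewrite -mulr_suml ler_wpM2r ?Hsum // sumr_ge0.
apply: (@le_trans _ _ (\sum_(al : 'X_{1..m < N} | (wd al < n)%N)
   \sum_(k : 'X_{1..m < N, N} | ((al + b0)%MM == (k.1 + k.2)%MM) &&
     (((k.1 : 'X_{1..m}) != b0) && (wd k.2 < n)%N)) G k)).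
  apply: ler_sum => al aln; rewrite mulr_suml big_mkcond [leRHS]big_mkcond.
  apply: ler_sum => k _; case: ifP => [/andP[kE kb]|_]; last by case: ifP.
  rewrite kE kb /=; have [le|gt] := leqP (wd k.1) (wd b0).
    by rewrite h_low // normr0 !mul0r; case: ifP.
  move/eqP/(congr1 wd): kE; rewrite !wdegD => wE.
  have -> : (wd al = wd k.1 - wd b0 + wd k.2)%N.
    by rewrite addnC addnBA ?(ltnW gt) // addnC -wE addnK.
  have -> : (wd k.2 < n)%N.
    apply: leq_trans aln; by rewrite ltnS -(leq_add2r (wd b0)) wE addnC leq_add2r ltnW.
  by rewrite /G /H /F exprD mulrACA.
rewrite (exchange_big_dep (fun k : 'X_{1..m < N, N} =>
    ((k.1 : 'X_{1..m}) != b0) && (wd k.2 < n)%N)) /=; last first.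
  by move=> al k _ /andP[].
apply: ler_sum => k kP.
have [al alP|none] := pickP (fun al : 'X_{1..m < N} =>
    (wd al < n)%N && (((al + b0)%MM == (k.1 + k.2)%MM) &&
     (((k.1 : 'X_{1..m}) != b0) && (wd k.2 < n)%N))); last by rewrite big_pred0.
rewrite (big_pred1 al) // => be /=; apply/idP/eqP => [/and3P[_ /eqP bE _]|-> //].
by case/and3P: alP => _ /eqP aE _; apply: val_inj; move: bE; rewrite -aE => /addIm.
Qed.

End Division.

End WeightedDivision.

Lemma weighted_division (K : numFieldType) m (w : 'I_m -> nat) (h u : cps K m)
    (b0 : 'X_{1..m}) : (forall i, 0 < w i)%N -> h b0 != 0 ->
  (forall be, be != b0 -> (wdeg w be <= wdeg w b0)%N -> h be = 0) ->
  exists q r : cps K m, u = q * h + r /\ forall al, (b0 <= al)%MM -> r al = 0.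
Proof.
move=> w0 hb0 hlow; pose c := h b0.
have cc : convergent (fun al => h al / c).
  have [r [M [r0 hM]]] := coefP h; exists r, (M / `|c|); split=> // n.
  rewrite ler_pdivlMr ?normr_gt0 // mulr_suml; apply: le_trans (hM n).
  by apply: ler_sum => al _; rewrite normrM normfV mulrAC divfK ?normr_eq0.
pose h' := CPS cc.
have h'b0 : h' b0 = 1 by rewrite /= divff.
have h'low be : be != b0 -> (wdeg w be <= wdeg w b0)%N -> h' be = 0.
  by move=> ne le /=; rewrite hlow // mul0r.
have cq := div_quo_convergent w0 h'b0 h'low (coefP h') (coefP u).
pose q' := CPS cq.
have ccq : convergent (fun al => q' al / c).
  have [r [M [r0 hM]]] := coefP q'; exists r, (M / `|c|); split=> // n.
  rewrite ler_pdivlMr ?normr_gt0 // mulr_suml; apply: le_trans (hM n).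
  by apply: ler_sum => al _; rewrite normrM normfV mulrAC divfK ?normr_eq0.
pose q := CPS ccq.
have qh : q * h = h' * q'.
  apply: cpsP => al; rewrite [LHS]psmulC /=; apply: eq_bigr => be _.
  by rewrite mulrA mulrAC.
exists q, (u - q * h); split=> [|al le]; first by rewrite addrC subrK.
by rewrite qh; apply/eqP; rewrite subr_eq0; apply/eqP; exact: div_rem.
Qed.

Section ConvergentSeries.
Variables (K : numFieldType) (m : nat).
Local Notation O := (cps K m).
Implicit Types (x y : O) (al be : 'X_{1..m}).

Lemma cpsD_coef x y al : (x + y) al = x al + y al. Proof. by []. Qed.

Lemma cpsM_coef n x y al : (mdeg al < n)%N ->
  (x * y) al = (trunc n x * trunc n y)@_al.
Proof. exact: psmul_trunc. Qed.

Lemma cps_sum_coef (I : Type) (r : seq I) (P : pred I) (F : I -> O) al :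
  (\sum_(i <- r | P i) F i) al = \sum_(i <- r | P i) F i al.
Proof. by elim/big_rec2: _ => // i y x _ <-. Qed.

Lemma deriv_cpsB i x y : deriv_cps i (x - y) = deriv_cps i x - deriv_cps i y.
Proof. by apply: cpsP => al; rewrite /= /psderiv /= /psadd /psopp mulrBr. Qed.

HB.instance Definition _ i :=
  GRing.isZmodMorphism.Build O O (deriv_cps i) (deriv_cpsB i).

Lemma trunc_deriv i n x be : (mdeg be < n)%N ->
  (trunc n (deriv_cps i x))@_be = ((trunc n.+1 x)^`M(i))@_be.
Proof.
move=> ltn; rewrite trunc_coef //= /psderiv mcoeff_mderiv trunc_coef.
  by rewrite mulr_natl.
by rewrite mdegD mdeg1 addn1.
Qed.

(** The coefficient at al depends on truncations of the factors only, so the Leibniz rule of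
    polynomials applies. Differentiation lowers the degree, which is why a truncation one order
    longer is differentiated. *)
Lemma deriv_cpsM i x y :
  deriv_cps i (x * y) = deriv_cps i x * y + x * deriv_cps i y.
Proof.
apply: cpsP => al; rewrite cpsD_coef !(cpsM_coef _ _ (ltnSn (mdeg al))).
set n := (mdeg al).+1.
have -> : (deriv_cps i (x * y)) al = ((trunc n.+1 x * trunc n.+1 y)^`M(i))@_al.
  rewrite mcoeff_mderiv -mulr_natl /= /psderiv; congr (_ * _).
  by rewrite (@psmul_trunc _ _ n.+1) // mdegD mdeg1 addn1.
have tr z be : (mdeg be < n)%N -> (trunc n z)@_be = (trunc n.+1 z)@_be.
  by move=> lt; rewrite !trunc_coef // (ltn_trans lt).
rewrite mderivM mcoeffD; congr (_ + _).
  transitivity (((trunc n.+1 x)^`M(i) * trunc n y)@_al).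
    rewrite ![(trunc n.+1 x)^`M(i) * _]mulrC; apply: (@mcoeffM_eq _ _ n) => // be lt.
    by rewrite tr.
  by apply: (@mcoeffM_eq _ _ n) => // be lt; rewrite trunc_deriv.
transitivity ((trunc n x * (trunc n.+1 y)^`M(i))@_al).
  by apply: (@mcoeffM_eq _ _ n) => // be lt; rewrite tr.
rewrite ![trunc n x * _]mulrC; apply: (@mcoeffM_eq _ _ n) => // be lt.
by rewrite trunc_deriv.
Qed.

Lemma convergent_monomial (c : K) (be : 'X_{1..m}) :
  convergent (fun al => c *+ (al == be)).
Proof.
exists 1, `|c|; split=> // n.
have [al0 /eqP al0E|ne0] := pickP (fun al : 'X_{1..m < n} => (al : 'X_{1..m}) == be).
  rewrite (bigD1 al0) //= al0E eqxx expr1n mulr1 big1 ?addr0 // => al.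
  by rewrite bmeqP al0E => /negPf ->; rewrite normr0 mul0r.
by rewrite big1 // => al _; rewrite ne0 normr0 mul0r.
Qed.

Definition monomial (c : K) be : O := CPS (convergent_monomial c be).

Lemma monomialM c be x al :
  (monomial c be * x) al = if (be <= al)%MM then c * x (al - be)%MM else 0.
Proof.
rewrite /= /psmul; case: ifP => [le|nle].
  have lt : (mdeg be < (mdeg al).+1)%N.
    by rewrite ltnS -(submK le) mdegD leq_addl.
  rewrite (bigD1 (BMultinom lt)) //= eqxx mulr1n big1 ?addr0 // => ga /andP[_].
  by rewrite bmeqP /= => /negPf ->; rewrite mul0r.
rewrite big1 // => ga le; case: eqP => [E|_]; last by rewrite mul0r.
by rewrite E nle in le.
Qed.

Lemma monomialD c d be ga :
  monomial c be * monomial d ga = monomial (c * d) (be + ga)%MM.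
Proof.
apply: cpsP => al; rewrite monomialM /=.
case: ifP => [le|nle]; last first.
  by case: eqP => // E; rewrite E lem_addr in nle.
by rewrite -{2}(submK le) addmC eqm_add2l mulrnAr.
Qed.

Definition cpsC (c : K) : O := monomial c 0%MM.

Lemma cpsC_coef c x al : (cpsC c * x) al = c * x al.
Proof.
rewrite monomialM subm0; case: mnm_lepP => // ne; case: ne => i.
by rewrite mnm0E.
Qed.

Lemma cpsC_zmod_morphism : zmod_morphism cpsC.
Proof.
move=> c d; apply: cpsP => al /=; rewrite /psadd /psopp.
by rewrite mulrnBl.
Qed.

Lemma cpsC_monoid_morphism : monoid_morphism cpsC.
Proof.
split; first by apply: cpsP => al.
by move=> c d; rewrite monomialD addm0.
Qed.

HB.instance Definition _ := GRing.isZmodMorphism.Build K O cpsC cpsC_zmod_morphism.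
HB.instance Definition _ := GRing.isMonoidMorphism.Build K O cpsC cpsC_monoid_morphism.

Definition cpsX (i : 'I_m) : O := monomial 1 U_(i)%MM.

Lemma cpsXn i n : cpsX i ^+ n = monomial 1 (U_(i) *+ n)%MM.
Proof.
elim: n => [|n IH]; first by rewrite expr0 mulm0n; exact: (esym (rmorph1 cpsC)).
by rewrite exprS IH monomialD mulmS mulr1.
Qed.

Lemma deriv_cpsX i j : deriv_cps i (cpsX j) = (i == j)%:R.
Proof.
apply: cpsP => al; rewrite /= /psderiv /=.
have -> : ((i == j)%:R : O) al = ((i == j) && (al == 0%MM))%:R.
  by case: (i == j); [rewrite /= /ps1|].
have [->|ne] := eqVneq al 0%MM.
  by rewrite add0m andbT eq_mnm1 mnm0E mul1r.
rewrite andbF; case: eqP; rewrite ?mulr0 // => /(congr1 mdeg) /eqP.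
by rewrite mdegD !mdeg1 addn1 eqSS mdeg_eq0 (negPf ne).
Qed.

End ConvergentSeries.

(** * Linear changes of coordinates *)

Section LinearForms.
Variables (K : comNzRingType) (m : nat).
Implicit Types (M N : 'M[K]_m) (p q : {mpoly K[m]}) (al be : 'X_{1..m}).

Definition linear_form M (j : 'I_m) : {mpoly K[m]} := \sum_i M j i *: 'X_i.

Definition linear_forms M : m.-tuple {mpoly K[m]} := [tuple linear_form M j | j < m].

Lemma comp_linearP M c p q : (c *: p + q) \mPo linear_forms M =
  c *: (p \mPo linear_forms M) + (q \mPo linear_forms M).
Proof. by rewrite comp_mpolyD comp_mpolyZ. Qed.

Lemma comp_linear_homog M be : ('X_[be] \mPo linear_forms M) \is (mdeg be).-homog.
Proof.
rewrite comp_mpolyX mdegE.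
elim/big_rec2: _ => [|i d p _ IH]; first exact: dhomog1.
apply: dhomogM => //; rewrite -[X in X.-homog]mul1n.
apply: dhomogMn; rewrite tnth_mktuple rpred_sum // => j _.
by apply: dhomogZ; rewrite dhomogX; apply/eqP; exact: mdeg1.
Qed.

Lemma comp_linear_low M p n : (forall be, (mdeg be < n)%N -> p@_be = 0) ->
  forall al, (mdeg al < n)%N -> (p \mPo linear_forms M)@_al = 0.
Proof.
move=> p0 al ltn; rewrite comp_mpolyEX raddf_sum big1 //= => be _.
rewrite mcoeffZ; have [lt|ge] := ltnP (mdeg be) n; first by rewrite p0 ?mul0r.
rewrite (dhomog_nemf_coeff (comp_linear_homog M be)) ?mulr0 //.
by apply: contraTneq ltn => ->; rewrite -leqNgt.
Qed.

Lemma comp_linear_eq M p q n : (forall be, (mdeg be < n)%N -> p@_be = q@_be) ->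
  forall al, (mdeg al < n)%N ->
    (p \mPo linear_forms M)@_al = (q \mPo linear_forms M)@_al.
Proof.
move=> pq al ltn; apply/eqP; rewrite -subr_eq0 -mcoeffB -comp_mpolyB.
rewrite (@comp_linear_low _ _ n) // => be lt.
by rewrite mcoeffB pq // subrr.
Qed.

Lemma comp_linearM M N p :
  (p \mPo linear_forms M) \mPo linear_forms N = p \mPo linear_forms (M *m N).
Proof.
have comp_lin P j : ('X_j \mPo linear_forms P) = linear_form P j.
  by rewrite comp_mpolyXU -tnth_nth tnth_mktuple.
elim/mpolyind: p => [|c be p _ _ IH]; first by rewrite !comp_mpoly0.
rewrite (comp_linearP M) (comp_linearP N) IH (comp_linearP (M *m N)).
suff -> : ('X_[be] \mPo linear_forms M) \mPo linear_forms N =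
  'X_[be] \mPo linear_forms (M *m N) by [].
rewrite mpolyXE_id !rmorph_prod /=; apply: eq_bigr => j _.
rewrite !rmorphXn /= !comp_lin; congr (_ ^+ _).
rewrite /linear_form raddf_sum /=; under eq_bigr do rewrite comp_mpolyZ comp_lin.
under eq_bigr do rewrite /linear_form scaler_sumr.
rewrite exchange_big /=; apply: eq_bigr => i _; rewrite mxE scaler_suml.
by apply: eq_bigr => l _; rewrite scalerA.
Qed.

Lemma comp_linear1 p : p \mPo linear_forms 1%:M = p.
Proof.
rewrite -[RHS]comp_mpoly_id; congr (_ \mPo _); apply: eq_from_tnth => j.
rewrite !tnth_mktuple /linear_form (bigD1 j) //= mxE eqxx scale1r.
by rewrite big1 ?addr0 // => i ne; rewrite mxE eq_sym (negPf ne) scale0r.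
Qed.

Lemma mderiv_comp_linear M p i : (p \mPo linear_forms M)^`M(i) =
  \sum_j M j i *: (p^`M(j) \mPo linear_forms M).
Proof.
pose chain q := (q \mPo linear_forms M)^`M(i) =
  \sum_j M j i *: (q^`M(j) \mPo linear_forms M).
have chainM q r : chain q -> chain r -> chain (q * r).
  rewrite /chain => Hq Hr; rewrite rmorphM /= mderivM Hq Hr mulr_suml mulr_sumr -big_split.
  apply: eq_bigr => j _ /=; rewrite mderivM comp_mpolyD !rmorphM /= scalerDr.
  by rewrite -scalerAl -scalerAr.
have chain1 : chain 1.
  rewrite /chain rmorph1 -mpolyC1 mderivC big1 // => j _.
  by rewrite mderivC comp_mpoly0 scaler0.
have chainX j : chain 'X_j.
  rewrite /chain comp_mpolyXU -tnth_nth tnth_mktuple /linear_form.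
  have dX l l' : ('X_l : {mpoly K[m]})^`M(l') = (l == l')%:R.
    rewrite mderivX mnm1E; case: eqP => [->|_]; last by rewrite scale0r.
    by rewrite scale1r -{1}[U_(l')%MM]add0m addmK mpolyX0.
  rewrite (raddf_sum (@mderiv _ _ i)) /= (bigD1 i) //= mderivZ dX eqxx big1 => [|l ne].
    rewrite addr0 (bigD1 j) //= dX eqxx comp_mpoly1 big1 ?addr0 // => l ne.
    by rewrite dX eq_sym (negPf ne) rmorph0 scaler0.
  by rewrite mderivZ dX (negPf ne) scaler0.
have chainXn j n : chain ('X_j ^+ n).
  by elim: n => [|n IH]; [rewrite expr0|rewrite exprS; exact: chainM].
suff : chain p by [].
elim/mpolyind: p => [|c be p _ _ IH].
  rewrite /chain comp_mpoly0 mderiv0 big1 // => j _.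
  by rewrite mderiv0 comp_mpoly0 scaler0.
have cX : chain 'X_[be].
  by rewrite mpolyXE_id; apply: big_ind => // j _; exact: chainXn.
rewrite /chain comp_mpolyD comp_mpolyZ mderivD mderivZ cX IH scaler_sumr -big_split.
apply: eq_bigr => j _ /=; rewrite mderivD mderivZ comp_mpolyD comp_mpolyZ scalerDr.
by rewrite !scalerA mulrC.
Qed.

End LinearForms.

Section LinearSubstitution.
Variables (K : numFieldType) (m : nat).
Local Notation O := (cps K m).
Implicit Types (M N : 'M[K]_m) (x y : O) (al be : 'X_{1..m}).

(** Linear forms have no constant term, so a coefficient of degree n of the composite involves the
    part of degree n of the series alone; any longer truncation gives the same value ([lsubE]). *)
Definition lsub M (a : 'X_{1..m} -> K) : 'X_{1..m} -> K := fun al =>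
  (trunc (mdeg al).+1 a \mPo linear_forms M)@_al.

Lemma lsubE n M a al : (mdeg al < n)%N ->
  lsub M a al = (trunc n a \mPo linear_forms M)@_al.
Proof.
move=> ltn; apply: (@comp_linear_eq _ _ M _ _ (mdeg al).+1) => // be lt.
by rewrite !trunc_coef // (leq_trans lt).
Qed.

Lemma trunc_lsub n M a be : (mdeg be < n)%N ->
  (trunc n (lsub M a))@_be = (trunc n a \mPo linear_forms M)@_be.
Proof. by move=> lt; rewrite (trunc_coef _ lt) (lsubE _ _ lt). Qed.

Definition norm1 n (p : {mpoly K[m]}) : K := \sum_(al : 'X_{1..m < n}) `|p@_al|.

Lemma norm1_ge0 n p : 0 <= norm1 n p. Proof. by rewrite sumr_ge0. Qed.

Lemma norm1M n p q : norm1 n (p * q) <= norm1 n p * norm1 n q.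
Proof.
pose F (k : 'X_{1..m < n, n}) := `|p@_k.1| * `|q@_k.2|.
apply: (@le_trans _ _ (\sum_(k : 'X_{1..m < n, n}) F k)); last first.
  rewrite -(pair_bigA _ (fun x y : 'X_{1..m < n} => `|p@_x| * `|q@_y|)) /=.
  under eq_bigr do rewrite -mulr_sumr.
  by rewrite -mulr_suml.
apply: (@le_trans _ _ (\sum_(al : 'X_{1..m < n})
   \sum_(k : 'X_{1..m < n, n} | (al : 'X_{1..m}) == (k.1 + k.2)%MM) F k)).
  apply: ler_sum => al _; rewrite (mcoeff_poly_mul _ _ (bmdeg al)).
  apply: le_trans (ler_norm_sum _ _ _) _.
  by apply: ler_sum => k _; rewrite normrM.
rewrite (exchange_big_dep xpredT) //=; apply: ler_sum => k _.
have [lt|ge] := ltnP (mdeg (k.1 + k.2)%MM) n.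
  by rewrite (big_pred1 (BMultinom lt)).
rewrite big_pred0 ?mulr_ge0 // => al; apply/negP => /eqP alE.
by have := bmdeg al; rewrite alE ltnNge ge.
Qed.

Lemma norm1_monomial n (c : K) be : norm1 n (c *: 'X_[be]) <= `|c|.
Proof.
rewrite /norm1; have E al : `|(c *: 'X_[be])@_al| = if be == al then `|c| else 0.
  by rewrite mcoeffZ mcoeffX; case: eqP; rewrite ?mulr1 ?mulr0 ?normr0.
have [al0 /eqP al0E|ne0] := pickP (fun al : 'X_{1..m < n} => (al : 'X_{1..m}) == be).
  rewrite (bigD1 al0) //= E al0E eqxx big1 ?addr0 // => al.
  by rewrite E bmeqP al0E eq_sym => /negPf ->.
by rewrite big1 ?normr_ge0 // => al _; rewrite E eq_sym ne0.
Qed.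

Lemma norm1_comp_linear M : exists2 C, 0 < C & forall n be,
  norm1 n ('X_[be] \mPo linear_forms M) <= C ^+ mdeg be.
Proof.
pose C := 1 + \sum_j \sum_i `|M j i|.
have S0 : 0 <= \sum_j \sum_i `|M j i| by apply: sumr_ge0 => j _; exact: sumr_ge0.
have C0 : 0 <= C by rewrite addr_ge0.
exists C => [|n be]; first by rewrite ltr_pwDl.
have normL j : norm1 n (linear_form M j) <= C.
  apply: (@le_trans _ _ (\sum_i `|M j i|)); last first.
    have -> : C = \sum_i `|M j i| + (1 + \sum_(l | l != j) \sum_i `|M l i|).
      by rewrite /C (bigD1 j) //= addrCA.
    rewrite lerDl addr_ge0 //.
    by apply: sumr_ge0 => l _; exact: sumr_ge0.
  apply: (@le_trans _ _ (\sum_i norm1 n (M j i *: 'X_i))).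
    rewrite [leRHS]exchange_big /=; apply: ler_sum => al _.
    by rewrite raddf_sum; exact: ler_norm_sum.
  by apply: ler_sum => i _; exact: norm1_monomial.
have norm_1 : norm1 n 1 <= 1.
  by rewrite -[X in norm1 _ X]scale1r -mpolyX0 (le_trans (norm1_monomial _ _ _)) ?normr1.
have normLn j l : norm1 n (linear_form M j ^+ l) <= C ^+ l.
  elim: l => // l IH; rewrite !exprS; apply: le_trans (norm1M _ _ _) _.
  by rewrite ler_pM ?norm1_ge0.
rewrite comp_mpolyX mdegE.
elim/big_rec2: _ => [|j d p _ IH]; first by rewrite expr0.
rewrite exprD tnth_mktuple; apply: le_trans (norm1M _ _ _) _.
by rewrite ler_pM ?norm1_ge0.
Qed.

Lemma lsub_sum n M a al : (mdeg al < n)%N ->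
  lsub M a al = \sum_(be : 'X_{1..m < n}) a be * ('X_[be] \mPo linear_forms M)@_al.
Proof.
move=> ltn; rewrite (lsubE _ _ ltn) /trunc (raddf_sum (comp_mpoly (linear_forms M))) raddf_sum.
by apply: eq_bigr => be _ /=; rewrite comp_mpolyZ mcoeffZ.
Qed.

(** A monomial of degree n becomes a form of degree n whose coefficients have absolute sum at most
    C^n; shrinking the radius from r to r / C absorbs this factor. *)
Lemma convergent_lsub M a : convergent a -> convergent (lsub M a).
Proof.
move=> [r [B [r0 aB]]]; have [C C0 normC] := norm1_comp_linear M.
exists (r / C), B; split=> [|n]; first by rewrite divr_gt0.
have rC0 l : 0 <= (r / C) ^+ l by rewrite exprn_ge0 // divr_ge0 // ltW.
apply: le_trans (aB n).
apply: (@le_trans _ _ (\sum_(al : 'X_{1..m < n}) \sum_(be : 'X_{1..m < n})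
    `|a be| * (`|('X_[be] \mPo linear_forms M)@_al| * (r / C) ^+ mdeg be))).
  apply: ler_sum => al _; rewrite (lsub_sum _ _ (bmdeg al)).
  apply: le_trans (ler_wpM2r (rC0 _) (ler_norm_sum _ _ _)) _.
  rewrite mulr_suml; apply: ler_sum => be _; rewrite normrM -mulrA ler_wpM2l //.
  have [->//|ne] := eqVneq (mdeg al) (mdeg be).
  rewrite (dhomog_nemf_coeff (comp_linear_homog M be)) ?normr0 ?mul0r //.
rewrite exchange_big /=; apply: ler_sum => be _; rewrite -mulr_sumr ler_wpM2l //.
rewrite -mulr_suml expr_div_n mulrCA ger_pMr ?exprn_gt0 //.
by rewrite ler_pdivrMr ?exprn_gt0 // mul1r; exact: normC.
Qed.

Definition linsub M x : O := CPS (convergent_lsub M (coefP x)).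

Lemma linsub_zmod_morphism M : zmod_morphism (linsub M).
Proof.
move=> x y; apply: cpsP => al.
rewrite [LHS](lsub_sum _ _ (ltnSn _)) [RHS]cpsD_coef /= /psopp.
rewrite !(lsub_sum _ _ (ltnSn _)) -sumrB; apply: eq_bigr => be _.
by rewrite -mulrBl.
Qed.

Lemma linsub_monoid_morphism M : monoid_morphism (linsub M).
Proof.
split.
  apply: cpsP => al; rewrite [LHS](lsubE _ _ (ltnSn _)).
  transitivity ((1 \mPo linear_forms M)@_al).
    apply: (@comp_linear_eq _ _ M _ _ (mdeg al).+1) => // be lt.
    by rewrite trunc_coef // mcoeff1.
  by rewrite rmorph1 mcoeff1.
move=> x y; apply: cpsP => al; have lt := ltnSn (mdeg al); set n := (mdeg al).+1 in lt.
rewrite [LHS](lsubE _ _ lt) (cpsM_coef _ _ lt).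
transitivity (((trunc n x * trunc n y) \mPo linear_forms M)@_al).
  apply: (@comp_linear_eq _ _ M _ _ n) => // be lt'.
  by rewrite (trunc_coef _ lt') (cpsM_coef _ _ lt').
rewrite rmorphM /=; transitivity ((trunc n (linsub M x) * (trunc n y \mPo linear_forms M))@_al).
  by apply: (@mcoeffM_eq _ _ n) => // be lt'; rewrite trunc_lsub.
rewrite ![trunc n (linsub M x) * _]mulrC.
by apply: (@mcoeffM_eq _ _ n) => // be lt'; rewrite trunc_lsub.
Qed.

HB.instance Definition _ M :=
  GRing.isZmodMorphism.Build O O (linsub M) (linsub_zmod_morphism M).
HB.instance Definition _ M :=
  GRing.isMonoidMorphism.Build O O (linsub M) (linsub_monoid_morphism M).

Lemma linsubK M N x : M *m N = 1%:M -> linsub N (linsub M x) = x.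
Proof.
move=> MN; apply: cpsP => al; rewrite [LHS](lsubE _ _ (ltnSn _)).
rewrite -(trunc_coef x (ltnSn (mdeg al))); set n := (mdeg al).+1.
rewrite -[in RHS](comp_linear1 (trunc n x)) -MN -comp_linearM.
by apply: (@comp_linear_eq _ _ N _ _ n) => // be lt; rewrite trunc_lsub.
Qed.

Lemma deriv_linsub M i x : deriv_cps i (linsub M x) =
  \sum_j cpsC m (M j i) * linsub M (deriv_cps j x).
Proof.
apply: cpsP => al; rewrite cps_sum_coef; under eq_bigr do rewrite cpsC_coef.
have lt' : (mdeg (al + U_(i))%MM < (mdeg al).+2)%N by rewrite mdegD mdeg1 addn1.
rewrite [LHS]/= /psderiv /= (lsubE _ _ lt') mulr_natl -mcoeff_mderiv.
rewrite mderiv_comp_linear raddf_sum; apply: eq_bigr => j _.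
rewrite /= mcoeffZ (lsubE _ _ (ltnSn _)); congr (_ * _).
apply: (@comp_linear_eq _ _ M _ _ (mdeg al).+1) => // be lt.
by rewrite -trunc_deriv.
Qed.

End LinearSubstitution.

Lemma digits_inj (B m : nat) (a b : 'I_m -> nat) :
  (forall i, a i < B)%N -> (forall i, b i < B)%N ->
  (\sum_i a i * B ^ i = \sum_i b i * B ^ i)%N -> a =1 b.
Proof.
elim: m a b => [|m IH] a b aB bB; first by move=> _ [].
have E (c : 'I_m.+1 -> nat) :
    (\sum_i c i * B ^ i = (\sum_i c (lift ord0 i) * B ^ i) * B + c ord0)%N.
  rewrite big_ord_recl expn0 muln1 addnC; congr (_ + _)%N; rewrite big_distrl /=.
  by apply: eq_bigr => i _; rewrite -mulnA -expnSr.
have B0 : (0 < B)%N by exact: leq_ltn_trans (aB ord0).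
rewrite !E => ab i; have ab0 : a ord0 = b ord0.
  by have := congr1 (modn^~ B) ab; rewrite !modnMDl !modn_small.
have [j ->|->//] := unliftP ord0 i.
apply: (IH (fun i => a (lift ord0 i)) (fun i => b (lift ord0 i))) => //.
by move/eqP: ab; rewrite ab0 eqn_add2r eqn_pmul2r // => /eqP.
Qed.

Lemma poly_nonroot (K : numDomainType) (p : {poly K}) : p != 0 ->
  exists c, p.[c] != 0.
Proof.
move=> p0; apply: contrapT => nroot; case/negP: p0; apply/eqP.
apply: (@roots_geq_poly_eq0 _ p [seq n%:R | n <- iota 0 (size p)]).
- apply/allP => _ /mapP[n _ ->]; apply/eqP; apply: contrapT => /eqP pn.
  by apply: nroot; exists n%:R.
- by rewrite map_inj_uniq ?iota_uniq // => i j /eqP; rewrite eqr_nat => /eqP.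
- by rewrite size_map size_iota.
Qed.

(* Kronecker substitution: [x_i |-> c ^ (B ^ i)] separates the monomials of [g]. *)
Lemma mpoly_nonroot (K : numDomainType) m (g : {mpoly K[m]}) : g != 0 ->
  exists v, g.@[v] != 0.
Proof.
move=> g0; pose B := msize g.
pose e (al : 'X_{1..m}) := (\sum_i al i * B ^ i)%N.
have ltB al i : al \in msupp g -> (al i < B)%N.
  by move=> /msize_mdeg_lt; apply: leq_ltn_trans; rewrite mdegE (bigD1 i) ?leq_addr.
have einj : {in msupp g &, injective e}.
  move=> al be alg beg /digits_inj E; apply/mnmP; apply: E => i; exact: ltB.
pose U : {poly K} := \sum_(al <- msupp g) g@_al *: 'X^(e al).
have [|c cU] := @poly_nonroot _ U.
  have [al alg] : exists al, al \in msupp g.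
    by move: g0; rewrite -msupp_eq0; case: (msupp g) => // al s _; exists al; rewrite inE eqxx.
  apply/eqP => /(congr1 (fun p : {poly K} => p`_(e al))) /eqP.
  rewrite coef0 coef_sum (bigD1_seq al) ?msupp_uniq //= big_seq_cond big1 => [|be].
    by rewrite addr0 coefZ coefXn eqxx mulr1 mcoeff_eq0 alg.
  move=> /andP[beg ne]; rewrite coefZ coefXn; case: eqP => [/einj E|_].
    by rewrite E ?eqxx // in ne.
  by rewrite mulr0.
exists (fun i => c ^+ (B ^ i)); rewrite mevalE; congr (_ != 0): cU.
rewrite horner_sum; apply: eq_bigr => al _; rewrite hornerZ hornerXn; congr (_ * _).
rewrite -prodrXr; apply: eq_bigr => i _; rewrite -exprM; congr (_ ^+ _).
by rewrite mulnC.
Qed.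

Section RegularCoordinates.
Variables (K : numFieldType) (m : nat).
Local Notation O := (cps K m.+1).

Lemma homog_axis_coef (p : {mpoly K[m.+1]}) d i : p \is d.-homog ->
  p@_(U_(i) *+ d)%MM = p.@[fun j => (j == i)%:R].
Proof.
move=> hp; rewrite mevalE.
have term be : be \in msupp p -> be != (U_(i) *+ d)%MM ->
    p@_be * \prod_j ((j == i)%:R : K) ^+ be j = 0.
  move=> bep ne; have [j ji bej] : exists2 j, j != i & be j != 0%N.
    apply: contrapT => nj; case/eqP: ne; apply/mnmP => j; rewrite mulmnE mnm1E.
    have be0 l : l != i -> be l = 0%N.
      by move=> li; apply/eqP/negP => /negP bel; apply: nj; exists l.
    have [ij|ij] := eqVneq i j; last by rewrite be0 // eq_sym.
    have bed : mdeg be = d := dhomog_mf hp bep.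
    rewrite mul1n -bed -ij mdegE (bigD1 i) //= big1 ?addn0 //.
  rewrite (bigD1 j) //= (negPf ji) expr0n (negPf bej) mul0r mulr0 //.
have [ini|nini] := boolP ((U_(i) *+ d)%MM \in msupp p); last first.
  rewrite memN_msupp_eq0 // big_seq big1 // => be bep; apply: term => //.
  by apply: contraNneq nini => <-.
rewrite (bigD1_seq (U_(i) *+ d)%MM) ?msupp_uniq //= [X in _ + X]big_seq_cond [X in _ + X]big1 ?addr0 => [|be].
  rewrite (bigD1 i) //= eqxx expr1n mul1r big1 ?mulr1 // => j ji.
  by rewrite mulmnE mnm1E [i == j]eq_sym (negPf ji) mul0n expr0.
by case/andP => bep ne; exact: term.
Qed.

(** Let g be the form of lowest degree d in [h]. A matrix sending the last basis vector to v turns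
    the coefficient at the d-th power of the last variable into g(v), so any v with g(v) nonzero
    will do. *)
Lemma regular_coordinates (h : O) : h != 0 ->
  exists2 M : 'M[K]_m.+1, M \in unitmx & exists d,
    linsub M h (U_(ord_max) *+ d)%MM != 0 /\
    forall be, (mdeg be < d)%N -> linsub M h be = 0.
Proof.
move=> h0; have [al0 hal0 hlow] := min_coef h0; pose d := mdeg al0.
have {}hlow be : (mdeg be < d)%N -> h be = 0.
  by move=> lt; apply/hlow/lt_mdeg_ltmc.
pose g : {mpoly K[m.+1]} := \sum_(al : 'X_{1..m.+1 < d.+1})
  (if mdeg al == d then h al else 0) *: 'X_[al].
have gE be : (mdeg be < d.+1)%N -> g@_be = if mdeg be == d then h be else 0.
  by move=> lt; exact: (mcoeff_mpoly (fun al => if mdeg al == d then h al else 0) lt).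
(* The extra factor makes the last entry of v nonzero, so that the identity matrix with v as last
   column is invertible. *)
have g0 : g * 'X_ord_max != 0.
  rewrite mulf_neq0 //; last first.
    apply/eqP => /(congr1 (mcoeff U_(ord_max)%MM)) /eqP.
    by rewrite mcoeffX eqxx mcoeff0 oner_eq0.
  apply/eqP => /(congr1 (mcoeff al0)) /eqP.
  by rewrite gE // eqxx mcoeff0 (negPf hal0).
have [v] := mpoly_nonroot g0; rewrite mevalM mevalXU mulf_eq0 negb_or => /andP[gv vm].
pose M : 'M[K]_m.+1 := \matrix_(j, i) if i == ord_max then v j else (i == j)%:R.
have Munit : M \in unitmx.
  rewrite unitmxE -det_tr det_trig; last first.
    apply/is_trig_mxP => i j ij; rewrite !mxE; case: eqP => [iE|_].
      by move: ij; rewrite iE ltnNge -ltnS ltn_ord.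
    by case: (i =P j) => // E; rewrite E ltnn in ij.
  rewrite unitfE prodf_seq_neq0; apply/allP => i _ /=; rewrite !mxE.
  by case: (i =P ord_max) => [->|_] //; rewrite eqxx oner_neq0.
exists M => //; exists d; have lt_d : (mdeg (U_(ord_max) *+ d : 'X_{1..m.+1})%MM < d.+1)%N.
  by rewrite mdegMn mdeg1 mul1n.
have Mlow n be : (mdeg be < n)%N -> (n <= d)%N -> linsub M h be = 0.
  move=> lt nd; rewrite [LHS](lsubE _ _ lt); apply: (@comp_linear_low _ _ M _ n) => //.
  move=> ga lt'; rewrite (trunc_coef _ lt') hlow //; exact: leq_trans nd.
split; last by move=> be lt; exact: (Mlow d).
have hg be : (mdeg be < d.+1)%N -> (trunc d.+1 h)@_be = g@_be.
  move=> lt; rewrite (trunc_coef _ lt) gE //; case: eqP => // ne; rewrite hlow //.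
  by rewrite ltn_neqAle -ltnS lt andbT; apply/eqP.
rewrite [X in X != 0](lsubE _ _ lt_d) (comp_linear_eq (n := d.+1) M hg) //.
rewrite homog_axis_coef.
  rewrite comp_mpoly_meval; congr (_ != 0): gv; apply: meval_eq => j.
  rewrite tnth_mktuple /linear_form raddf_sum /= (bigD1 ord_max) //= mevalZ mevalXU.
  rewrite mxE !eqxx mulr1 big1 ?addr0 // => i ne.
  by rewrite mevalZ mevalXU (negPf ne) mulr0.
rewrite comp_mpolyEX big_seq rpred_sum // => be beg; rewrite dhomogZ //.
have := comp_linear_homog M be; congr (_ \is _.-homog).
move: beg; rewrite mcoeff_msupp; have [lt|ge] := ltnP (mdeg be) d.+1.
  by rewrite gE //; case: (mdeg be =P d) => // _; rewrite eqxx.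
rewrite (_ : g@_be = 0) ?eqxx // /g raddf_sum big1 //= => al _.
rewrite mcoeffZ mcoeffX; case: ((al : 'X_{1..m.+1}) =P be) => [E|_]; last by rewrite mulr0.
by have := bmdeg al; rewrite E ltnNge ge.
Qed.

End RegularCoordinates.

(** * Weierstrass division and noetherianity *)

Section Embedding.
Variables (K : numFieldType) (m : nat).
Implicit Types (x y : cps K m) (u : cps K m.+1) (be : 'X_{1..m}) (al : 'X_{1..m.+1}).

Local Notation widen := (widen_ord (leqnSn m)).

Definition mnmcut al : 'X_{1..m} := [multinom al (widen i) | i < m].

Lemma ord_widenP (P : 'I_m.+1 -> Prop) :
  P ord_max -> (forall i, P (widen i)) -> forall i, P i.
Proof.
move=> Pmax Pw i; have [lt|ge] := ltnP i m.
  by have := Pw (Ordinal lt); congr P; exact: val_inj.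
by move: Pmax; congr P; apply: val_inj; apply/eqP; rewrite eqn_leq /= ge -ltnS ltn_ord.
Qed.

Lemma mnmwidenK : cancel (@mnmwiden m) mnmcut.
Proof. by move=> be; apply/mnmP => i; rewrite mnmE mnmwiden_widen. Qed.

Lemma mnmcutK al : mnmwiden (mnmcut al) = (al - U_(ord_max) *+ al ord_max)%MM.
Proof.
apply/mnmP; apply: ord_widenP => [|i]; rewrite mnmBE mulmnE mnm1E.
  by rewrite mnmwiden_ordmax eqxx mul1n subnn.
rewrite mnmwiden_widen mnmE; case: eqP => [E|_]; last by rewrite mul0n subn0.
by move/(congr1 val): E => /= E; have := ltn_ord i; rewrite -E ltnn.
Qed.

Lemma mnmcut_id al : al ord_max = 0%N -> mnmwiden (mnmcut al) = al.
Proof. by move=> al0; rewrite mnmcutK al0 mulm0n subm0. Qed.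

Lemma mdeg_mnmwiden be : mdeg (mnmwiden be) = mdeg be.
Proof.
rewrite !mdegE big_ord_recr /= mnmwiden_ordmax addn0.
by apply: eq_bigr => i _; rewrite mnmwiden_widen.
Qed.

Lemma mwiden_coef (p : {mpoly K[m]}) al :
  (mwiden p)@_al = if al ord_max == 0%N then p@_(mnmcut al) else 0.
Proof.
case: eqP => [al0|alN]; first by rewrite -{1}(mnmcut_id al0) mwiden_mnmwiden.
rewrite (mwidenE (leqnn _)) raddf_sum big1 //= => be _.
rewrite mcoeffZ mcoeffX; case: eqP => [E|_]; last by rewrite mulr0.
by case: alN; rewrite -E mnmwiden_ordmax.
Qed.

Lemma convergent_embed x :
  convergent (fun al => if al ord_max == 0%N then x (mnmcut al) else 0).
Proof.
have [r [M [r0 xM]]] := coefP x; exists r, M; split=> // -[|n].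
  by rewrite big1 ?(bounded_ge0 xM) // => al; have := bmdeg al; rewrite ltn0.
apply: le_trans (xM n.+1).
pose cut (al : 'X_{1..m.+1 < n.+1}) : 'X_{1..m < n.+1} := insubd bm0 (mnmcut al).
have cutK (al : 'X_{1..m.+1 < n.+1}) : (al : 'X_{1..m.+1}) ord_max == 0%N ->
    mnmwiden (cut al) = al.
  move=> /eqP al0; rewrite -[RHS](mnmcut_id al0) [_ (cut al)]insubdK //.
  by rewrite unfold_in -mdeg_mnmwiden mnmcut_id // bmdeg.
apply: (@le_trans _ _ (\sum_(al : 'X_{1..m.+1 < n.+1} | (al : 'X_{1..m.+1}) ord_max == 0%N)
    (fun be : 'X_{1..m < n.+1} => `|x be| * r ^+ mdeg be) (cut al))).
  rewrite [leRHS]big_mkcond; apply: ler_sum => al _; case: ifP => [al0|_].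
    by rewrite -mdeg_mnmwiden cutK // -[mnmcut al]/(mnmcut (al : 'X_{1..m.+1})) -{1}(cutK _ al0) mnmwidenK.
  by rewrite normr0 mul0r.
apply: ler_sum_inj => // [be _|al al' al0 al'0 E].
  by rewrite mulr_ge0 // exprn_ge0 // ltW.
by apply: val_inj; rewrite /= -(cutK _ al0) E cutK.
Qed.

Definition embed x : cps K m.+1 := CPS (convergent_embed x).

Lemma embed_coef x be : embed x (mnmwiden be) = x be.
Proof. by rewrite /= mnmwiden_ordmax mnmwidenK. Qed.

Lemma trunc_embed n x al : (mdeg al < n)%N ->
  (trunc n (embed x))@_al = (mwiden (trunc n x))@_al.
Proof.
move=> lt; rewrite (trunc_coef _ lt) mwiden_coef /=; case: eqP => // al0.
by rewrite trunc_coef // -mdeg_mnmwiden mnmcut_id.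
Qed.

Lemma embed_zmod_morphism : zmod_morphism embed.
Proof.
move=> x y; apply: cpsP => al; rewrite /= /psadd /psopp /=.
by case: ifP; rewrite ?subrr.
Qed.

Lemma embed_monoid_morphism : monoid_morphism embed.
Proof.
split=> [|x y]; apply: cpsP => al.
  have [[be ->]|nbe] := pselect (exists be, al = mnmwiden be).
    rewrite embed_coef /= /ps1; congr (_%:R); congr nat_of_bool.
    by rewrite -mnmwiden0 (inj_eq (@inj_mnmwiden m)).
  rewrite /= /ps1; case: eqP => [al0|ne]; first by case: nbe; exists (mnmcut al); rewrite mnmcut_id.
  by case: eqP ne => // -> []; rewrite mnm0E.
have lt := ltnSn (mdeg al); set n := (mdeg al).+1 in lt.
rewrite (cpsM_coef _ _ lt).
transitivity ((mwiden (trunc n x * trunc n y))@_al).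
  rewrite mwiden_coef /=; case: eqP => // al0.
  by rewrite (@psmul_trunc _ _ n) // -mdeg_mnmwiden mnmcut_id.
rewrite mwidenM; transitivity ((trunc n (embed x) * mwiden (trunc n y))@_al).
  by apply: (@mcoeffM_eq _ _ n) => // be lt'; rewrite trunc_embed.
rewrite ![trunc n (embed x) * _]mulrC.
by apply: (@mcoeffM_eq _ _ n) => // be lt'; rewrite trunc_embed.
Qed.

HB.instance Definition _ :=
  GRing.isZmodMorphism.Build (cps K m) (cps K m.+1) embed embed_zmod_morphism.
HB.instance Definition _ :=
  GRing.isMonoidMorphism.Build (cps K m) (cps K m.+1) embed embed_monoid_morphism.

Lemma deriv_embed_widen i x : deriv_cps (widen i) (embed x) = embed (deriv_cps i x).
Proof.
apply: cpsP => al; rewrite /= /psderiv /= mnmDE mnm1E.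
have -> : (widen i == ord_max :> 'I_m.+1) = false.
  by apply/eqP => /(congr1 val) /= E; have := ltn_ord i; rewrite {1}E ltnn.
rewrite addn0; case: eqP => [al0|]; last by rewrite mulr0.
rewrite /psderiv mnmE; congr (_ * x _); apply/mnmP => j.
by rewrite !(mnmE, mnmDE).
Qed.

Lemma deriv_embed_max x : deriv_cps ord_max (embed x) = 0.
Proof.
apply: cpsP => al; rewrite /= /psderiv /= mnmDE mnm1E eqxx addn1.
by rewrite mulr0.
Qed.

Lemma convergent_slice u j :
  convergent (fun be => u (mnmwiden be + U_(ord_max) *+ j)%MM).
Proof.
have [r [M [r0 uM]]] := coefP u; exists r, (M / r ^+ j); split=> // n.
rewrite ler_pdivlMr ?exprn_gt0 // mulr_suml; apply: le_trans (uM (n + j)%N).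
have lt (be : 'X_{1..m < n}) : (mdeg (mnmwiden be + U_(ord_max) *+ j)%MM < n + j)%N.
  by rewrite mdegD mdeg_mnmwiden mdegMn mdeg1 mul1n ltn_add2r bmdeg.
apply: (@le_trans _ _ (\sum_(be : 'X_{1..m < n})
    (fun al : 'X_{1..m.+1 < n + j} => `|u al| * r ^+ mdeg al) (BMultinom (lt be)))).
  apply: ler_sum => be _ /=.
  by rewrite mdegD mdeg_mnmwiden mdegMn mdeg1 mul1n exprD mulrA.
apply: ler_sum_inj => // [al _|be be' _ _ /(congr1 val) /= /addIm /inj_mnmwiden /val_inj //].
by rewrite mulr_ge0 // exprn_ge0 // ltW.
Qed.

Definition slice j u : cps K m := CPS (convergent_slice u j).

Lemma slice_sum d u : (forall al, (d <= al ord_max)%N -> u al = 0) ->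
  u = \sum_(j < d) embed (slice j u) * cpsX K ord_max ^+ j.
Proof.
move=> u0; apply: cpsP => al; rewrite cps_sum_coef.
have coefE (j : 'I_d) : (embed (slice j u) * cpsX K ord_max ^+ j) al =
    if al ord_max == j then u al else 0.
  rewrite mulrC cpsXn monomialM mul1r.
  have -> : (U_(ord_max) *+ j <= al)%MM = (j <= al ord_max)%N.
    apply/mnm_lepP/idP => [/(_ ord_max)|le i]; rewrite mulmnE mnm1E ?eqxx ?mul1n //.
    by case: eqP => [<-|]; rewrite ?mul1n.
  rewrite /= mnmBE mulmnE mnm1E eqxx mul1n subn_eq0.
  case: (ltngtP (al ord_max) j) => // E; congr (u _).
  rewrite mnmcut_id; last by rewrite mnmBE mulmnE mnm1E eqxx mul1n E subnn.
  rewrite submK //; apply/mnm_lepP => i; rewrite mulmnE mnm1E.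
  by case: eqP => [<-|]; rewrite ?mul1n ?E.
under eq_bigr do rewrite coefE.
have [lt|ge] := ltnP (al ord_max) d; last by rewrite u0 // big1 // => j _; case: ifP.
rewrite (bigD1 (Ordinal lt)) //= eqxx big1 ?addr0 // => j ne; case: eqP => // E.
by case/eqP: ne; exact: val_inj.
Qed.

(** The last variable gets weight 1 and the others weight d + 1. A monomial of weight at most d is
    then a power of the last variable, so the d-th power is the only such monomial in [h]; the
    remainder has degree below d in the last variable and splits into slices. *)
Lemma weierstrass_division d (h u : cps K m.+1) :
  h (U_(ord_max) *+ d)%MM != 0 -> (forall al, (mdeg al < d)%N -> h al = 0) ->
  exists q (c : 'I_d -> cps K m),
    u = q * h + \sum_(j < d) embed (c j) * cpsX K ord_max ^+ j.
Proof.
move=> hd hlow; pose w (i : 'I_m.+1) := if i == ord_max then 1%N else d.+1.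
have [||be ne wle|q [r [-> r0]]] := @weighted_division K _ w h u (U_(ord_max) *+ d)%MM.
- by move=> i; rewrite /w; case: ifP.
- by [].
- apply: hlow; have wd : wdeg w (U_(ord_max) *+ d)%MM = d.
    rewrite /wdeg (bigD1 ord_max) //= /w eqxx mul1n mulmnE mnm1E eqxx mul1n.
    rewrite big1 ?addn0 // => i ni; rewrite mulmnE mnm1E [ord_max == i]eq_sym (negPf ni).
    by rewrite mul0n muln0.
  rewrite wd in wle; have be0 i : i != ord_max -> be i = 0%N.
    move=> ni; apply/eqP; rewrite -leqn0 leqNgt; apply/negP => bi.
    move: wle; rewrite /wdeg (bigD1 i) //= /w (negPf ni) leqNgt => /negP; apply.
    by apply: ltn_addr; rewrite leq_pmulr.
  have mE : mdeg be = be ord_max.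
    by rewrite mdegE (bigD1 ord_max) //= big1 ?addn0.
  have wE : wdeg w be = be ord_max.
    rewrite /wdeg (bigD1 ord_max) //= /w eqxx mul1n big1 ?addn0 // => i ni.
    by rewrite be0 // muln0.
  rewrite mE ltn_neqAle -{2}wE wle andbT; apply: contra ne => /eqP E.
  apply/eqP/mnmP => i; rewrite mulmnE mnm1E; case: eqP => [<-|/eqP ni].
    by rewrite mul1n.
  by rewrite mul0n be0 // eq_sym.
exists q, (fun j => slice j r); congr (_ + _); apply: slice_sum => al le.
apply: r0; apply/mnm_lepP => i; rewrite mulmnE mnm1E.
by case: eqP => [<-|]; rewrite ?mul1n.
Qed.

End Embedding.

(** The first coordinates of [N] form an ideal; subtracting lifts of its generators leaves elements
    with first coordinate zero, a submodule in d - 1 coordinates. *)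
Lemma noetherian_submodule (A : comNzRingType) d (N : set ('I_d -> A)) :
  noetherian A -> N (fun=> 0) ->
  (forall a x y, N x -> N y -> N (fun i => a * x i + y i)) ->
  exists n (g : 'I_n -> 'I_d -> A), (forall l, N (g l)) /\
    forall x, N x -> exists c, forall i, x i = \sum_l c l * g l i.
Proof.
move=> noethA; elim: d N => [|d IH] N N0 NL.
  by exists 0%N, (fun _ _ => 0); split=> [[]//|x _]; exists (fun=> 0); case.
have Nsum n (c : 'I_n -> A) g : (forall l, N (g l)) ->
    N (fun i => \sum_l c l * g l i).
  elim: n c g => [|n IHn] c g Ng.
    by under eq_fun do rewrite big_ord0.
  under eq_fun do rewrite big_ord_recl; apply: NL => //.
  exact: (IHn (fun l => c (lift ord0 l)) (fun l => g (lift ord0 l))).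
pose I0 : set A := [set a | exists2 x, N x & x ord0 = a]%classic.
have idI0 : ideal I0.
  split; first by exists (fun=> 0).
  by move=> a _ _ [x Nx <-] [y Ny <-]; exists (fun i => a * x i + y i) => //; exact: NL.
have [n [g [/= I0g gI0]]] := noethA _ idI0.
have /choice[X XP] : forall l, exists x, N x /\ x ord0 = g l.
  by move=> l; have [x] := I0g l; exists x.
pose ext (y : 'I_d -> A) i := if unlift ord0 i is Some j then y j else 0.
have ext0 y : ext y ord0 = 0 by rewrite /ext unlift_none.
have extS y j : ext y (lift ord0 j) = y j by rewrite /ext liftK.
have [||n' [g' [Ng' g'N]]] := IH [set y | N (ext y)]%classic.
- rewrite /=; have -> // : ext (fun=> 0) = fun=> 0.
  by apply/funext => i; rewrite /ext; case: unlift.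
- move=> a x y /= /(NL a) H /H; congr N; apply/funext => i.
  by rewrite /ext; case: unlift => //; rewrite mulr0 addr0.
exists (n + n')%N, (fun l => match fintype.split l with inl j => X j | inr j => ext (g' j) end).
split=> [l|x Nx].
  by case: fintype.splitP => j _; [exact: (XP j).1|exact: Ng'].
have [c cE] : exists c, x ord0 = \sum_l c l * g l.
  by apply: ideal_span_range; apply: gI0; exists x.
pose y i := x i - \sum_l c l * X l i.
have Ny : N (ext (fun j => y (lift ord0 j))).
  have := NL (-1) (fun i => \sum_l c l * X l i) x (Nsum _ _ _ (fun l => (XP l).1)) Nx.
  congr N; apply/funext => i; have [j ->|->] := unliftP ord0 i.
    by rewrite extS /y mulN1r addrC.
  rewrite ext0 mulN1r cE addrC -sumrB big1 // => l _.
  by rewrite (XP l).2 subrr.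
have [c' c'E] := g'N _ Ny.
exists (fun l => match fintype.split l with inl j => c j | inr j => c' j end) => i.
rewrite big_split_ord /=.
under eq_bigr => l _ do rewrite -[lshift _ l]/(unsplit (inl l)) unsplitK.
under [X in _ + X]eq_bigr => l _ do rewrite -[rshift _ l]/(unsplit (inr l)) unsplitK.
have [j ->|->] := unliftP ord0 i.
  under [X in _ + X]eq_bigr => l _ do rewrite extS.
  by rewrite -c'E /y addrC subrK.
under [X in _ + X]eq_bigr => l _ do rewrite ext0 mulr0.
rewrite [X in _ + X]big1 // addr0 cE; apply: eq_bigr => l _.
by rewrite (XP l).2.
Qed.

Section NoetherianSeries.
Variable K : numFieldType.

Lemma finitely_generated_linsub m (M N : 'M[K]_m) (I : set (cps K m)) :
  M *m N = 1%:M -> finitely_generated [set x | I (linsub N x)]%classic ->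
  finitely_generated I.
Proof.
move=> MN [n [g [Ig gI]]]; exists n, (fun i => linsub N (g i)); split=> // x Ix.
have /gI/ideal_span_range[c cE] : [set x | I (linsub N x)]%classic (linsub M x).
  by rewrite /= linsubK.
exists n, (fun i => linsub N (c i)), (fun i => linsub N (g i)).
split=> [i|]; first by exists i.
rewrite -[x](linsubK _ MN) cE rmorph_sum; apply: eq_bigr => i _.
by rewrite rmorphM.
Qed.

Lemma cps0_div (h u : cps K 0) : h != 0 -> exists q, u = q * h.
Proof.
move=> h0; have h00 : h 0%MM != 0.
  apply: contra h0 => /eqP h00; apply/eqP/cpsP => al.
  by rewrite (_ : al = 0%MM) //; apply/mnmP => -[].
have [//|be ne _|q [r [-> r0]]] := @weighted_division K _ (fun=> 1%N) h u 0%MM _ h00.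
  by case/eqP: ne; apply/mnmP => -[].
exists q; have -> : r = 0 by apply: cpsP => al; apply: r0; apply/mnm_lepP => -[].
by rewrite addr0.
Qed.

(** Once some h in the ideal is regular of order d in the last variable, division by h shows that h
    and the polynomials of degree below d in the ideal generate it; the latter form a submodule of
    the d-th power of the ring in one variable less. *)
Lemma noetherian_cps m : noetherian (cps K m).
Proof.
elim: m => [|m IH] I idI.
all: have [[h [Ih h0]]|I0] := pselect (exists h, I h /\ h != 0); last first.
- exists 0%N, (fun=> 0); split=> [[]//|x Ix]; suff -> : x = 0.
    exact: (ideal0 (ideal_ideal_span _)).
  by apply/eqP/negP => /negP x0; apply: I0; exists x.
- exists 1%N, (fun=> h); split=> // u _; have [q ->] := cps0_div u h0.
  apply: idealM; first exact: ideal_ideal_span.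
  by apply: mem_ideal_span; exists ord0.
- exists 0%N, (fun=> 0); split=> [[]//|x Ix]; suff -> : x = 0.
    exact: (ideal0 (ideal_ideal_span _)).
  by apply/eqP/negP => /negP x0; apply: I0; exists x.
have [M Munit [d [hd hlow]]] := regular_coordinates h0.
apply: (finitely_generated_linsub (mulmxV Munit)).
set J := [set x | _]%classic; pose h' := linsub M h.
have Jh' : J h' by rewrite /J /h' /= linsubK // mulmxV.
have idJ : ideal J.
  split=> [|a x y Jx Jy]; rewrite /J /= ?rmorph0; first exact: ideal0.
  by rewrite rmorphD rmorphM; exact: idI.2.
pose S (c : 'I_d -> cps K m) := \sum_(j < d) embed (c j) * cpsX K ord_max ^+ j.
have SL a x y : S (fun j => a * x j + y j) = embed a * S x + S y.
  rewrite mulr_sumr -big_split; apply: eq_bigr => j _ /=.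
  by rewrite rmorphD rmorphM mulrDl mulrA.
have S0 : S (fun=> 0) = 0.
  by rewrite /S big1 // => j _; rewrite rmorph0 mul0r.
have [||n [g [Jg gJ]]] := @noetherian_submodule _ d [set c | J (S c)]%classic IH.
- by rewrite /= S0; exact: ideal0.
- by move=> a x y Jx Jy; rewrite /= SL; exact: idJ.2.
exists n.+1, (fun i => if unlift ord0 i is Some l then S (g l) else h').
split=> [i|u Ju]; first by case: unlift.
have [q [c uE]] := weierstrass_division u hd hlow.
set T := (X in ideal_span X); have idT : ideal (ideal_span T) by exact: ideal_ideal_span.
have Th' : ideal_span T h' by apply: mem_ideal_span; exists ord0; rewrite // unlift_none.
rewrite uE; apply: idealD => //; first exact: idealM.
have /gJ[e eE] : [set c | J (S c)]%classic c.
  rewrite /= (_ : S c = u - q * h'); first by apply: idealB => //; exact: idealM.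
  by rewrite uE addrC addKr.
rewrite -[X in ideal_span _ X]/(S c) (_ : S c = \sum_l embed (e l) * S (g l)).
  apply: ideal_sum => // l; apply: mem_ideal_span; exists (lift ord0 l) => //.
  by rewrite liftK.
rewrite /S; under [RHS]eq_bigr do rewrite mulr_sumr.
rewrite exchange_big; apply: eq_bigr => j _ /=.
rewrite eE rmorph_sum mulr_suml; apply: eq_bigr => l _.
by rewrite rmorphM mulrA.
Qed.

End NoetherianSeries.

(** * Tangent vectors along a prime chain *)

Lemma preim_prime_idealr (A B : comNzRingType) (f : {rmorphism A -> B})
    (P : prime_idealr B) :
  exists Q : prime_idealr A, forall x, (x \in Q) = (f x \in P).
Proof.
have [||a b|Q QE] := @prime_idealr_of A [set x | f x \in P]%classic.
- by split=> [|a x y Px Py] /=; rewrite ?rmorph0 ?rpred0 // rmorphD rmorphM rpredD ?idealMr.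
- by rewrite /= rmorph1 idealr1.
- by rewrite /= rmorphM prime_idealrM => /orP.
by exists Q => x; apply/idP/idP => /QE.
Qed.

Section IntegralOverSlices.
Variables (K : numFieldType) (m d : nat) (h : cps K m.+1).
Hypothesis h_reg : h (U_(ord_max) *+ d)%MM != 0.
Hypothesis h_low : forall al, (mdeg al < d)%N -> h al = 0.

Definition evalp (u : cps K m.+1) (p : {poly cps K m}) : cps K m.+1 :=
  (map_poly (embed (m := m)) p).[u].

Lemma evalpMXaddC u p c : evalp u (p * 'X + c%:P) = evalp u p * u + embed c.
Proof.
by rewrite /evalp rmorphD rmorphM /= map_polyX map_polyC hornerD hornerMX hornerC.
Qed.

(** Modulo [h] the ring is spanned over the slices by the powers of the last variable below d, so
    the characteristic polynomial of multiplication by u vanishes at u. *)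
Lemma monic_relation u : exists2 p : {poly cps K m}, p \is monic &
  exists q, evalp u p = h * q.
Proof.
(* For d = 0 the series [h] is a unit and the constant polynomial 1 is a relation. *)
have [d0|d_gt0] := posnP d.
  exists 1; first exact: monic1.
  have [q [c E]] := weierstrass_division 1 h_reg h_low.
  exists q; rewrite /evalp rmorph1 hornerE [LHS]E mulrC big1 ?addr0 // => j _.
  by suff : (j < 0)%N; [rewrite ltn0|rewrite -d0 ltn_ord].
have /choice[q /choice[c cE]] : forall i : 'I_d, exists q, exists c : 'I_d -> cps K m,
    u * cpsX K ord_max ^+ i = q * h + \sum_(j < d) embed (c j) * cpsX K ord_max ^+ j.
  by move=> i; exact: weierstrass_division.
pose M : 'M[cps K m]_d := \matrix_(i, j) c i j.
exists (char_poly M); first exact: char_poly_monic.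
pose rho := horner_eval u \o map_poly (embed (m := m)).
pose B := map_mx rho (char_poly_mx M).
have detE : evalp u (char_poly M) = \det B by rewrite det_map_mx.
pose X : 'cV[cps K m.+1]_d := \col_i cpsX K ord_max ^+ i.
pose Q : 'cV[cps K m.+1]_d := \col_i q i.
have BX : B *m X = h *: Q.
  apply/colP => i; rewrite !mxE; transitivity
    (u * cpsX K ord_max ^+ i - \sum_(j < d) embed (c i j) * cpsX K ord_max ^+ j).
    rewrite [in LHS](eq_bigr (fun j => (u *+ (i == j)) * cpsX K ord_max ^+ j -
        embed (c i j) * cpsX K ord_max ^+ j)) => [|j _].
      rewrite sumrB; congr (_ - _); rewrite (bigD1 i) //= eqxx mulr1n.
      by rewrite big1 ?addr0 // => j; rewrite eq_sym => /negPf ->; rewrite mul0r.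
    rewrite !mxE /rho /= rmorphB rmorphMn /= map_polyX map_polyC /= /horner_eval.
    by rewrite hornerD hornerN hornerC hornerMn hornerX mulrBl.
  by rewrite cE addrK mulrC.
(* The entry of [X] at index 0 is 1, so row 0 of adj(B) B X = h adj(B) Q reads det B = h times this
   witness. *)
exists ((\adj B *m Q) (Ordinal d_gt0) ord0).
have := congr1 (fun V : 'cV_d => V (Ordinal d_gt0) ord0) (mulmxA (\adj B) B X).
rewrite mul_adj_mx mul_scalar_mx BX -scalemxAr !mxE /= expr0 mulr1 detE => <-.
by [].
Qed.

(** Strict inclusions survive contraction along an integral extension. For u in [Q] outside [P],
    take a monic p of least degree with p(u) in [P]: its constant term lies in [Q], and if it were
    in [P], dividing by u would give a shorter relation. *)
Lemma slice_prime_incomparable (P Q : prime_idealr (cps K m.+1)) :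
  h \in P -> {subset P <= Q} -> ~ {subset Q <= P} ->
  exists c, embed c \in Q /\ embed c \notin P.
Proof.
move=> Ph PQ nQP; have [u [Qu Pu]] : exists u, u \in Q /\ u \notin P.
  apply: contrapT => nu; apply: nQP => u Qu; apply/negP => /negP Pu.
  by apply: nu; exists u.
pose S n := exists2 p : {poly cps K m}, p \is monic & size p = n /\ evalp u p \in P.
have exS : exists n, `[< S n >].
  have [p pm [q pE]] := monic_relation u.
  by exists (size p); apply/asboolP; exists p => //; rewrite pE mulrC idealMr.
case: (ex_minnP exS) => n /asboolP[p pm [pn pP]] nmin.
have pE : p = drop_poly 1 p * 'X + (p`_0)%:P.
  rewrite -{1}(poly_take_drop 1 p) expr1 addrC; congr (_ + _).
  by apply/polyP => -[|i]; rewrite coef_take_poly coefC.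
have size_p : (1 < size p)%N.
  rewrite ltnNge; apply/negP => /size1_polyC pc; move: pP pm.
  rewrite pc /evalp map_polyC hornerC monicE lead_coefC => Pp /eqP p0.
  by move: Pp; rewrite /= p0 rmorph1 idealr1.
have drop_monic : drop_poly 1 p \is monic.
  rewrite monicE lead_coefE size_drop_poly coef_drop_poly.
  have -> : ((size p - 1).-1 + 1 = (size p).-1)%N by lia.
  by rewrite -lead_coefE -monicE.
exists p`_0; move: (pP); rewrite {1}pE evalpMXaddC => P1; split.
  by rewrite -[embed _](addKr (evalp u (drop_poly 1 p) * u)) rpredD // ?rpredN ?idealMr // PQ.
apply/negP => P0; have : evalp u (drop_poly 1 p) * u \in P.
  by rewrite -[_ * u](addrK (embed p`_0)) rpredB.
rewrite prime_idealrM (negPf Pu) orbF => P2.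
have /nmin : `[< S (size (drop_poly 1 p)) >] by apply/asboolP; exists (drop_poly 1 p).
by rewrite size_drop_poly -pn leqNgt ltn_subrL (ltnW size_p).
Qed.

End IntegralOverSlices.

Section Tangent.
Variables (K : numFieldType) (F : fieldType).

(** The derivation along [phi] whose value at the coordinate x_i is t_i. Vanishing on the kernel of
    [phi] means being tangent to the corresponding subvariety at its generic point. *)
Definition tangent m (phi : cps K m -> F) (t : 'I_m -> F) (x : cps K m) : F :=
  \sum_i t i * phi (deriv_cps i x).

Lemma tangentM m (phi : {rmorphism cps K m -> F}) t x y :
  tangent phi t (x * y) = tangent phi t x * phi y + phi x * tangent phi t y.
Proof.
rewrite /tangent mulr_suml mulr_sumr -big_split; apply: eq_bigr => i _ /=.
by rewrite deriv_cpsM rmorphD !rmorphM; ring.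
Qed.

Lemma tangentD m (phi : {rmorphism cps K m -> F}) t x y :
  tangent phi t (x + y) = tangent phi t x + tangent phi t y.
Proof.
rewrite /tangent -big_split; apply: eq_bigr => i _ /=.
by rewrite raddfD rmorphD mulrDr.
Qed.

Lemma natr_neq0 m (phi : {rmorphism cps K m -> F}) n : (n.+1%:R : F) != 0.
Proof.
apply/eqP => n0; have : phi (cpsC m (n.+1%:R^-1 * n.+1%:R)) = 0.
  by rewrite !rmorphM /= !rmorph_nat n0 mulr0.
by rewrite mulVf ?pnatr_eq0 // !rmorph1 => /eqP; rewrite oner_eq0.
Qed.

Lemma tangent_linsub m (N : 'M[K]_m) (phi : {rmorphism cps K m -> F}) t x :
  tangent phi t (linsub N x) =
  tangent (phi \o linsub N) (fun j => \sum_i phi (cpsC m (N j i)) * t i) x.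
Proof.
rewrite /tangent; under eq_bigr do rewrite deriv_linsub rmorph_sum mulr_sumr.
rewrite exchange_big; apply: eq_bigr => j _; rewrite mulr_suml.
by apply: eq_bigr => i _ /=; rewrite rmorphM; ring.
Qed.

Lemma tangent_embed m (phi : {rmorphism cps K m.+1 -> F}) t (x : cps K m) :
  tangent phi t (embed x) =
  tangent (phi \o @embed K m) (fun j => t (widen_ord (leqnSn m) j)) x.
Proof.
rewrite /tangent big_ord_recr /= deriv_embed_max rmorph0 mulr0 addr0.
by apply: eq_bigr => j _; rewrite deriv_embed_widen.
Qed.

(* The minimal polynomial of the last coordinate over the slices is separable,
   hence a tangent vector vanishing on the slices vanishes. *)
Lemma tangent_last m d (h : cps K m.+1) (phi : {rmorphism cps K m.+1 -> F}) t :
  h (U_(ord_max) *+ d)%MM != 0 -> (forall al, (mdeg al < d)%N -> h al = 0) ->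
  phi h = 0 -> (forall x, phi x = 0 -> tangent phi t x = 0) ->
  (forall j, t (widen_ord (leqnSn m) j) = 0) -> t ord_max = 0.
Proof.
move=> h_reg h_low ph0 tker t0; pose psi : {rmorphism cps K m -> F} := phi \o @embed K m.
pose X := cpsX K (@ord_max m).
have evE p : phi (evalp X p) = (map_poly psi p).[phi X].
  by rewrite /evalp -horner_map -map_poly_comp.
(* Here p has only to survive under [psi], not to be monic: the descent passes to its derivative. *)
pose S n := exists2 p : {poly cps K m}, map_poly psi p != 0 &
  size p = n /\ (map_poly psi p).[phi X] = 0.
have exS : exists n, `[< S n >].
  have [p pm [q pE]] := monic_relation h_reg h_low X.
  exists (size p); apply/asboolP; exists p; last first.
    by rewrite -evE pE rmorphM /= ph0 mul0r.
  have : map_poly psi p \is monic by exact: monic_map.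
  exact: monic_neq0.
case: (ex_minnP exS) => n /asboolP[p p0 [pn pX]] nmin.
have tE q : tangent phi t (evalp X q) = (map_poly psi q^`()).[phi X] * t ord_max.
  elim/poly_ind: q => [|q c IH].
    rewrite /evalp deriv0 !rmorph0 !horner0 mul0r /tangent big1 // => i _.
    by rewrite raddf0 rmorph0 mulr0.
  rewrite evalpMXaddC tangentD tangentM IH tangent_embed.
  rewrite [X in _ + X]big1 ?addr0 => [|j _]; last by rewrite t0 mul0r.
  have -> : tangent phi t X = t ord_max.
    rewrite /tangent (bigD1 ord_max) //= deriv_cpsX eqxx rmorph1 mulr1.
    by rewrite big1 ?addr0 // => i /negPf ne; rewrite deriv_cpsX ne rmorph0 mulr0.
  rewrite evE derivD derivM derivX derivC addr0 mulr1 rmorphD rmorphM /= map_polyX.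
  by rewrite hornerD hornerMX mulrDl mulrAC.
have := tE p; rewrite tker ?evE // => /esym/eqP; rewrite mulf_eq0 => /orP[|/eqP //].
have p_neq0 : p != 0 by apply: contraNneq p0 => ->; rewrite rmorph0.
(* By minimality the derivative dies under [psi]; in characteristic zero p then becomes a nonzero
   constant, which has no root. *)
move=> dp0; have dp : map_poly psi p^`() = 0.
  apply/eqP; apply: contraT => ne; have /nmin : `[< S (size p^`()) >].
    by apply/asboolP; exists p^`() => //; split=> //; exact/eqP.
  by rewrite leqNgt -pn lt_size_deriv.
have pC : map_poly psi p = (psi p`_0)%:P.
  apply/polyP => -[|i]; rewrite coefC coef_map //=.
  have /eqP := congr1 (fun q : {poly F} => q`_i) dp.
  rewrite coef0 (coef_map psi) coef_deriv -mulr_natr /= !rmorphM !rmorph_nat mulf_eq0.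
  by rewrite (negPf (natr_neq0 phi i)) orbF => /eqP.
by case/eqP: p0; rewrite pC -[psi _](hornerC _ (phi X)) -pC pX.
Qed.

(* Noether normalization along a prime chain: each step of the chain removes a
   coordinate, and the remaining [d] coordinates determine tangent vectors. *)
Lemma tangent_bound m k (phi : {rmorphism cps K m -> F})
    (C : nat -> prime_idealr (cps K m)) : prime_chain k C ->
  (forall x, (x \in C k) = (phi x == 0)) ->
  exists d (L : 'M[cps K m]_(d, m)), (d + k <= m)%N /\
    forall t, (forall x, phi x = 0 -> tangent phi t x = 0) ->
      (forall j, \sum_i phi (L j i) * t i = 0) -> forall i, t i = 0.
Proof.
elim: m k phi C => [|m IH] k phi C chC CE.
all: have [ker0|/existsNP[h0 /not_implyP[ph0 /eqP h0N]]] :=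
  pselect (forall x, phi x = 0 -> x = 0).
all: try have k0 : (forall x, phi x = 0 -> x = 0) -> k = 0%N by
  case: k chC CE => // k chC CE ker; have [_ []] := chC k (ltnSn k);
  move=> x; rewrite CE => /eqP/ker ->; exact: rpred0.
- exists 0%N, 0; split; first by rewrite k0.
  by move=> t _ _ [].
- have [q] := cps0_div 1 h0N => /(congr1 phi); rewrite rmorph1 rmorphM /= ph0 mulr0.
  by move/eqP; rewrite oner_eq0.
- exists m.+1, 1%:M; split; first by rewrite k0 // addn0.
  move=> t _ L0 i; rewrite -[RHS](L0 i) (bigD1 i) //= mxE eqxx rmorph1 mul1r.
  by rewrite big1 ?addr0 // => j /negPf ne; rewrite mxE eq_sym ne rmorph0 mul0r.
(* The index is 1 for a chain of positive length, whose first member may be the zero ideal, and 0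
   for k = 0, where the nonzero kernel of [phi] provides h. *)
have [h Ch hN] : exists2 h, h \in C (0 < k)%N & h != 0.
  case: k chC CE {k0} => [|k] chC CE; first by exists h0; rewrite // CE ph0.
  have [_ nsub] := chC 0%N isT; apply: contrapT => nh; apply: nsub => x Cx.
  suff -> : x = 0 by exact: rpred0.
  by apply/eqP/negP => /negP xN; apply: nh; exists x.
clear k0.
have CkE i : ((0 < k)%N <= i)%N -> (i <= k)%N -> h \in C i.
  move=> ki; elim: i ki => [|i IHi] ki ik; first by move: ki; case: (0 < k)%N Ch.
  have [iE|iN] := eqVneq ((0 < k)%N : nat) i.+1; first by rewrite -iE.
  have [sub _] := chC i ik; apply/sub/IHi; last exact: ltnW.
  by rewrite -ltnS ltn_neqAle iN.
have [M Munit [d [hreg hlow]]] := regular_coordinates hN.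
pose N := invmx M; have MN : M *m N = 1%:M by exact: mulmxV.
have NM : N *m M = 1%:M by exact: mulVmx.
pose h' := linsub M h; pose phi' : {rmorphism cps K m.+1 -> F} := phi \o linsub N.
have /choice[C' C'E] : forall i, exists Q : prime_idealr (cps K m.+1),
    forall x, (x \in Q) = (linsub N x \in C i) by move=> i; exact: preim_prime_idealr.
(* Members of the chain before the index 0 < k need not contain h and are dropped. A chain of length
   k.-1 in one variable less remains, and its bound gives d' + k <= m + 1. *)
have /choice[D DE] : forall i, exists Q : prime_idealr (cps K m),
    forall x, (x \in Q) = (embed x \in C' (i + (0 < k))%N).
  by move=> i; exact: preim_prime_idealr.
have [|x|d' [L' [dk LP]]] := IH k.-1 (phi' \o @embed K m) D.
- move=> i ik; have ik' : (i + (0 < k) < k)%N.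
    by case: k ik {chC CE CkE Ch C'E DE} => // k; rewrite addn1.
  have [sub nsub] := chC _ ik'; split=> [x|sub'].
    by rewrite !DE !C'E addSn; exact: sub.
  have [|||c [Qc Pc]] := @slice_prime_incomparable _ _ _ h' hreg hlow
     (C' (i + (0 < k))%N) (C' (i + (0 < k)).+1).
  + by rewrite C'E linsubK // CkE ?leq_addl // ltnW.
  + by move=> u; rewrite !C'E; exact: sub.
  + move=> sub''; apply: nsub => u Cu; have := sub'' (linsub M u).
    by rewrite !C'E linsubK //; apply.
  by case/negP: Pc; rewrite -DE; apply: sub'; rewrite DE addSn.
- rewrite DE C'E (_ : k.-1 + (0 < k) = k)%N ?CE //.
  by case: (k) => // k'; rewrite addn1.
pose w := widen_ord (leqnSn m).
(* The conditions [L'] are applied to the first m coordinates of N t, the vector that t becomes in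
   the new coordinates. *)
exists d', (\matrix_(j, i) \sum_l linsub N (embed (L' j l)) * cpsC m.+1 (N (w l) i)).
split; first by case: (k) dk => [|k'] /=; lia.
move=> t tker tL; pose t' j := \sum_i phi (cpsC m.+1 (N j i)) * t i.
have t'ker x : phi' x = 0 -> tangent phi' t' x = 0.
  by move=> px; rewrite -tangent_linsub; exact: tker.
have t'w j : t' (w j) = 0.
  apply: (LP (fun j => t' (w j))) => [x px|l].
    by rewrite -tangent_embed; exact: t'ker.
  rewrite -[RHS](tL l); under [RHS]eq_bigr do rewrite mxE rmorph_sum mulr_suml.
  rewrite exchange_big; apply: eq_bigr => i _; rewrite mulr_sumr.
  by apply: eq_bigr => i' _; rewrite /= rmorphM mulrA.
have t'max : t' ord_max = 0.
  apply: (tangent_last hreg hlow _ t'ker t'w).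
  by rewrite /= linsubK //; apply/eqP; rewrite -CE CkE //; case: (k).
move=> i; transitivity (\sum_j phi (cpsC m.+1 (M i j)) * t' j).
  under eq_bigr do rewrite mulr_sumr.
  rewrite exchange_big /= (bigD1 i) //= [X in _ = _ + X]big1 => [|l li].
    rewrite addr0 -[LHS]mul1r; under [RHS]eq_bigr do rewrite mulrA -!rmorphM.
    rewrite -mulr_suml -!rmorph_sum; congr (_ * _).
    by rewrite -(rmorph1 phi) -(rmorph1 (cpsC m.+1)); congr (phi (cpsC _ _));
       have := congr1 (fun B : 'M_m.+1 => B i i) MN; rewrite !mxE eqxx mulr1n => ->.
  under eq_bigr do rewrite mulrA -!rmorphM.
  rewrite -mulr_suml -!rmorph_sum.
  have := congr1 (fun B : 'M_m.+1 => B i l) MN.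
  by rewrite !mxE eq_sym (negPf li) => ->; rewrite !rmorph0 mul0r.
rewrite big1 // => j _; suff -> : t' j = 0 by rewrite mulr0.
by move: j; apply: ord_widenP.
Qed.

End Tangent.

(** * Jacobian minors *)

Local Open Scope quotient_scope.

Section Quotients.
Variables (A : comNzRingType) (I : idealr A).
Local Notation Q := {ideal_quot I}.

Lemma pi_eq0 a : (\pi_Q a == 0) = (a \in I).
Proof. by rewrite -(rmorph0 \pi_Q) -Quotient.idealrBE subr0. Qed.

Lemma pi_eqP a b : \pi_Q a = \pi_Q b <-> a - b \in I.
Proof. by rewrite Quotient.idealrBE; split=> /eqP. Qed.

Lemma pi_lregP g : GRing.lreg (\pi_Q g) <-> forall a, g * a \in I -> a \in I.
Proof.
split=> [greg a|greg].
  rewrite -!pi_eq0 rmorphM => /eqP E; apply/eqP/greg.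
  by rewrite E mulr0.
move=> x y; rewrite -[x]reprK -[y]reprK -!rmorphM => /pi_eqP.
by rewrite -mulrBr => /greg /pi_eqP.
Qed.

End Quotients.

Section ResidueField.
Variables (A : comNzRingType) (P : prime_idealr A).

Definition residue_domain := {ideal_quot P}.
HB.instance Definition _ := GRing.ComNzRing.on residue_domain.
HB.instance Definition _ := GRing.ComNzRing_hasMulInverse.Build residue_domain
  (@cmulVx residue_domain) (@cunitPl residue_domain) (@cinv_out residue_domain).
HB.instance Definition _ := GRing.ComUnitRing_isIntegral.Build residue_domain
  (@Quotient.rquot_IdomainAxiom A P).

Lemma residue_field : exists (F : fieldType) (phi : {rmorphism A -> F}),
  forall x, (x \in P) = (phi x == 0).
Proof.
pose pi : {rmorphism A -> residue_domain} := \pi_{ideal_quot P}.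
exists {fraction residue_domain}, (@FracField.tofrac residue_domain \o pi) => x.
by rewrite /= tofrac_eq0 -pi_eq0.
Qed.

End ResidueField.

Section IncreasingFamilies.
Variable m : nat.

Definition increasing k (s : 'I_k -> 'I_m) : Prop := {homo s : i j / (i < j)%N}.

Lemma increasing_mono k (s : 'I_k -> 'I_m) : increasing s ->
  {mono s : i j / (i < j)%N}.
Proof.
move=> inc i j; apply/idP/idP => [|/inc //]; apply: contraTT.
by rewrite -!leqNgt leq_eqVlt => /orP[/eqP/val_inj ->//|/inc/ltnW].
Qed.

Lemma increasing_inj k (s : 'I_k -> 'I_m) : increasing s -> injective s.
Proof.
move=> inc i j sE; apply: val_inj; case: (ltngtP i j) => // /inc.
  by rewrite sE ltnn.
by rewrite sE ltnn.
Qed.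

(** Passage between the two indexings: coefficients of forms by sets, minors by increasing
    families. *)
Lemma increasing_enum (L : {set 'I_m}) :
  exists2 s : 'I_#|L| -> 'I_m, increasing s & s @: [set: 'I_#|L|]%SET = L.
Proof.
exists (fun i => enum_val i) => [i j ij|]; last first.
  apply/setP => x; apply/imsetP/idP => [[i _ ->]|xL]; first exact: enum_valP.
  by exists (enum_rank_in xL x); rewrite ?enum_rankK_in.
pose lt_ord := [rel x y : 'I_m | (x < y)%N].
have lt_trans : transitive lt_ord by move=> x y z; exact: ltn_trans.
have srt : sorted lt_ord (enum L).
  rewrite /(enum _) /enum_mem; apply: sorted_filter => //.
  by have := iota_ltn_sorted 0 m; rewrite -val_enum_ord sorted_map enumT.
have x0 : 'I_m := enum_val i.
rewrite !(enum_val_nth x0).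
by apply: (sorted_ltn_nth lt_trans) => //; rewrite inE -cardE.
Qed.

Lemma increasing_enum_card k (L : {set 'I_m}) : #|L| = k ->
  exists2 s : 'I_k -> 'I_m, increasing s & s @: [set: 'I_k]%SET = L.
Proof. by move=> <-; exact: increasing_enum. Qed.

End IncreasingFamilies.

(** [fullrankfun] selects independent columns in no prescribed order; enumerating them again as a
    set makes the family increasing and keeps the span. *)
Lemma row_free_minor (F : fieldType) k m (B : 'M[F]_(k, m)) : row_free B ->
  exists2 s : 'I_k -> 'I_m, increasing s & \det (colsub s B) != 0.
Proof.
move=> Bfree; have Bfull : row_full B^T by rewrite /row_full mxrank_tr.
pose f := fullrankfun Bfull; pose L := (f @: [set: 'I_k])%SET.
have cL : #|L| = k by rewrite card_imset ?cardsT ?card_ord //; exact: fullrankfun_inj.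
have [s' s'inc s'L] := increasing_enum L.
pose s i := s' (cast_ord (esym cL) i); exists s; first by move=> i j ij; exact: s'inc.
have sub : (rowsub f B^T <= rowsub s B^T)%MS.
  apply/row_subP => i; have : f i \in L by rewrite imset_f.
  rewrite -s'L => /imsetP[j _ fE]; rewrite row_rowsub fE.
  have -> : row (s' j) B^T = row (cast_ord cL j) (rowsub s B^T).
    by rewrite row_rowsub /s cast_ordK.
  exact: row_sub.
rewrite -unitfE -unitmxE -unitmx_tr trmx_mxsub -row_full_unit -sub1mx.
by apply: submx_trans sub; rewrite sub1mx fullrowsub_full.
Qed.

Section JacobianMinors.
Variables (K : numFieldType) (m : nat).
Local Notation O := (cps K m).

Definition jac_minor n (g : 'I_n -> O) (s : 'I_n -> 'I_m) : O :=
  \det (\matrix_(i, j) deriv_cps (s j) (g i)).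

Definition fcons n (T : Type) (h : T) (f : 'I_n -> T) (i : 'I_n.+1) : T :=
  if unlift ord0 i is Some j then f j else h.

Lemma fcons0 n T (h : T) (f : 'I_n -> T) : fcons h f ord0 = h.
Proof. by rewrite /fcons unlift_none. Qed.

Lemma fconsS n T (h : T) (f : 'I_n -> T) j : fcons h f (lift ord0 j) = f j.
Proof. by rewrite /fcons liftK. Qed.

Variables (k : nat) (f : 'I_k -> O) (IC : idealr O).
Hypothesis IC_radical : radical_ideal IC.
Hypothesis f_regular : regular_sequence f.
Hypothesis IC_gen : [set` IC]%classic = ideal_span (range f)%classic.

Lemma mem_IC i : f i \in IC.
Proof.
suff : [set` IC]%classic (f i) by [].
by rewrite IC_gen; apply: mem_ideal_span; exists i.
Qed.

Lemma IC_span x : x \in IC -> exists c, x = \sum_i c i * f i.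
Proof.
move=> xI; apply: ideal_span_range.
by rewrite -IC_gen.
Qed.

(* Locally at a minimal prime of [IC], every function vanishing there is a
   combination of the [f i], and so is its differential. *)
Lemma tangent_minimal (F : fieldType) (phi : {rmorphism O -> F})
    (P : prime_idealr O) (h : O) : minimal_prime IC P ->
  (forall x, (x \in P) = (phi x == 0)) -> h \in P ->
  exists (e : F) (c : 'I_k -> F), e != 0 /\ forall j,
    e * phi (deriv_cps j h) = \sum_i c i * phi (deriv_cps j (f i)).
Proof.
move=> minP PE Ph; have [s sP /IC_span[c sh]] := minimal_prime_torsion IC_radical minP Ph.
have phf i : phi (f i) = 0 by apply/eqP; rewrite -PE; apply: minP.1; exact: mem_IC.
exists (phi s), (fun i => phi (c i)); split=> [|j]; first by rewrite -PE.
have := congr1 (fun x => phi (deriv_cps j x)) sh.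
have /eqP ph0 : phi h == 0 by rewrite -PE.
rewrite deriv_cpsM rmorphD !rmorphM /= ph0 mulr0 add0r => ->.
rewrite !raddf_sum; apply: eq_bigr => i _ /=.
by rewrite deriv_cpsM rmorphD !rmorphM /= phf mulr0 add0r.
Qed.

(** By [tangent_minimal] the row (e, -c_1, ..., -c_k) is a nonzero left kernel vector of the matrix
    over the residue field. *)
Lemma jac_minor_minimal (P : prime_idealr O) h (s : 'I_k.+1 -> 'I_m) :
  minimal_prime IC P -> h \in P -> jac_minor (fcons h f) s \in P.
Proof.
move=> minP Ph; have [F [phi PE]] := residue_field P.
have [e [c [e0 ecE]]] := tangent_minimal minP PE Ph.
rewrite PE -det_map_mx; apply/det0P.
exists (\row_i fcons e (fun i => - c i) i).
  by apply/eqP => /rowP/(_ ord0); rewrite !mxE fcons0 => /eqP; apply/negP.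
apply/rowP => j; rewrite !mxE big_ord_recl !mxE !fcons0 ecE -big_split.
by rewrite big1 // => i _; rewrite /= !mxE !fconsS mulNr subrr.
Qed.

(** If the Jacobian matrix had rank below k, stacking it on the matrix of d conditions from
    [tangent_bound] would give rank below m, hence a common nonzero kernel vector v. Killing the
    differentials of the f_i, v kills those of all functions in [P] by [tangent_minimal], and then
    it is zero by [tangent_bound]. *)
Lemma jac_minor_generic (P : prime_idealr O) : minimal_prime IC P ->
  exists2 s : 'I_k -> 'I_m, increasing s & jac_minor f s \notin P.
Proof.
move=> minP; have [F [phi PE]] := residue_field P.
have Pf i : f i \in P by apply: minP.1; exact: mem_IC.
have [C chC CE] := regular_sequence_chain f_regular Pf.
have [x|d [L [dk LP]]] := @tangent_bound _ F m k phi C chC; first by rewrite CE.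
pose J : 'M[F]_(k, m) := \matrix_(i, j) phi (deriv_cps j (f i)).
have Jfree : row_free J.
  rewrite /row_free eqn_leq rank_leq_row /= leqNgt; apply/negP => rJ.
  pose W := col_mx J (map_mx phi L).
  have rW : (\rank W < m)%N.
    apply: leq_trans dk; rewrite -addsmxE addnC.
    apply: (@leq_ltn_trans (\rank J + \rank (map_mx phi L))).
      exact: mxrank_adds_leqif.
    by rewrite -addSn leq_add // rank_leq_row.
  have /rowV0Pn[v vker v0] : kermx W^T != 0.
    by rewrite -mxrank_eq0 mxrank_ker mxrank_tr subn_eq0 -ltnNge.
  have vW : W *m v^T = 0.
    by apply: trmx_inj; rewrite trmx_mul trmxK trmx0; apply/sub_kermxP.
  have [vJ vL] : J *m v^T = 0 /\ map_mx phi L *m v^T = 0.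
    by move: vW; rewrite mul_col_mx => /eqP; rewrite col_mx_eq0 => /andP[/eqP ? /eqP].
  case/eqP: v0; apply/rowP => j; rewrite mxE.
  apply: (LP (fun j => v ord0 j)) => [h ph0|l]; last first.
    have := congr1 (fun V : 'cV_d => V l ord0) vL; rewrite !mxE => vLE.
    by rewrite -[RHS]vLE; apply: eq_bigr => i _; rewrite !mxE.
  have [|e [c [e0 ecE]]] := tangent_minimal (h := h) minP PE; first by rewrite PE ph0.
  apply: (mulfI e0); rewrite mulr0 mulr_sumr.
  under eq_bigr do rewrite mulrCA ecE mulr_sumr.
  rewrite exchange_big big1 //= => i _.
  have := congr1 (fun V : 'cV_k => V i ord0) vJ; rewrite !mxE => vJE.
  rewrite -[RHS](mulr0 (c i)) -[in RHS]vJE mulr_sumr; apply: eq_bigr => l _.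
  by rewrite !mxE mulrCA [v _ _ * _]mulrC.
have [s sinc sdet] := row_free_minor Jfree; exists s => //.
rewrite PE -det_map_mx; congr (\det _ != 0): sdet.
by apply/matrixP => i j; rewrite !mxE.
Qed.

Definition jac_span : set O :=
  ideal_span [set jac_minor f s | s in [set s | increasing s]]%classic.

Lemma jac_span_minor s : increasing s -> jac_span (jac_minor f s).
Proof. by move=> sinc; apply: mem_ideal_span; exists s. Qed.

Lemma jac_span_nonzerodivisor :
  exists2 g, jac_span g & GRing.lreg (\pi_{ideal_quot IC} g).
Proof.
have [n [Q [Qmin QE]]] := minimal_primes (@noetherian_cps K m) IC_radical.
have [|||g Jg gQ] := @prime_avoidance _ jac_span _ Q.
- move=> l; exists (cpsC m l.+1%:R^-1).
  by rewrite -(rmorph_nat (cpsC m)) -rmorphM mulVf ?pnatr_eq0 // rmorph1.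
- exact: ideal_ideal_span.
- move=> i; have [s sinc sP] := jac_minor_generic (Qmin i).
  by exists (jac_minor f s) => //; exact: jac_span_minor.
exists g => //; apply/pi_lregP => a /QE gaQ; apply/QE => i.
by have := gaQ i; rewrite prime_idealrM (negPf (gQ i)).
Qed.

(** A minimal prime of [IC] consists of zero divisors modulo [IC], so g lies in none of the [Q i].
    This makes xi / g meaningful on X. *)
Lemma radical_generic_nonzerodivisor (IX : idealr O) n (Q : 'I_n -> prime_idealr O) g :
  (forall i, minimal_prime IC (Q i)) -> (forall x, x \in IX <-> forall i, x \in Q i) ->
  GRing.lreg (\pi_{ideal_quot IC} g) -> GRing.lreg (\pi_{ideal_quot IX} g).
Proof.
move=> Qmin QE /pi_lregP greg; apply/pi_lregP => a /QE gaQ; apply/QE => i.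
have := gaQ i; rewrite prime_idealrM => /orP[gQ|//].
have [s sQ sg] := minimal_prime_torsion IC_radical (Qmin i) gQ.
by case/negP: sQ; apply: (Qmin i).1; apply: greg; rewrite mulrC.
Qed.

End JacobianMinors.

(** * Differential forms *)

Section OneForms.
Variables (m : nat) (A : comNzRingType).
Implicit Types (v : 'I_m -> A) (w : form m A) (L : {set 'I_m}).

(** [differential h] is by conversion the case where v lists the partial derivatives of h. *)
Definition oneform v : form m A := [ffun I => \sum_(i < m | I == [set i]%SET) v i].

Lemma wedge_oneform v w L : wedge (oneform v) w L =
  \sum_(l in L) (-1) ^+ inversions [set l]%SET (L :\ l)%SET * (v l * w (L :\ l)%SET).
Proof.
rewrite ffunE; under eq_bigr do rewrite ffunE mulr_suml mulr_sumr.
rewrite (exchange_big_dep (fun l : 'I_m => l \in L)) /=; last first.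
  by move=> I l IL /eqP IE; rewrite IE finset.sub1set in IL.
apply: eq_bigr => l lL; rewrite (big_pred1 [set l]%SET) //= => I.
by rewrite /= andb_idl // => /eqP ->; rewrite finset.sub1set.
Qed.

(** The inversions come from the j members of the family before s_j; the wedge sign is thus the sign
    of a cofactor in the first row. *)
Lemma inversions_increasing n (s : 'I_n.+1 -> 'I_m) j : increasing s ->
  inversions [set s j]%SET ((s @: [set: 'I_n.+1]) :\ s j)%SET = j.
Proof.
move=> inc; rewrite /inversions.
pose g (i : 'I_j) : 'I_m * 'I_m := (s j, s (widen_ord (ltnW (ltn_ord j)) i)).
have ginj : injective g.
  by move=> i i' [] /(increasing_inj inc) /(congr1 val) /= /val_inj.
rewrite -[RHS]card_ord -[RHS](cardsT 'I_j) -(card_imset _ ginj); congr #|pred_of_set _|.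
apply/setP => -[p1 p2]; rewrite !inE /=; apply/and3P/imsetP => [[/eqP -> /andP[_]]|[i _ [-> ->]]].
  move=> /imsetP[i _ ->]; rewrite (increasing_mono inc) => ij.
  by exists (Ordinal ij); rewrite ?finset.in_setT //; congr (_, s _); exact: val_inj.
split=> //; last by apply: inc => /=.
rewrite imset_f // andbT; apply/eqP => /(increasing_inj inc) /(congr1 val) /= E.
by have := ltn_ord i; rewrite E ltnn.
Qed.

Lemma wedge_increasing n v w (s : 'I_n.+1 -> 'I_m) : increasing s ->
  wedge (oneform v) w (s @: [set: 'I_n.+1])%SET = \sum_(j < n.+1) (-1) ^+ j *
    (v (s j) * w ((fun i => s (lift j i)) @: [set: 'I_n])%SET).
Proof.
move=> inc; rewrite wedge_oneform big_imset /=; last first.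
  by move=> i j _ _; exact: (increasing_inj inc).
apply: eq_big => [j|j _]; first by rewrite inE.
rewrite inversions_increasing //; congr (_ * (_ * w _)).
apply/setP => x; rewrite !inE; apply/andP/imsetP => [[ne /imsetP[i _ xE]]|[i _ ->]].
  have [i' iE|iE] := unliftP j i; first by exists i'; rewrite ?finset.in_setT // xE iE.
  by rewrite xE iE eqxx in ne.
by rewrite imset_f //; split=> //; rewrite (inj_eq (increasing_inj inc)) eq_sym neq_lift.
Qed.

Lemma homogeneous_oneform_wedge q v w : homogeneous q w ->
  homogeneous q.+1 (wedge (oneform v) w).
Proof.
move=> wq L Lq; rewrite wedge_oneform big1 // => l lL.
by rewrite wq ?mulr0 // => E; apply: Lq; rewrite (cardsD1 l) lL E.
Qed.

Definition wedge_prod k (V : 'I_k -> 'I_m -> A) : form m A :=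
  \big[@wedge m A/form1 m A]_(i < k) oneform (V i).

Lemma homogeneous_wedge_prod k (V : 'I_k -> 'I_m -> A) :
  homogeneous k (wedge_prod V).
Proof.
elim: k V => [|k IH] V; rewrite /wedge_prod.
  by rewrite big_ord0 => L L0; rewrite ffunE; case: eqP.
by rewrite big_ord_recl; apply: homogeneous_oneform_wedge; exact: IH.
Qed.

(** Splitting off the first factor of the product is the expansion of the determinant along its
    first row. *)
Lemma wedge_prod_det k (V : 'I_k -> 'I_m -> A) (s : 'I_k -> 'I_m) : increasing s ->
  wedge_prod V (s @: [set: 'I_k])%SET = \det (\matrix_(i, j) V i (s j)).
Proof.
elim: k V s => [|k IH] V s inc; rewrite /wedge_prod.
  rewrite big_ord0 det_mx00 ffunE; case: eqP => // -[].
  by apply/eqP; rewrite cards_eq0; apply/eqP/setP => x; rewrite inE; apply/imsetP => -[[]].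
rewrite big_ord_recl wedge_increasing // (expand_det_row _ ord0).
apply: eq_bigr => j _; rewrite mxE mulrCA; congr (_ * _).
rewrite /cofactor add0n; congr (_ * _).
rewrite [LHS](IH (fun i => V (lift ord0 i)) (fun i => s (lift j i))); last first.
  by move=> i i' ii'; apply: inc; rewrite /= /bump; lia.
by congr (\det _); apply/matrixP => i i'; rewrite !mxE.
Qed.

Lemma wedgeZ (c : A) (v w : form m A) : wedge v (c *: w) = c *: wedge v w.
Proof.
apply/ffunP => L; rewrite !ffunE scaler_sumr; apply: eq_bigr => I _.
by rewrite ffunE /GRing.scale /=; ring.
Qed.

End OneForms.

Lemma map_form_wedge m (A B : comNzRingType) (h : {rmorphism A -> B}) (v w : form m A) :
  map_form h (wedge v w) = wedge (map_form h v) (map_form h w).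
Proof.
apply/ffunP => L; rewrite !ffunE rmorph_sum; apply: eq_bigr => I _ /=.
by rewrite !ffunE !rmorphM rmorphXn rmorphN rmorph1.
Qed.

Lemma wedge_differential_minor (K : numFieldType) m k (f : 'I_k -> cps K m) h
    (s : 'I_k.+1 -> 'I_m) : increasing s ->
  wedge (differential h) (\big[@wedge m _/form1 m _]_(i < k) differential (f i))
    (s @: [set: 'I_k.+1])%SET = jac_minor (fcons h f) s.
Proof.
move=> inc.
have := wedge_prod_det (fun i l => deriv_cps l (fcons h f i)) inc.
rewrite /wedge_prod big_ord_recl fcons0; under eq_bigr do rewrite fconsS.
by [].
Qed.

Lemma wedge_differentials_minor (K : numFieldType) m k (f : 'I_k -> cps K m)
    (s : 'I_k -> 'I_m) : increasing s ->
  (\big[@wedge m _/form1 m _]_(i < k) differential (f i)) (s @: [set: 'I_k])%SET =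
  jac_minor f s.
Proof. exact: (wedge_prod_det (fun i l => deriv_cps l (f i))). Qed.

Lemma homogeneous_wedge_differentials (K : numFieldType) m k (f : 'I_k -> cps K m) :
  homogeneous k (\big[@wedge m _/form1 m _]_(i < k) differential (f i)).
Proof. exact: (homogeneous_wedge_prod (fun i l => deriv_cps l (f i))). Qed.

Lemma tfemb_div_eq (A : comNzRingType) (x y s t : A) : GRing.lreg s -> GRing.lreg t ->
  tfemb x / tfemb s = tfemb y / tfemb t <-> x * t = y * s.
Proof.
move=> sreg treg; have su := tfemb_unit sreg; have tu := tfemb_unit treg.
split=> [E|E].
  apply: tfemb_inj; rewrite !rmorphM /= -[tfemb x](divrK su) E.
  by rewrite mulrAC divrK.
apply: (mulIr su); apply: (mulIr tu).
by rewrite divrK // mulrAC divrK // -!rmorphM E.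
Qed.

Lemma formZE m (A : comNzRingType) (c : A) (w : form m A) L : (c *: w) L = c * w L.
Proof. by rewrite ffunE. Qed.

Lemma formDE m (A : comNzRingType) (v w : form m A) L : (v + w) L = v L + w L.
Proof. by rewrite ffunE. Qed.

Lemma formBE m (A : comNzRingType) (v w : form m A) L : (v - w) L = v L - w L.
Proof. by rewrite !ffunE. Qed.

Lemma wedgeE m (A : comNzRingType) (v w : form m A) L : wedge v w L =
  \sum_(J : {set 'I_m} | J \subset L)
    (-1) ^+ inversions J (L :\: J)%SET * (v J * w (L :\: J)%SET).
Proof. by rewrite ffunE. Qed.

(** * Clearing the common denominator of meromorphic forms *)

Section FractionForms.
Variables (A : idomainType) (m : nat).
Local Notation mero := (map_form (@FracField.tofrac A)).
Local Notation "x %:F" := (@FracField.tofrac A x) (at level 1, format "x %:F").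
Implicit Types (v w : form m A) (c d : A).

Lemma fracform_coef w L : mero w L = (w L)%:F.
Proof. by rewrite ffunE. Qed.

Lemma fracform_inj v w : mero v = mero w -> v = w.
Proof.
move=> E; apply/ffunP => L; have := congr1 (fun u : form m {fraction A} => u L) E.
by rewrite !fracform_coef => /eqP; rewrite tofrac_eq => /eqP.
Qed.

Lemma fracformD v w : mero (v + w) = mero v + mero w.
Proof. by apply/ffunP => L; rewrite formDE !fracform_coef formDE tofracD. Qed.

Lemma fracformZ c w : mero (c *: w) = c%:F *: mero w.
Proof. by apply/ffunP => L; rewrite formZE !fracform_coef formZE tofracM. Qed.

Lemma fracform_over_inj d v w : d != 0 ->
  (d%:F)^-1 *: mero v = (d%:F)^-1 *: mero w -> v = w.
Proof.
rewrite -tofrac_eq0 => d0 E; apply: fracform_inj.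
by rewrite -[mero v]scale1r -[mero w]scale1r -(divff d0) -!scalerA E.
Qed.

Lemma fracform_overZ d c v :
  c%:F *: ((d%:F)^-1 *: mero v) = (d%:F)^-1 *: mero (c *: v).
Proof. by rewrite fracformZ !scalerA mulrC. Qed.

Lemma fracform_residue d g xi (a w e : form m A) : d != 0 ->
  g%:F *: ((d%:F)^-1 *: mero a) =
    (xi%:F / d%:F) *: mero w + (d%:F)^-1 *: mero e <->
  g *: a = xi *: w + e.
Proof.
move=> d0; rewrite fracform_overZ [xi%:F / _]mulrC -scalerA -fracformZ -scalerDr -fracformD.
by split=> [/(fracform_over_inj d0)|->].
Qed.

End FractionForms.

Section MeromorphicForms.
Variables (R : realType) (m : nat).
Local Notation O := (cps R[i] m).
Local Notation "x %:F" := (@FracField.tofrac O x) (at level 1, format "x %:F").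

Lemma mero_form_wedge (v w : form m O) :
  mero_form (wedge v w) = wedge (mero_form v) (mero_form w).
Proof. exact: (map_form_wedge (@FracField.tofrac O)). Qed.

Lemma over_inj (D : O) (v w : form m O) : D != 0 ->
  (D%:F)^-1 *: mero_form v = (D%:F)^-1 *: mero_form w -> v = w.
Proof. exact: fracform_over_inj. Qed.

Lemma overZ (D c : O) (v : form m O) :
  c%:F *: ((D%:F)^-1 *: mero_form v) = (D%:F)^-1 *: mero_form (c *: v).
Proof. exact: fracform_overZ. Qed.

Lemma over_residue (D g xi : O) (a w e : form m O) : D != 0 ->
  g%:F *: ((D%:F)^-1 *: mero_form a) =
    (xi%:F / D%:F) *: mero_form w + (D%:F)^-1 *: mero_form e <->
  g *: a = xi *: w + e.
Proof. exact: fracform_residue. Qed.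

Lemma ideal_formsP (I : idealr O) q (w : form m O) :
  ideal_forms I q w <-> homogeneous q w /\ forall L, w L \in I.
Proof.
split=> [[n [c [v [cv ->]]]]|[wq wI]].
  have E L : (\sum_i c i *: v i) L = \sum_i v i L * c i.
    by rewrite sum_ffunE; apply: eq_bigr => i _; rewrite ffunE mulrC.
  split=> L => [Lq|]; rewrite E.
    by rewrite big1 // => i _; rewrite (cv i).2 // mul0r.
  by apply: rpred_sum => i _; rewrite idealMr // (cv i).1.
exists #|{set 'I_m}|, (fun i : 'I_#|{set 'I_m}| => w (enum_val i)).
(* The basis forms dx_L, those of degree other than q being replaced by zero so that all are
   homogeneous of degree q. *)
exists (fun i : 'I_#|{set 'I_m}| => [ffun L : {set 'I_m} => ((L == enum_val i) && (#|L| == q))%:R]); split=> [i|].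
  by split=> // L /eqP/negPf Lq; rewrite ffunE Lq andbF.
apply/ffunP => L; rewrite sum_ffunE (bigD1 (enum_rank L)) //= big1 => [|i ne].
  rewrite addr0 !ffunE enum_rankK eqxx /= /GRing.scale /=.
  by case: eqP => [_|/wq ->]; rewrite ?mulr1 ?mul0r.
rewrite !ffunE /GRing.scale /=; case: eqP => [E|_]; last by rewrite mulr0.
by rewrite E enum_valK eqxx in ne.
Qed.

Lemma wedge_mem (I : idealr O) (v w : form m O) :
  (forall L, w L \in I) -> forall L, wedge v w L \in I.
Proof.
by move=> wI L; rewrite ffunE; apply: rpred_sum => J _; rewrite !idealMr.
Qed.

End MeromorphicForms.

(** * Residues as fractions xi / g *)

Section Residues.
Variables (R : realType) (m k : nat).
Local Notation O := (cps R[i] m).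
Local Notation "x %:F" := (@FracField.tofrac O x) (at level 1, format "x %:F").
Variables (IC : idealr O) (f : 'I_k -> O).
Hypothesis IC_radical : radical_ideal IC.
Hypothesis f_regular : regular_sequence f.
Hypothesis IC_gen : [set` IC]%classic = ideal_span (range f)%classic.
Variable IX : idealr O.
Hypothesis minor_IX : forall h s, h \in IX -> increasing s ->
  jac_minor (fcons h f) s \in IX.
Local Notation OX := {ideal_quot IX}.
Local Notation OC := {ideal_quot IC}.
Local Notation W := (\big[@wedge m O/form1 m O]_(i < k) differential (f i)).

(** What a logarithmic form leaves once it is eliminated: the second condition comes from IX w, the
    third says that xi W / g has coefficients in O modulo [IC]. The condition on dh /\ w follows by
    [minor_IX]. *)
Definition residue_datum (g xi : O) : Prop :=
  [/\ GRing.lreg (\pi_OC g), forall h, h \in IX -> xi * h \in IC &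
      forall y, jac_span f y -> exists a, g * a - xi * y \in IC].

Definition residue_value (g xi : O) : totfrac OX :=
  tfemb (\pi_OX xi) / tfemb (\pi_OX g).

(** If f_i were 0, regularity applied to a = 1 would put 1 in the ideal of the preceding
    elements. *)
Lemma f_neq0 i : f i != 0.
Proof.
apply/eqP => fi0; have [freg f1] := f_regular; apply: f1.
apply: (ideal_span_sub (ideal_ideal_span _) _ (freg i 1 _)).
  by move=> _ [j _ <-]; apply: mem_ideal_span; exists j.
by rewrite fi0 mul0r; apply: ideal0; exact: ideal_ideal_span.
Qed.

Lemma denominator_neq0 : \prod_i f i != 0.
Proof. by apply/prodf_neq0 => i _; exact: f_neq0. Qed.

Lemma jac_span_W (L : {set 'I_m}) : #|L| = k -> jac_span f (W L).
Proof.
move=> /increasing_enum_card[s sinc <-].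
by rewrite wedge_differentials_minor //; exact: jac_span_minor.
Qed.

(** With g a = xi W + e, each coefficient gives W_L xi h = g (h a_L) - h e_L, which lies in [IC] for
    h in [IX]. So xi h is killed modulo [IC] by all minors, in particular by a nonzerodivisor among
    their combinations. *)
Lemma is_residue_datum (w : form m {fraction O}) rho :
  log_forms IX IC f k w -> @is_residue R m k IX IC f w rho ->
  exists g xi, residue_datum g xi /\ rho = residue_value g xi.
Proof.
move=> [[a aq <-] logX _] [g [xi [eta [greg [e /ideal_formsP[eq eI] <-] gw rhoE]]]].
exists g, xi; split; last exact: rhoE.
have D0 := denominator_neq0; have {gw}gaE := (over_residue _ _ _ _ _ D0).1 gw.
have gaL L : g * a L = xi * W L + e L.
  by have := congr1 (fun v : form m O => v L) gaE; rewrite !ffunE.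
have haI h L : h \in IX -> h * a L \in IC.
  move=> /logX[e' /ideal_formsP[_ e'I]]; rewrite overZ => /(over_inj D0) e'E.
  by have := e'I L; rewrite e'E ffunE.
have ids (Y : set O) : ideal Y -> (forall L, Y (W L)) -> (jac_span f `<=` Y)%classic.
  move=> idY YW; apply: ideal_span_sub => // _ [s sinc <-].
  by rewrite -(wedge_differentials_minor f sinc).
split; first exact: greg.
  move=> h hX; have [g0 Jg0 g0reg] := jac_span_nonzerodivisor IC_radical f_regular IC_gen.
  apply: ((pi_lregP _ _).1 g0reg).
  apply: (ids [set y | y * (xi * h) \in IC]%classic) Jg0 => [|L /=].
    split=> [|b x y /= xI yI]; first by rewrite /= mul0r rpred0.
    by rewrite mulrDl -mulrA rpredD // idealMr.
  have -> : W L * (xi * h) = g * (h * a L) - h * e L.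
    by transitivity (h * (g * a L - e L)); [rewrite gaL|]; ring.
  by apply: rpredB; apply: idealMr; [exact: haI|exact: eI].
apply: (ids [set y | exists a, g * a - xi * y \in IC]%classic) => [|L /=].
  split=> [|b x y /= [c cI] [d dI]]; first by exists 0; rewrite !mulr0 subrr rpred0.
  exists (b * c + d).
  have -> : g * (b * c + d) - xi * (b * x + y) =
    b * (g * c - xi * x) + (g * d - xi * y) by ring.
  by rewrite rpredD // idealMr.
by exists (a L); rewrite gaL addrAC subrr add0r; exact: eI.
Qed.

(** The coefficients a_L solve g a_L = xi W_L modulo [IC]. Both logarithmic conditions may be tested
    after multiplication by g, where the form becomes xi W: h xi lies in [IC], and the coefficients
    of dh /\ W are minors in [IX], which xi sends into [IC]. *)
Lemma residue_datum_residues g xi :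
  residue_datum g xi -> residues IX IC f (residue_value g xi).
Proof.
move=> [greg xiX xiJ]; set D := (\prod_i f i)%:F.
have /choice[a aP] : forall L : {set 'I_m}, exists b : O,
    (#|L| = k -> g * b - xi * W L \in IC) /\ (#|L| <> k -> b = 0).
  move=> L; have [Lk|Lk] := eqVneq #|L| k; last first.
    by exists 0; split=> // E; rewrite E eqxx in Lk.
  by have [b bI] := xiJ _ (jac_span_W Lk); exists b.
pose al : form m O := [ffun L => a L].
have alq : homogeneous k al by move=> L Lk; rewrite ffunE (aP L).2.
have Wq := homogeneous_wedge_differentials f.
have alI L : (g *: al - xi *: W) L \in IC.
  rewrite !ffunE; have [Lk|/eqP Lk] := eqVneq #|L| k; first exact: (aP L).1.
  by rewrite Wq // (aP L).2 // !scaler0 subr0 rpred0.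
have cancel x : g * x \in IC -> x \in IC by exact: ((pi_lregP _ _).1 greg).
exists (D^-1 *: mero_form al); last first.
  exists g, xi, (D^-1 *: mero_form (g *: al - xi *: W)); split.
  - exact: greg.
  - exists (g *: al - xi *: W); last exact: erefl.
    apply/ideal_formsP; split; last exact: alI.
    by move=> L Lk; rewrite formBE !formZE (Wq _ Lk) (alq _ Lk) !mulr0 subr0.
  - by apply/(over_residue _ _ _ _ _ denominator_neq0); rewrite addrC subrK.
  - exact: erefl.
split.
- by exists al.
- move=> h hX; exists (h *: al); last by rewrite overZ.
  apply/ideal_formsP; split=> L => [Lk|].
    by rewrite formZE (alq _ Lk) mulr0.
  rewrite formZE; apply: cancel.
  have [Lk|/eqP Lk] := eqVneq #|L| k; last by rewrite (alq _ Lk) !mulr0 rpred0.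
  have -> : g * (h * al L) = h * (g *: al - xi *: W) L + W L * (xi * h).
    by rewrite formBE !formZE; ring.
  by apply: rpredD; apply: idealMr; [exact: alI|exact: xiX].
move=> h hX; exists (wedge (differential h) al); last by rewrite wedgeZ mero_form_wedge.
have dq v : homogeneous k v -> homogeneous k.+1 (wedge (differential h) v).
  exact: homogeneous_oneform_wedge.
apply/ideal_formsP; split=> [|L]; first exact: dq.
have [Lk|/eqP Lk] := eqVneq #|L| k.+1; last by rewrite (dq _ alq) // rpred0.
apply: cancel; have [s sinc sL] := increasing_enum_card Lk.
have dWX : wedge (differential h) W L \in IX.
  by rewrite -sL wedge_differential_minor //; exact: minor_IX.
have -> : g * wedge (differential h) al L =
    wedge (differential h) (g *: al - xi *: W) L + xi * wedge (differential h) W L.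
  rewrite !wedgeE !mulr_sumr -big_split; apply: eq_bigr => J _ /=.
  by rewrite formBE !formZE; ring.
by apply: rpredD; [exact: wedge_mem|exact: xiX].
Qed.

Lemma residuesP rho : residues IX IC f rho <->
  exists g xi, residue_datum g xi /\ rho = residue_value g xi.
Proof.
split=> [[w wlog /(is_residue_datum wlog)]//|[g [xi [dat ->]]]].
exact: residue_datum_residues.
Qed.

End Residues.

(** * Residues as homomorphisms *)

Lemma linear_fraction (T : comUnitRingType) (a x z u v : T) :
  u \is a GRing.unit -> v \is a GRing.unit ->
  a * (x / u) + z / v = (a * x * v + z * u) / (u * v).
Proof.
move=> uu vu; rewrite invrM // mulrDl; congr (_ + _).
  by rewrite !mulrA mulrK.
by rewrite [v^-1 * _]mulrC mulrA mulrK.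
Qed.

Section JacobianIdeals.
Variables (R : realType) (m k : nat).
Local Notation O := (cps R[i] m).
Variables (IC : idealr O) (f : 'I_k -> O).
Local Notation OC := {ideal_quot IC}.

Lemma pi_jac_minor s : \pi_OC (jac_minor f s) =
  \det (\matrix_(i < k, j < k) \pi_OC (deriv_cps (s j) (f i))).
Proof. by rewrite -det_map_mx; congr (\det _); apply/matrixP => i j; rewrite !mxE. Qed.

Lemma jacobian_idealP z : jacobian_ideal IC f z <->
  exists2 y, jac_span f y & \pi_OC y = z.
Proof.
split=> [[n [c [g [gP ->]]]]|[_ [n [c [g [gP ->]]]] <-]].
  have /choice[y yP] : forall i, exists y, jac_span f y /\ \pi_OC y = g i.
    move=> i; have [s sinc <-] := gP i; exists (jac_minor f s).
    by split; [exact: jac_span_minor|exact: pi_jac_minor].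
  exists (\sum_i repr (c i) * y i).
    by apply: ideal_sum => [|i]; [exact: ideal_ideal_span|exact: (yP i).1].
  by rewrite rmorph_sum; apply: eq_bigr => i _; rewrite rmorphM /= reprK (yP i).2.
exists n, (fun i => \pi_OC (c i)), (fun i => \pi_OC (g i)); split=> [i|].
  by have [s sinc <-] := gP i; exists s => //; rewrite pi_jac_minor.
by rewrite rmorph_sum; apply: eq_bigr => i _; rewrite rmorphM.
Qed.

End JacobianIdeals.

Section Isomorphism.
Variables (R : realType) (m k : nat).
Local Notation O := (cps R[i] m).
Variables (IC : idealr O) (f : 'I_k -> O).
Hypothesis IC_radical : radical_ideal IC.
Variable IX : idealr O.
Hypothesis ICX : {subset IC <= IX}.
Hypothesis lreg_restr : forall g,
  GRing.lreg (\pi_{ideal_quot IC} g) -> GRing.lreg (\pi_{ideal_quot IX} g).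
Local Notation OX := {ideal_quot IX}.
Local Notation OC := {ideal_quot IC}.
Local Notation datum := (residue_datum IC f IX).
Local Notation value := (residue_value IX).
Local Notation JXC := (jacobian_ideal_restr IX IC f).

Definition is_residue_of (rho : totfrac OX) (g xi : O) := datum g xi /\ rho = value g xi.

Lemma jacobian_ideal_restrP x : JXC x <-> exists2 y, jac_span f y & \pi_OX y = x.
Proof.
split=> [[z /jacobian_idealP[y Jy <-] <-]|[y Jy <-]].
  by exists y => //; rewrite restriction_pi.
exists (\pi_OC y); last by rewrite restriction_pi.
by apply/jacobian_idealP; exists y.
Qed.

(** Equality in the fractions of [OX] puts the difference in [IX] only. Both xi and xi' carry [IX]
    into [IC], so its square lies in [IC], which is radical. *)
Lemma residue_valueP g xi g' xi' : datum g xi -> datum g' xi' ->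
  value g xi = value g' xi' <-> xi * g' - xi' * g \in IC.
Proof.
move=> [greg xiX _] [g'reg xi'X _].
have E := tfemb_div_eq (\pi_OX xi) (\pi_OX xi') (lreg_restr greg) (lreg_restr g'reg).
split=> [/E|dI].
  rewrite -!rmorphM => /pi_eqP dX; apply: (IC_radical (n := 2)).
  have -> : (xi * g' - xi' * g) ^+ 2 =
    g' * (xi * (xi * g' - xi' * g)) - g * (xi' * (xi * g' - xi' * g)) by ring.
  by apply: rpredB; apply: idealMr; [exact: xiX|exact: xi'X].
by apply/E; rewrite -!rmorphM; apply/pi_eqP; exact: ICX.
Qed.

(* [b] is the value at [y] of the homomorphism attached to [rho = xi / g]. *)
Definition acts (rho : totfrac OX) (y : OX) (b : OC) : Prop :=
  exists g xi y', [/\ is_residue_of rho g xi, jac_span f y', \pi_OX y' = y &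
    \pi_OC g * b = \pi_OC (xi * y')].

(** Independence of all choices: two lifts of y differ by an element of [IX], which xi carries into
    [IC], and changing the fraction is covered by [residue_valueP]. *)
Lemma acts_datum rho y b g xi y' : acts rho y b -> is_residue_of rho g xi ->
  \pi_OX y' = y -> \pi_OC g * b = \pi_OC (xi * y').
Proof.
move=> [h [ze [z [[dat' rhoE'] Jz <- bE]]]] [dat rhoE] /pi_eqP yz.
have [hreg zeX _] := dat'; have [greg xiX _] := dat.
have := rhoE; rewrite rhoE' => /(residue_valueP dat' dat) dI.
apply: hreg; rewrite mulrCA bE -!rmorphM; apply/pi_eqP.
have -> : g * (ze * z) - h * (xi * y') = (ze * g - xi * h) * z - h * (xi * (y' - z)).
  by ring.
by apply: rpredB; [rewrite mulrC|]; apply: idealMr => //; exact: xiX.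
Qed.

Lemma acts_inj rho y b b' : acts rho y b -> acts rho y b' -> b = b'.
Proof.
move=> ab [g [xi [y' [dat _ yE b'E]]]]; have := acts_datum ab dat yE.
by rewrite -b'E; have [[greg _ _] _] := dat; move/greg.
Qed.

Lemma acts_exists rho y g xi : is_residue_of rho g xi -> JXC y -> exists b, acts rho y b.
Proof.
move=> dat /jacobian_ideal_restrP[y' Jy' <-]; have [[_ _ xiJ] _] := dat.
have [a aI] := xiJ _ Jy'; exists (\pi_OC a), g, xi, y'; split=> //.
by rewrite -rmorphM; apply/pi_eqP.
Qed.

Lemma acts_linear_arg rho (a : OC) x y b c : acts rho x b -> acts rho y c ->
  acts rho (restriction IX IC a * x + y) (a * b + c).
Proof.
move=> [g [xi [x' [dat Jx' xE bE]]]] ac; have [_ [_ [y' [_ Jy' yE _]]]] := ac.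
have cE := acts_datum ac dat yE.
exists g, xi, (repr a * x' + y'); split=> //.
- by apply: (ideal_ideal_span _).2.
- by rewrite rmorphD rmorphM /= xE yE.
rewrite mulrDr cE mulrCA bE -{1}[a]reprK -rmorphM -rmorphD; congr (\pi_OC _).
by ring.
Qed.

Lemma is_residue_of_linear (a : OC) rho sigma g xi h ze :
  is_residue_of rho g xi -> is_residue_of sigma h ze ->
  is_residue_of (restr_scalar IX IC a * rho + sigma) (g * h) (repr a * xi * h + ze * g).
Proof.
move=> [[greg xiX xiJ] ->] [[hreg zeX zeJ] ->]; split; last first.
  have gu := tfemb_unit (lreg_restr greg); have hu := tfemb_unit (lreg_restr hreg).
  rewrite /residue_value /restr_scalar (linear_fraction _ _ _ gu hu).
  by rewrite !rmorphD !rmorphM.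
split=> [|x xX|y Jy].
- by rewrite rmorphM; exact: lregM.
- have -> : (repr a * xi * h + ze * g) * x = repr a * h * (xi * x) + g * (ze * x) by ring.
  by apply: rpredD; apply: idealMr; [exact: xiX|exact: zeX].
have [b bI] := xiJ _ Jy; have [c cI] := zeJ _ Jy; exists (repr a * b + c).
have -> : g * h * (repr a * b + c) - (repr a * xi * h + ze * g) * y =
  repr a * h * (g * b - xi * y) + g * (h * c - ze * y) by ring.
by apply: rpredD; exact: idealMr.
Qed.

Lemma acts_linear (a : OC) rho sigma y b c : acts rho y b -> acts sigma y c ->
  acts (restr_scalar IX IC a * rho + sigma) y (a * b + c).
Proof.
move=> [g [xi [y' [datr Jy' yE bE]]]] ac; have [h [ze [_ [dats _ _ _]]]] := ac.
have cE := acts_datum ac dats yE.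
exists (g * h), (repr a * xi * h + ze * g), y'; split=> //.
  exact: is_residue_of_linear.
have -> : \pi_OC (g * h) * (a * b + c) =
    a * \pi_OC h * (\pi_OC g * b) + \pi_OC g * (\pi_OC h * c).
  by rewrite rmorphM /=; ring.
rewrite bE cE -{1}[a]reprK -!rmorphM -rmorphD; congr (\pi_OC _).
by ring.
Qed.

Variable g0 : O.
Hypothesis Jg0 : jac_span f g0.
Hypothesis g0_reg : GRing.lreg (\pi_OC g0).
Hypothesis residuesE : forall rho, residues IX IC f rho <->
  exists g xi, is_residue_of rho g xi.

(** The default 0 occurs only for [rho] outside the residues, so linearity in [rho] is asserted on
    residues. *)
Definition residue_hom (rho : totfrac OX) (y : JXC) : OC :=
  if pselect (exists b, acts rho (val y) b) is left e then sval (cid e) else 0.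

Lemma set_valP_JXC (y : JXC) : JXC (val y).
Proof. exact: set_mem (valP y). Qed.

Lemma residue_homP rho (y : JXC) : residues IX IC f rho ->
  acts rho (val y) (residue_hom rho y).
Proof.
move=> /residuesE[g [xi dat]]; rewrite /residue_hom.
case: pselect => [e|[]]; first by case: cid.
exact: acts_exists dat (set_valP_JXC y).
Qed.

Lemma residue_homE rho (y : JXC) b : residues IX IC f rho ->
  acts rho (val y) b -> residue_hom rho y = b.
Proof. by move=> Rrho; apply: acts_inj; exact: residue_homP. Qed.

Lemma residues_submodule :
  submodule_along (restr_scalar IX IC) (residues IX IC f).
Proof.
split.
  apply/residuesE; exists 1, 0; split.
    split=> [|h _|y _]; first by rewrite rmorph1; exact: lreg1.
      by rewrite mul0r rpred0.
    by exists 0; rewrite mulr0 mul0r subrr rpred0.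
  by rewrite /residue_value !rmorph0 mul0r.
move=> a rho sigma /residuesE[g [xi dat]] /residuesE[h [ze dat']]; apply/residuesE.
by do 2 eexists; exact: is_residue_of_linear dat dat'.
Qed.

Lemma residue_hom_linear a rho sigma (y : JXC) :
  residues IX IC f rho -> residues IX IC f sigma ->
  residue_hom (restr_scalar IX IC a * rho + sigma) y =
  a * residue_hom rho y + residue_hom sigma y.
Proof.
move=> Rrho Rsigma; apply: residue_homE; first exact: residues_submodule.2.
by apply: acts_linear; exact: residue_homP.
Qed.

Definition JXC_of y (Jy : jac_span f y) : JXC :=
  exist _ (\pi_OX y) (mem_set ((jacobian_ideal_restrP _).2 (ex_intro2 _ _ y Jy erefl))).

Lemma residue_hom_bij :
  set_bij (residues IX IC f) (hom_along (restriction IX IC) JXC) residue_hom.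
Proof.
split=> [rho Rrho a x y z zE|rho sigma /set_mem Rrho /set_mem Rsigma homE|phi phiP].
- apply: residue_homE => //; rewrite zE.
  by apply: acts_linear_arg; exact: residue_homP.
(* Injectivity: equal values at [g0] give g0 (xi h - ze g) in [IC], and [g0] cancels. *)
- have [g [xi dat]] := (residuesE rho).1 Rrho.
  have [h [ze dat']] := (residuesE sigma).1 Rsigma.
  have bE := acts_datum (residue_homP (JXC_of Jg0) Rrho) dat (erefl _).
  have cE := acts_datum (residue_homP (JXC_of Jg0) Rsigma) dat' (erefl _).
  rewrite dat.2 dat'.2; apply/(residue_valueP dat.1 dat'.1).
  apply: ((pi_lregP _ _).1 g0_reg); have -> : g0 * (xi * h - ze * g) =
    h * (xi * g0) - g * (ze * g0) by ring.
  by apply/pi_eqP; rewrite rmorphM /= -bE rmorphM /= -cE homE mulrCA.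
have J0 : jac_span f 0 := ideal0 (ideal_ideal_span _).
pose y0 := JXC_of Jg0; pose z0 := JXC_of J0; pose xi := repr (phi y0).
(* In [OX] the class of h g0 is zero, so h annihilates phi(g0); this is the condition xi IX in [IC]
   for the fraction phi(g0) / g0. *)
have phi_ann h : h \in IX -> \pi_OC h * phi y0 = 0.
  move=> hX; have /phiP : val z0 = restriction IX IC (\pi_OC h) * val y0 + val z0.
    rewrite restriction_pi //= (_ : \pi_OX h = 0) ?mul0r ?add0r //.
    by apply/eqP; rewrite pi_eq0.
  by move=> /eqP; rewrite -subr_eq subrr eq_sym => /eqP.
(* Both sides compute phi at the product y y'. The term [phi z0] is phi(0), present because
   [hom_along] states additivity and scaling in one formula; it cancels. *)
have phiM (y y' : O) (Jy : jac_span f y) (Jy' : jac_span f y') :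
    \pi_OC y' * phi (JXC_of Jy) = \pi_OC y * phi (JXC_of Jy').
  have Jyy : jac_span f (y' * y) by apply: idealM => //; exact: ideal_ideal_span.
  have E1 : phi (JXC_of Jyy) = \pi_OC y' * phi (JXC_of Jy) + phi z0.
    by apply: phiP; rewrite restriction_pi //= rmorph0 addr0 rmorphM.
  have E2 : phi (JXC_of Jyy) = \pi_OC y * phi (JXC_of Jy') + phi z0.
    by apply: phiP; rewrite restriction_pi //= rmorph0 addr0 rmorphM mulrC.
  by apply: (addIr (phi z0)); rewrite -E1.
have dat : datum g0 xi.
  split=> // [h hX|y Jy].
    by rewrite -pi_eq0 rmorphM /= reprK mulrC phi_ann.
  exists (repr (phi (JXC_of Jy))); apply/pi_eqP.
  by rewrite !rmorphM /= !reprK (phiM _ _ Jy Jg0) mulrC.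
have Rrho : residues IX IC f (value g0 xi) by apply/residuesE; exists g0, xi.
exists (value g0 xi) => //; apply/funext => y; apply: residue_homE => //.
have /jacobian_ideal_restrP[y' Jy' yE] := set_valP_JXC y.
have -> : y = JXC_of Jy' by apply: val_inj; rewrite /= yE.
exists g0, xi, y'; split=> //.
by rewrite (phiM _ _ Jy' Jg0) rmorphM /= reprK mulrC.
Qed.

End Isomorphism.

(** Computing phi(g y) in two ways gives g phi(y) = phi(g) y, so the fraction is phi(g) / g; its
    value at the nonzerodivisor g determines it. *)
Lemma hom_ideal_totfrac (A : comNzRingType) (J : set A) (g : A) (phi : J -> A) :
  ideal J -> J g -> GRing.lreg g -> hom_along id J phi ->
  exists! rho : totfrac A, forall y : J, tfemb (phi y) = rho * tfemb (val y).
Proof.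
move=> idJ Jg greg phiP; have gu := tfemb_unit greg.
pose elt x (Jx : J x) : J := exist _ x (mem_set Jx).
pose g0 := elt g Jg; pose z0 := elt 0 (ideal0 idJ).
have JP (y : J) : J (val y) by exact: set_mem (valP y).
have phiM (y : J) : phi y * g = phi g0 * val y.
  pose w := elt (g * val y) (idealM g idJ (JP y)).
  have E1 : phi w = g * phi y + phi z0 by apply: phiP; rewrite /= addr0.
  have E2 : phi w = val y * phi g0 + phi z0 by apply: phiP; rewrite /= addr0 mulrC.
  by apply: (addIr (phi z0)); rewrite [phi y * g]mulrC -E1 E2 mulrC.
exists (tfemb (phi g0) / tfemb g); split=> [y|rho rhoE].
  by apply: (mulIr gu); rewrite mulrAC divrK // -!rmorphM phiM.
by apply: (mulIr gu); rewrite divrK // rhoE.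
Qed.

Section CompleteIntersection.
Variables (R : realType) (m k : nat).
Local Notation O := (cps R[i] m).
Variables (IC : idealr O) (f : 'I_k -> O).
Hypothesis IC_radical : radical_ideal IC.
Hypothesis f_regular : regular_sequence f.
Hypothesis IC_gen : [set` IC]%classic = ideal_span (range f)%classic.
Local Notation OC := {ideal_quot IC}.

Lemma minors_vanish (IX : idealr O) n (Q : 'I_n -> prime_idealr O) h s :
  (forall i, minimal_prime IC (Q i)) -> (forall x, x \in IX <-> forall i, x \in Q i) ->
  h \in IX -> jac_minor (fcons h f) s \in IX.
Proof.
by move=> Qmin QE /QE hQ; apply/QE => i; apply: (jac_minor_minimal IC_radical IC_gen) (hQ i).
Qed.

(** Minimality over [IC] of the minimal primes of [IX] serves twice: nonzerodivisors stay such on X,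
    and the minors of (h, f) lie in [IX]. *)
Lemma residues_isomorphism (IX : idealr O) : radical_ideal IX ->
  equidimensional_of_codim k IX -> {subset IC <= IX} ->
  submodule_along (restr_scalar IX IC) (residues IX IC f) /\
  exists Phi : totfrac {ideal_quot IX} -> (jacobian_ideal_restr IX IC f -> OC),
    set_bij (residues IX IC f)
      (hom_along (restriction IX IC) (jacobian_ideal_restr IX IC f)) Phi /\
    forall a rho sigma, residues IX IC f rho -> residues IX IC f sigma ->
      forall y : jacobian_ideal_restr IX IC f,
      Phi (restr_scalar IX IC a * rho + sigma) y = a * Phi rho y + Phi sigma y.
Proof.
move=> IX_radical equi ICX.
have [n [Q [QminX QE]]] := minimal_primes (@noetherian_cps _ m) IX_radical.
have Qmin i : minimal_prime IC (Q i).
  exact: equidimensional_minimal f_regular IC_gen ICX equi (QminX i).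
have lreg_restr := fun g => @radical_generic_nonzerodivisor _ _ IC IC_radical IX n Q g Qmin QE.
have [g0 Jg0 g0_reg] := jac_span_nonzerodivisor IC_radical f_regular IC_gen.
have resE rho := residuesP IC_radical f_regular IC_gen
  (fun h s hX _ => minors_vanish s Qmin QE hX) rho.
split; first exact: (residues_submodule lreg_restr resE).
exists (@residue_hom R m k IC f IX); split.
  exact: (residue_hom_bij IC_radical ICX lreg_restr Jg0 g0_reg resE).
move=> a rho sigma Rrho Rsigma y.
exact: (residue_hom_linear IC_radical ICX lreg_restr resE).
Qed.

(** For IX = IC the condition xi IC in [IC] is automatic, so a residue datum is just a fraction
    multiplying the Jacobian ideal into [OC]; numerator and denominator of an element of the colon
    are lifted to O. *)
Lemma colon_residues : colon (jacobian_ideal IC f) = residues IC IC f.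
Proof.
have [n [Q [Qmin QE]]] := minimal_primes (@noetherian_cps _ m) IC_radical.
have resE rho := residuesP IC_radical f_regular IC_gen
  (fun h s hX _ => minors_vanish s Qmin QE hX) rho.
apply/seteqP; split=> [rho rhoJ|rho /resE[g [xi [[greg _ xiJ] ->]]] z].
  have [x [t [treg rhoE]]] := totfrac_div rho.
  have tu := tfemb_unit treg.
  apply/resE; exists (repr t), (repr x); split; last by rewrite /residue_value !reprK.
  split=> [|h hI|y Jy]; first by rewrite reprK.
    exact: idealMr.
  have Jz : jacobian_ideal IC f (\pi_OC y) by apply/jacobian_idealP; exists y.
  have [b bE] := rhoJ _ Jz; exists (repr b); apply/pi_eqP.
  rewrite !rmorphM /= !reprK; apply: tfemb_inj.
  by rewrite !rmorphM /= -bE rhoE mulrA [_ * (_ / _)]mulrC divrK.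
move=> /jacobian_idealP[y Jy <-]; have [a aI] := xiJ _ Jy.
exists (\pi_OC a); apply: (mulIr (tfemb_unit greg)).
rewrite /residue_value mulrAC divrK ?tfemb_unit // -!rmorphM; congr (tfemb _).
by rewrite [a * g]mulrC; apply/esym/pi_eqP.
Qed.

End CompleteIntersection.

Local Open Scope classical_set_scope.

Theorem proposition3p13 (R : realType) (m k : nat) (k_ge1 : (1 <= k)%N)
    (IC : idealr (cps R[i] m)) (f : 'I_k -> cps R[i] m)
    (IC_radical : radical_ideal IC)
    (f_regular : regular_sequence f)
    (IC_gen : [set` IC] = ideal_span (range f)) :
  (forall IX : idealr (cps R[i] m),
     radical_ideal IX -> equidimensional_of_codim k IX -> {subset IC <= IX} ->
     let RX := residues IX IC f in
     let JXC := jacobian_ideal_restr IX IC f in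
     submodule_along (restr_scalar IX IC) RX /\
     exists Phi : totfrac {ideal_quot IX} -> (JXC -> {ideal_quot IC}),
       set_bij RX (hom_along (restriction IX IC) JXC) Phi /\
       forall a rho sigma, RX rho -> RX sigma -> forall y : JXC,
         Phi (restr_scalar IX IC a * rho + sigma) y = a * Phi rho y + Phi sigma y) /\
  (let JC := jacobian_ideal IC f in
   (forall phi : JC -> {ideal_quot IC}, hom_along id JC phi ->
      exists! rho : totfrac {ideal_quot IC},
        forall y : JC, tfemb (phi y) = rho * tfemb (val y)) /\
   colon JC = residues IC IC f).
Proof.
split=> [IX IX_radical equi ICX|].
  exact: (residues_isomorphism IC_radical f_regular IC_gen IX_radical equi ICX).
split; last exact: (colon_residues IC_radical f_regular IC_gen).
move=> phi; have [g Jg greg] := jac_span_nonzerodivisor IC_radical f_regular IC_gen.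
apply: (hom_ideal_totfrac _ _ greg); first exact: ideal_ideal_span.
by apply/jacobian_idealP; exists g.
Qed.
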